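(* For completely reducible trigonal curves $C$ of maximal degree $2$, there are exactly three combinatorial types of dessins d'enfants $\Gamma_C$, namely $[4,4,2,2]$, $[4,2,2,2,2]$ and $[2,2,2,2,2,2]$.
   Context: A completely reducible trigonal curve (CRTC) $C$ is a curve given by $(y-y_1)(y-y_2)(y-y_3)=0$ with $y_1,y_2,y_3\in\mathbb{C}[x]$; its maximal degree is $\max\{\deg y_1,\deg y_2,\deg y_3\}=n\ge 1$. All curves are assumed to have no triple intersections: there is no $x_0\in\mathbb{C}$ with $y_1(x_0)=y_2(x_0)=y_3(x_0)$, and (the same condition over $x=\infty$) the coefficients of $x^n$ in $y_1,y_2,y_3$ are not all equal. Put $\lambda=\frac{y_1-y_3}{y_2-y_3}:P^1\to P^1$ and $j_C=\frac{4(\lambda^2-\lambda+1)^3}{27\lambda^2(\lambda-1)^2}:P^1\to P^1$ (the $j$-invariant of $C$), where $P^1=\mathbb{C}\cup\{\infty\}$. The dessin d'enfant of $C$ is the embedded graph $\Gamma_C=j_C^{-1}([0,1])\subset P^1$; its $\bullet$-vertices are the points of $j_C^{-1}(0)$ and its $\circ$-vertices are the points of $j_C^{-1}(1)$. Ramification points of $j_C$ with image in $(0,1)$ are called monochrome vertices; they are not regarded as subdividing edges. The regions of $\Gamma_C$ are the connected components of $P^1\setminus\Gamma_C$. A region is an $m$-gon, where $m$ is its number of boundary edges, counted with $\circ$-vertices disregarded as subdivision points (so $m$ is half the number of passages between a $\bullet$-vertex and a $\circ$-vertex made when traversing the whole boundary of the region once). The combinatorial type of $\Gamma_C$ is the list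 of these numbers $m$ over all regions, written in non-increasing order. *)

(* Defs.v *)
From HB Require Import structures.
From mathcomp Require Import all_boot all_order all_algebra.
From mathcomp Require Import complex.
From mathcomp Require Import all_classical all_reals all_analysis.
Import Order.TTheory GRing.Theory Num.Theory numFieldNormedType.Exports.

Set Implicit Arguments.
Unset Strict Implicit.
Unset Printing Implicit Defensive.

Local Open Scope classical_set_scope.
Local Open Scope ring_scope.
Local Open Scope complex_scope.

(* The curve (y - y1)(y - y2)(y - y3) = 0, given by its three components. *)
Record trigonal (R : realType) := Trigonal {
  y1 : {poly R[i]};
  y2 : {poly R[i]};
  y3 : {poly R[i]} }.

Definition max_degree (R : realType) (C : trigonal R) : nat :=
  (maxn (size (y1 C)) (maxn (size (y2 C)) (size (y3 C)))).-1.

Definition no_triple_intersection (R : realType) (C : trigonal R) : Prop :=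
  ~ exists x0 : R[i], (y1 C).[x0] = (y2 C).[x0] /\ (y2 C).[x0] = (y3 C).[x0].

Definition no_triple_intersection_at_infinity
    (R : realType) (C : trigonal R) : Prop :=
  let n := max_degree C in
  ~ ((y1 C)`_n = (y2 C)`_n /\ (y2 C)`_n = (y3 C)`_n).

Definition crtc (R : realType) (n : nat) (C : trigonal R) : Prop :=
  [/\ max_degree C = n, (1 <= n)%N, no_triple_intersection C
    & no_triple_intersection_at_infinity C].

(* [None] is the point at infinity.  The topology of C is carried by the
   regular copy [R[i]^o] of [R[i]]. *)
Definition P1 (R : realType) : topologicalType :=
  one_point_compactification (R[i]^o).

(* Only used when [a] and [b] are not both zero. *)
Definition to_P1 (R : realType) (a b : R[i]) : P1 R :=
  if b == 0 then None else Some (a / b).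

(* The value at infinity is the limit of the rational function: numerator and
   denominator have degree at most the maximal degree n, and for a curve
   without triple intersections their coefficients of x^n are not both zero
   and they have no common root. *)
Definition lambda (R : realType) (C : trigonal R) (x : P1 R) : P1 R :=
  let p := y1 C - y3 C in
  let q := y2 C - y3 C in
  let n := max_degree C in
  if x is Some x0 then to_P1 p.[x0] q.[x0] else to_P1 p`_n q`_n.

Definition j_of_lambda (R : realType) (l : P1 R) : P1 R :=
  if l is Some a then
    to_P1 (4 * (a ^+ 2 - a + 1) ^+ 3) (27 * a ^+ 2 * (a - 1) ^+ 2)
  else None.

Definition j_invariant (R : realType) (C : trigonal R) (x : P1 R) : P1 R :=
  j_of_lambda (lambda C x).

Definition dessin (R : realType) (C : trigonal R) : set (P1 R) :=
  j_invariant C @^-1` [set Some t%:C | t in `[0, 1]%classic].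

Definition regions (R : realType) (C : trigonal R) : set (set (P1 R)) :=
  [set connected_component (~` dessin C) x | x in ~` dessin C].

(* The closed rectangle of height [e] resting on [0, 1]: above it for
   [s = false], below it for [s = true]. *)
Definition half_strip (R : realType) (s : bool) (e : R) : set R[i]^o :=
  [set w | 0 <= complex.Re w <= 1 /\ 0 <= (-1) ^+ s * complex.Im w <= e].

(* A passage along the boundary of the region U between a black vertex (j = 0)
   and a white vertex (j = 1), together with the thin strip of U bordering it.
   Since j is monotone along it, the passage is parametrized by j itself:
   [sigma] restricted to [0, 1] is a path in the dessin which starts at the
   black vertex [sigma 0], ends at the white vertex [sigma 1], meets no other
   such vertex, and turns at the monochrome vertices it meets so as to keep U
   on the same side; the rest of the half-strip is sent into U.
   Walking along the boundary with U on the left, the passage is made from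
   black to white if [s = false] and from white to black if [s = true]; an
   edge with U on both sides thus gives two passages.  The value of [sigma]
   outside the half-strip is irrelevant and is fixed, so that distinct
   functions are distinct passages. *)
Definition passages (R : realType) (C : trigonal R) (U : set (P1 R)) (e : R) :
    set (bool * (R[i]^o -> P1 R)) :=
  [set p | let: (s, sigma) := p in
    [/\ {within half_strip s e, continuous sigma},
        forall w, half_strip s e w -> j_invariant C (sigma w) = Some w,
        forall w, half_strip s e w -> complex.Im w != 0 -> U (sigma w)
      & forall w, ~ half_strip s e w -> sigma w = None]].

(* A traversal of the whole boundary of U (all its components) makes every
   passage exactly once, whence the number of passages is 2m for an m-gon.
   The width e must be small enough for the strips to avoid the branching of j
   off the dessin; it is then immaterial. *)
Definition is_gon (R : realType) (C : trigonal R) (m : nat) (U : set (P1 R)) :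
    Prop :=
  \forall e \near (0 : R)^'+, (passages C U e #= `I_(m.*2))%card.

Definition combinatorial_type (R : realType) (C : trigonal R) (s : seq nat) :
    Prop :=
  sorted geq s /\
  exists U : 'I_(size s) -> set (P1 R),
    [/\ injective U, range U = regions C
      & forall i : 'I_(size s), is_gon C (nth 0%N s i) (U i)].

(* Main.v *)
Require Import Defs.
From mathcomp Require Import all_boot all_order all_algebra.
From mathcomp Require Import complex.
From mathcomp Require Import all_classical all_reals all_analysis.
From mathcomp Require Import ring lra.
Import Order.TTheory GRing.Theory Num.Theory numFieldNormedType.Exports.
Import Normc.
Set Implicit Arguments.
Unset Strict Implicit.
Unset Printing Implicit Defensive.
Local Open Scope classical_set_scope.
Local Open Scope ring_scope.
Local Open Scope complex_scope.

(** Let w be a primitive cube root of unity and consider the Lagrange resolvents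
Z1 = y1 + w^2 y2 + w y3 and Z2 = y1 + w y2 + w^2 y3.  The quotient z = Z1 / Z2
is a Moebius function of lambda for which j = - 4 v / (1 - v)^2 with v = z^3.
Hence j lies in [0, 1] exactly when v lies in [-oo, 0]: in the z-line the dessin
consists of the three rays arg z = pi, pi/3, - pi/3, and its regions are the
three open sectors around the cube roots of unity ([cone], [dessinC]).

For maximal degree 2, Z1 and Z2 are binary quadratic forms in the homogeneous
coordinates of x, without common zero because of the absence of triple
intersections.  Two such forms are combinations of the squares of the same two
linear forms xi1 and xi2 ([simultaneous_squares]).  So z is a Moebius function
of (xi1 / xi2)^2: it has degree 2 and exactly two branch values, those taken
where xi1 = 0 and where xi2 = 0.  If a sector contains no branch value, the
square root is single-valued on it and its preimage has two components, told
apart by the sign of Re (k xi1 conj(xi2)) for a suitable constant k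
([split_region]).  If a sector contains a branch value, its preimage is
connected, since lifting a segment joins each point to a ramification point
([connected_ramified]).

It remains to count the passages along the boundary of each region.  Over a
half-strip resting on [0, 1] the equation j = u is solved by radicals: with
r = sqrt (1 - u) one has v = ((r - 1) / (r + 1)) or its inverse, then z is a cube
root of v, and xi1^2, xi2^2 are linear in (Z1, Z2).  All these roots have
continuous branches when the half-strip is thin ([sqrt_of_linear]), which gives
12 continuous sections of j over each of the two half-strips.  Off the real axis
they are pairwise distinct and exhaust the fibres, and the half-strip is
connected there, so there are no others ([passagesE]).  Of these 24 sections, 8
lie over each sector: its preimage is a 4-gon if it is connected
([gon_sector]), and two 2-gons otherwise ([gon_half_sector]).

Each sector containing a branch value therefore contributes 4 to the type and
each other sector contributes 2, 2 ([type_of_model]).  As there are two branch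
values, zero, one or two sectors contain some, which leaves the three types of
the statement.  They are realized by lambda = x^2, by lambda = x^2 - 1 and by
lambda = (2 x^2 + 1) / (x^2 - 1). *)

(** * Limits of complex functions *)

Section ComplexTopology.
Variable R : realType.
Local Notation C := (R[i]^o).
Local Notation Re := complex.Re.
Local Notation Im := complex.Im.
Implicit Types (x y z : R[i]).

Lemma normc_ge0 x : 0 <= normc x.
Proof. by case: x => a b /=; exact: sqrtr_ge0. Qed.

Lemma normc_sqr x : normc x ^+ 2 = Re x ^+ 2 + Im x ^+ 2.
Proof. by case: x => a b /=; rewrite sqr_sqrtr // addr_ge0 ?sqr_ge0. Qed.

Lemma normcX x n : normc (x ^+ n) = normc x ^+ n.
Proof. by elim: n => [|n IH]; rewrite ?expr0 ?normc1 // !exprS normcM IH. Qed.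

Lemma Re_le_normc x : `|Re x| <= normc x.
Proof.
rewrite -(ler_pXn2r (ltn0Sn 1)) ?nnegrE ?normc_ge0 // normc_sqr real_normK ?num_real //.
by rewrite lerDl sqr_ge0.
Qed.

Lemma Im_le_normc x : `|Im x| <= normc x.
Proof.
rewrite -(ler_pXn2r (ltn0Sn 1)) ?nnegrE ?normc_ge0 // normc_sqr real_normK ?num_real //.
by rewrite lerDr sqr_ge0.
Qed.

Lemma cvgCP (T : Type) (F : set_system T) {FF : Filter F} (f : T -> R[i]) (l : R[i]) :
  (f : T -> C) @ F --> (l : C) <->
  forall e : R, 0 < e -> \forall w \near F, normc (f w - l) < e.
Proof.
split.
  move=> /cvgrPdist_lt h e e0; have := h e%:C; rewrite ltcR => /(_ e0).
  apply: filterS => w; rewrite distrC normc_def ltcR => /le_lt_trans; apply.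
  by case: (f w - l).
move=> h; apply/cvgrPdist_lt => e; rewrite ltcE => /andP[/eqP ei er].
apply: filterS (h (Re e) er) => w hw; rewrite distrC normc_def ltcE /= ei eqxx /=.
by move: hw; case: (f w - l).
Qed.

Lemma cvgRe (T : Type) (F : set_system T) {FF : Filter F} (f : T -> R[i]) (l : R[i]) :
  (f : T -> C) @ F --> (l : C) -> Re (f w) @[w --> F] --> Re l.
Proof.
move=> /cvgCP h; apply/cvgrPdist_lt => e e0.
apply: filterS (h e e0) => w; apply: le_lt_trans; rewrite distrC.
apply: le_trans (Re_le_normc _).
by case: (f w) => a b; case: l {h}.
Qed.

Lemma normc_conj x : normc x^* = normc x.
Proof. by case: x => a b /=; rewrite sqrrN. Qed.

Lemma cvg_conjc (T : Type) (F : set_system T) {FF : Filter F} (f : T -> R[i])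
  (l : R[i]) :
  (f : T -> C) @ F --> (l : C) -> ((f w)^* : C) @[w --> F] --> (l^* : C).
Proof.
move=> /cvgCP h; apply/cvgCP => e e0; apply: filterS (h e e0) => w.
by rewrite -rmorphB normc_conj.
Qed.

Lemma cvg_normc (T : Type) (F : set_system T) {FF : Filter F} (f : T -> R[i])
  (l : R[i]) :
  (f : T -> C) @ F --> (l : C) -> normc (f w) @[w --> F] --> normc l.
Proof.
move=> /cvgCP h; apply/cvgrPdist_lt => e e0.
apply: filterS (h e e0) => w; apply: le_lt_trans.
have t x y : normc x - normc y <= normc (x - y).
  by rewrite lerBlDr; have := le_normcD (x - y) y; rewrite subrK.
rewrite ler_norml lerNl opprB t /=.
by apply: le_trans (t _ _) _; rewrite -normcN opprB.
Qed.

Lemma cvg_Complex (T : Type) (F : set_system T) {FF : Filter F} (f g : T -> R)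
  (a b : R) :
  f @ F --> a -> g @ F --> b -> (f w +i* g w : C) @[w --> F] --> (a +i* b : C).
Proof.
move=> /cvgrPdist_lt hf /cvgrPdist_lt hg; apply/cvgCP => e e0.
have e2 : 0 < e / 2 by lra.
apply: filterS2 (hf _ e2) (hg _ e2) => w h1 h2.
have -> : (f w +i* g w) - (a +i* b) = (f w - a)%:C + (f w - a)%:C * 0
  + 'i * (g w - b)%:C.
  by simpc.
rewrite mulr0 addr0; apply: le_lt_trans (le_normcD _ _) _.
rewrite normcM /= !expr0n /= !(add0r, addr0) !expr1n sqrtr1 mul1r !sqrtr_sqr.
by rewrite distrC [`|g w - b|]distrC; lra.
Qed.

Section Arithmetic.
Context (T : Type) (F : set_system T) {FF : Filter F}.
Implicit Types (f g : T -> R[i]) (a b : R[i]).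

Lemma cvgCM f g a b :
  (f : T -> C) @ F --> (a : C) -> (g : T -> C) @ F --> (b : C) ->
  (f w * g w : C) @[w --> F] --> (a * b : C).
Proof. by move=> hf hg; exact: (@cvgM R[i] T F FF f g a b hf hg). Qed.

Lemma cvgCV f a : a != 0 -> (f : T -> C) @ F --> (a : C) ->
  ((f w)^-1 : C) @[w --> F] --> (a^-1 : C).
Proof. by move=> a0 hf; exact: (@cvgV R[i] T F FF f a a0 hf). Qed.

Lemma cvgCD f g a b :
  (f : T -> C) @ F --> (a : C) -> (g : T -> C) @ F --> (b : C) ->
  (f w + g w : C) @[w --> F] --> (a + b : C).
Proof. by move=> hf hg; exact: (@cvgD R[i] C T F FF f g a b hf hg). Qed.

Lemma cvgCN f a : (f : T -> C) @ F --> (a : C) ->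
  (- f w : C) @[w --> F] --> (- a : C).
Proof. by move=> hf; exact: (@cvgN R[i] C T F FF f a hf). Qed.

Lemma cvgCX f a n : (f : T -> C) @ F --> (a : C) ->
  (f w ^+ n : C) @[w --> F] --> (a ^+ n : C).
Proof.
move=> hf; elim: n => [|n IH]; first by under eq_fun do rewrite expr0; exact: cvg_cst.
by rewrite exprS; under eq_fun do rewrite exprS; exact: cvgCM.
Qed.

End Arithmetic.

(** A root that is Hoelder continuous along the values of [f] inherits the
    convergence of [f]; every branch of a radical below is handled this way. *)
Lemma cvg_root n (T : Type) (F : set_system T) {FF : Filter F} (M : R)
  (f k : T -> R[i]) (l m : R[i]) :
  (f : T -> C) @ F --> (l : C) ->
  (\forall w \near F, normc (k w - m) ^+ n.+1 <= M * normc (f w - l)) ->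
  (k : T -> C) @ F --> (m : C).
Proof.
move=> /cvgCP h hk; apply/cvgCP => e e0.
have M0 : 0 < `|M| + 1 by rewrite ltr_wpDl.
have e1 : 0 < e ^+ n.+1 / (`|M| + 1) by rewrite divr_gt0 // exprn_gt0.
apply: filterS2 hk (h _ e1) => w kw; rewrite ltr_pdivlMr // => fw.
rewrite -(ltr_pXn2r (ltn0Sn n)) ?nnegrE ?normc_ge0 ?(ltW e0) //.
apply: le_lt_trans kw _; apply: le_lt_trans fw; rewrite mulrC.
apply: ler_wpM2l; first exact: normc_ge0.
by apply: le_trans (ler_norm _) _; rewrite lerDl.
Qed.

End ComplexTopology.

(** * The topology of the Riemann sphere *)

Section P1Topology.
Variable R : realType.
Local Notation C := (R[i]^o).
Local Notation Re := complex.Re.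

Lemma continuous_normc : continuous (@normc R : C -> R).
Proof. by move=> x; apply: (@cvg_normc R C (nbhs x) _ id); exact: cvg_id. Qed.

Lemma compact_normc_bounded (K : set C) : compact K ->
  exists2 M : R, 0 < M & forall x, K x -> normc x <= M.
Proof.
move=> cK; have : compact ((@normc R : C -> R) @` K).
  apply: continuous_compact cK; exact: continuous_subspaceT continuous_normc.
move=> /compact_bounded[M [_ hM]]; exists (`|M| + 1); first by rewrite ltr_wpDl.
move=> x Kx; apply: le_trans (ler_norm _) _; apply: (hM (`|M| + 1)).
  by apply: le_lt_trans (ler_norm M) _; rewrite ltrDl.
by exists x.
Qed.

Lemma compact_disc (M : R) : compact ([set x | normc x <= M] : set C).
Proof.
pose S := `[- M, M]%classic `*` `[- M, M]%classic : set (R * R).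
have cS : compact S by apply: compact_setX; exact: segment_compact.
pose f (p : R * R) : C := p.1 +i* p.2.
have cf : continuous f.
  by move=> p; apply: cvg_Complex; [exact: cvg_fst|exact: cvg_snd].
have cfS : compact (f @` S) by apply: continuous_compact cS;
  exact: continuous_subspaceT.
apply: subclosed_compact cfS _.
  have -> : [set x : C | normc x <= M] = (@normc R : C -> R) @^-1` [set t | t <= M]
    by [].
  apply: closed_comp; last exact: closed_le.
  by move=> x _; exact: continuous_normc.
move=> -[a b] /= hM; exists (a, b) => //.
by split; rewrite /= in_itv /= -ler_norml; apply: le_trans hM;
  [exact: (Re_le_normc (a +i* b))|exact: (Im_le_normc (a +i* b))].
Qed.

(** Near infinity, compact subsets of the plane are bounded while the quotient
    of a nonzero limit by a null limit is not. *)
Lemma cvg_to_P1 (T : Type) (F : set_system T) {FF : Filter F} (a b : T -> R[i])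
    (a0 b0 : R[i]) :
  (a : T -> C) @ F --> (a0 : C) -> (b : T -> C) @ F --> (b0 : C) ->
  (a0 != 0) || (b0 != 0) ->
  to_P1 (a w) (b w) @[w --> F] --> (to_P1 a0 b0 : P1 R).
Proof.
move=> ha hb ab0; rewrite {2}/to_P1; case: ifPn => [/eqP b0E|b0N].
  move: ab0; rewrite b0E eqxx orbF => a0N.
  have na0 : 0 < normc a0.
    by rewrite lt_def normc_ge0 andbT; apply: contraNneq a0N => /eq0_normc ->.
  move=> V [K [cK _] KV]; have [M M0 hM] := compact_normc_bounded cK.
  have e1 : 0 < normc a0 / 2 by lra.
  have e2 : 0 < normc a0 / 2 / M by rewrite divr_gt0.
  have na : normc (a w) @[w --> F] --> normc a0 by exact: cvg_normc.
  have /cvgrPdist_lt/(_ _ e1) h1 := na.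
  move/cvgCP/(_ _ e2): hb => h2; apply: filterS2 h1 h2 => w h1 h2.
  apply: KV; rewrite /to_P1; case: ifPn => bw; [by right|left].
  exists (a w / b w) => // /hM; apply/negP; rewrite -ltNge normcM normcV.
  have nb : 0 < normc (b w).
    by rewrite lt_def normc_ge0 andbT; apply: contraNneq bw => /eq0_normc ->.
  rewrite ltr_pdivlMr //; move: h2; rewrite b0E subr0 ltr_pdivlMr // mulrC => h2.
  by apply: lt_trans h2 _; move: h1 => /(le_lt_trans (ler_norm _)); lra.
have nzb : \forall w \near F, b w != 0.
  have nb0 : 0 < normc b0.
    by rewrite lt_def normc_ge0 andbT; apply: contraNneq b0N => /eq0_normc ->.
  move/cvgCP/(_ _ nb0): (hb); apply: filterS => w; apply: contraTneq => ->.
  by rewrite sub0r normcN ltxx.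
have h : ((a w / b w : C) @[w --> F] --> (a0 / b0 : C)).
  exact: (cvgCM ha (cvgCV b0N hb)).
have /(cvg_comp _ _ h) h2 := @one_point_compactification_some_continuous C (a0 / b0).
apply: cvg_trans h2; apply: near_eq_cvg; apply: filterS nzb => w bw.
by rewrite /to_P1 (negbTE bw).
Qed.

Definition hom1 (x : P1 R) : R[i] := if x is Some a then a else 1.
Definition hom2 (x : P1 R) : R[i] := if x is Some _ then 1 else 0.

Lemma to_P1_hom (x : P1 R) : to_P1 (hom1 x) (hom2 x) = x.
Proof. by case: x => [a|] /=; rewrite /to_P1 ?oner_eq0 ?divr1 ?eqxx. Qed.

Lemma to_P1Z (k a b : R[i]) : k != 0 -> to_P1 (k * a) (k * b) = to_P1 a b.
Proof.
move=> k0; rewrite /to_P1 mulf_eq0 (negbTE k0) /=; case: ifPn => // b0.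
by rewrite -mulf_div divff // mul1r.
Qed.

Lemma hom_to_P1 (a b : R[i]) : (a != 0) || (b != 0) ->
  exists2 k : R[i], k != 0 & a = k * hom1 (to_P1 a b) /\ b = k * hom2 (to_P1 a b).
Proof.
move=> ab; rewrite /to_P1; case: ifPn => [/eqP b0|b0] /=.
  by exists a; rewrite ?mulr0 ?mulr1 //; move: ab; rewrite b0 eqxx orbF.
by exists b => //; rewrite mulr1 mulrCA divff // mulr1.
Qed.

Lemma hom_neq0 (x : P1 R) : (hom1 x != 0) || (hom2 x != 0).
Proof. by case: x => [a|] /=; rewrite oner_eq0 ?orbT. Qed.

(** An open condition on homogeneous coordinates is open in both charts, and
    the second chart shows that it holds off a closed disc when it holds at
    infinity. *)
Lemma open_P1 (H : R[i] -> R[i] -> R) :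
  continuous (fun x : C => H x 1) -> continuous (fun y : C => H 1 y) ->
  (forall c, c != 0 -> exists2 k : R, 0 < k & forall X Y, H (c * X) (c * Y) =
    k * H X Y) ->
  open ([set x | 0 < H (hom1 x) (hom2 x)] : set (P1 R)).
Proof.
move=> c1 c2 hH.
have o1 : open ([set x | 0 < H x 1] : set C).
  apply: (@open_comp _ _ (fun x : C => H x 1) [set t | 0 < t]) => //; exact: open_gt.
have o2 : open ([set x | 0 < H 1 x] : set C).
  apply: (@open_comp _ _ (fun x : C => H 1 x) [set t | 0 < t]) => //; exact: open_gt.
rewrite openE /= => -[a|] /= Ha.
  by apply: (@open_nbhs_nbhs C a [set x | 0 < H x 1]).
have /= := @open_nbhs_nbhs C 0 _ (conj o2 Ha).
rewrite -nbhs_ballE => -[e /= ]; rewrite ltcE => /andP[/eqP ei er] he.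
exists [set x | normc x <= (Re e)^-1]; first split.
- exact: compact_disc.
- have -> : [set x : C | normc x <= (Re e)^-1] =
  (@normc R : C -> R) @^-1` [set t | t <= (Re e)^-1] by [].
  apply: closed_comp; last exact: closed_le.
  by move=> x _; exact: continuous_normc.
- move=> z /= [[x /= /negP hx <-]|->]; last exact: Ha.
  rewrite -ltNge in hx; rewrite /=.
  have x0 : x != 0.
    by apply: contraTneq hx => ->; rewrite normc0 -leNgt invr_ge0 ltW.
  have [k k0 /(_ 1 x^-1)] := hH x x0; rewrite mulr1 mulfV // => ->.
  rewrite mulr_gt0 //; apply: (he x^-1).
  rewrite -ball_normE /= sub0r normc_def ltcE /= ei eqxx /=.
  suff : normc (- x^-1) < Re e by case: (- x^-1).
  by rewrite normcN normcV invf_plt ?posrE //; apply: lt_trans hx; rewrite invr_gt0.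
Qed.

End P1Topology.

(** * Connected sets *)

Section GeneralTopology.

Lemma near_neq (T Y : topologicalType) (F : set_system T) {FF : Filter F}
  (f g : T -> Y) (y z : Y) :
  hausdorff_space Y -> f @ F --> y -> g @ F --> z -> y <> z ->
  \forall w \near F, f w <> g w.
Proof.
move=> hY fy gz yz; have [//|nc] := pselect (cluster (nbhs y) z).
  by move/(hY y z).
have /existsNP[U /existsNP[V /not_implyP[Uy /not_implyP[Vz UV]]]] := nc.
have fU : F (f @^-1` U) := fy _ Uy.
have gV : F (g @^-1` V) := gz _ Vz.
apply: filterS2 fU gV => w /= Uw Vw fg.
by apply: UV; exists (f w); split => //; rewrite fg.
Qed.

(** The sets where [s] agrees with a given [t i] are finitely many, relatively
    open by separation, and partition [A], so only one of them is nonempty. *)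
Lemma connected_choice (I : finType) (T Y : topologicalType) (A : set T)
    (s : T -> Y) (t : I -> T -> Y) :
  hausdorff_space Y -> connected A -> A !=set0 ->
  (forall w, A w -> s @ within A (nbhs w) --> s w) ->
  (forall i w, A w -> t i @ within A (nbhs w) --> t i w) ->
  (forall i j w, A w -> t i w = t j w -> i = j) ->
  (forall w, A w -> exists i, s w = t i w) ->
  exists i, forall w, A w -> s w = t i w.
Proof.
move=> hY cA [w0 Aw0] cs ct inj cov; have [i si] := cov _ Aw0; exists i.
have neqP w j : A w -> s w <> t j w -> nbhs w [set w' | A w' -> s w' <> t j w'].
  by move=> Aw sw; apply: (near_neq hY (cs _ Aw) (ct j _ Aw)).
suff <- : [set w | A w /\ s w = t i w] = A by move=> w [].
apply: cA; first by exists w0.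
- exists [set w | A w -> s w = t i w]^° ; first exact: open_interior.
  apply/seteqP; split=> w; last by move=> [Aw /interior_subset/(_ Aw)].
  move=> [Aw sw]; split=> //=.
  have : \forall w' \near w, forall j, j != i -> A w' -> s w' <> t j w'.
    apply: filter_forall => j; have [->|ji] := eqVneq j i; first exact: nearW.
    have : nbhs w [set w' | A w' -> s w' <> t j w'].
      by apply: neqP => // sj; move: ji; rewrite (inj i j w Aw) ?eqxx // -sw.
    by apply: filterS => w' h _; exact: h.
  apply: filterS => w' hw' Aw'; have [j sj] := cov _ Aw'.
  by have [<-//|ji] := eqVneq j i; case: (hw' j ji Aw').
- exists (~` [set w | A w -> s w <> t i w]^°).
    exact/open_closedC/open_interior.
  apply/seteqP; split=> w.
    by move=> [Aw sw]; split=> //= /interior_subset/(_ Aw).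
  by move=> [Aw /= sw]; split=> //; apply: contrapT => /(neqP _ _ Aw).
Qed.

Lemma within_dense_eq (T Y : topologicalType) (A K : set T) (f g : T -> Y) :
  hausdorff_space Y -> A `<=` K -> K `<=` closure A ->
  (forall w, K w -> f @ within K (nbhs w) --> f w) ->
  (forall w, K w -> g @ within K (nbhs w) --> g w) ->
  (forall w, A w -> f w = g w) -> forall w, K w -> f w = g w.
Proof.
move=> hY AK KA cf cg fg w Kw; apply: contrapT => ne.
have h : nbhs w [set w' | K w' -> f w' <> g w'] by
  exact: (near_neq hY (cf _ Kw) (cg _ Kw) ne).
have [w' [Aw' /(_ (AK _ Aw')) fg']] := KA _ Kw _ h.
by apply: fg'; exact: fg.
Qed.

(** In a partition into open sets every part is also relatively closed, so no
    connected set meets two of them. *)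
Lemma components_partition (T : topologicalType) (I : Type) (J : set I) (X : set T)
  (V : I -> set T) :
  (forall i, J i -> open (V i)) -> (forall i, J i -> connected (V i)) ->
  (forall i, J i -> V i !=set0) ->
  (forall i j x, J i -> J j -> V i x -> V j x -> i = j) ->
  X = \bigcup_(i in J) V i ->
  [set connected_component X x | x in X] = V @` J.
Proof.
move=> oV cV nV dV XE.
have comp i x : J i -> V i x -> connected_component X x = V i.
  move=> Ji Vx; apply/seteqP; split; last first.
    apply: connected_component_max => //; last exact: cV.
    by rewrite XE => y Vy; exists i.
  move=> y [E [Ex EX cE] Ey].
  suff EV : E `&` V i = E by move: Ey; rewrite -EV => -[].
  apply: cE.
  - by exists x.
  - by exists (V i) => //; exact: oV.
  - exists (~` \bigcup_(j in J `\ i) V j).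
      by apply/open_closedC/bigcup_open => j [Jj _]; exact: oV.
    apply/seteqP; split=> z [Ez Vz]; split => //.
      by move=> [j [Jj ji] Vjz]; apply: ji; exact: dV Vz.
    have := EX _ Ez; rewrite XE => -[j Jj Vjz].
    have [<-//|ji] := pselect (j = i); case: Vz; exists j => //; split => //.
apply/seteqP; split=> U.
  by move=> [x + <-]; rewrite {1}XE => -[i Ji Vx]; exists i => //; rewrite (comp i).
move=> [i Ji <-]; have [x Vx] := nV _ Ji; exists x; last exact: comp.
by rewrite XE; exists i.
Qed.

Lemma connected_path (R : realType) (Y : topologicalType) (f : R -> Y) :
  (forall t : R, 0 <= t <= 1 -> f @ within `[0, 1]%classic (nbhs t) --> f t) ->
  connected (f @` `[0, 1]%classic).
Proof.
move=> cf; apply: connected_continuous_connected; first exact: segment_connected.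
by apply/subspace_continuousP => t; rewrite /= in_itv; exact: cf.
Qed.

End GeneralTopology.

Section ConvexP1.
Variable R : realType.
Local Notation C := (R[i]^o).

Lemma cvg_real (F : set_system R) {FF : Filter F} (t : R) : F --> t ->
  (x%:C : C) @[x --> F] --> (t%:C : C).
Proof. by move=> Ft; apply: cvg_Complex => //; exact: cvg_cst. Qed.

Lemma connected_star (A : set C) (z0 : R[i]) : A z0 ->
  (forall z (t : R), A z -> 0 <= t <= 1 -> A (z0 + t%:C * (z - z0) : R[i])) ->
  connected A.
Proof.
move=> Az0 hA.
pose p z := (fun t : R => z0 + t%:C * (z - z0) : C) @` `[0, 1]%classic.
have -> : A = \bigcup_(z in A) p z.
  apply/seteqP; split=> z.
    move=> Az; exists z => //; exists 1; first by rewrite /= in_itv /= ler01 lexx.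
    by rewrite mul1r addrC subrK.
  by move=> [y Ay [t /= ]]; rewrite in_itv /= => t01 <-; exact: hA.
apply: bigcup_connected.
  exists z0 => z Az; exists 0; first by rewrite /= in_itv /= ler01 lexx.
  by rewrite mul0r addr0.
move=> z Az; apply: connected_path => t _.
apply: cvgCD; first exact: cvg_cst.
apply: cvgCM; last exact: cvg_cst.
by apply: cvg_real; exact: cvg_within.
Qed.

(** Two points are separated by comparing the chordal distances to them, which
    in homogeneous coordinates is an open condition. *)
Lemma hausdorff_P1 : hausdorff_space (P1 R).
Proof.
move=> x y xy; apply: contrapT => ne.
pose n X Y z : R := normc (X * hom2 z - hom1 z * Y).
pose N X Y z : R := n X Y z * n X Y z.
pose H u v X Y : R := N X Y v - N X Y u.
have oH u v : open ([set z | 0 < H u v (hom1 z) (hom2 z)] : set (P1 R)).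
  have cN v' (a b : R[i] -> R[i]) : continuous (a : C -> C) ->
    continuous (b : C -> C) ->
     continuous (fun z : C => N (a z) (b z) v').
    move=> ca cb z; rewrite /N.
    suff h : n (a w) (b w) v' @[w --> z] -->
      n (a z) (b z) v' by exact: (@cvgM R C (nbhs z) _ _ _ _ _ h h).
    apply: (@cvg_normc R C (nbhs (z : C))); apply: cvgCD; last apply: cvgCN;
      apply: cvgCM;
     by [exact: ca|exact: cb|exact: cvg_cst].
  have cH (a b : R[i] -> R[i]) : continuous (a : C -> C) -> continuous (b : C -> C) ->
     continuous (fun z : C => H u v (a z) (b z)).
    by move=> ca cb z; exact:
      (@cvgB R R C (nbhs (z : C)) _ _ _ _ _ (cN v a b ca cb z) (cN u a b ca cb z)).
  have cid : continuous (id : C -> C) by move=> z; exact: cvg_id.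
  have c1 : continuous (cst 1 : C -> C) by exact: cst_continuous.
  apply: (@open_P1 R (H u v) (cH id (cst 1) cid c1) (cH (cst 1) id c1 cid)).
  move=> c c0; exists (normc c ^+ 2).
    rewrite exprn_gt0 // lt_def normc_ge0 andbT;
      apply: contraNneq c0 => /eq0_normc ->//.
    move=> X Y; suff nc w : n (c * X) (c * Y) w = normc c * n X Y w.
      by rewrite /H /N !nc; ring.
    by rewrite /n -normcM; congr normc; ring.
have HN u v z : 0 < H u v (hom1 z) (hom2 z) -> 0 < H v u (hom1 z) (hom2 z) -> False.
  rewrite /H; lra.
have Hu u v : u <> v -> 0 < H u v (hom1 u) (hom2 u).
  move=> uv; rewrite /H /N [X in _ - X](_ : _ = 0) ?subr0; last first.
    by rewrite /n subrr normc0 mulr0.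
  rewrite -expr2 exprn_gt0 // lt_def normc_ge0 andbT; apply/eqP => /eq0_normc /eqP.
  rewrite subr_eq0 => /eqP h; apply: uv; rewrite -(to_P1_hom u) -(to_P1_hom v).
  case: u v h => [a|] [b|] //=; rewrite ?mulr1 ?mul1r ?mulr0 //.
  - by move=> ->.
  - by move/eqP; rewrite eq_sym oner_eq0.
  - by move/eqP; rewrite oner_eq0.
have := xy _ _ (open_nbhs_nbhs (conj (oH x y) (Hu _ _ ne)))
   (open_nbhs_nbhs (conj (oH y x) (Hu _ _ (fun h => ne (esym h))))).
by case=> z [h1 h2]; exact: HN h1 h2.
Qed.

End ConvexP1.

(** * Square roots, and cube roots in sectors *)

Section Roots.
Variable R : realType.
Local Notation C := (R[i]^o).
Local Notation Re := complex.Re.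
Local Notation Im := complex.Im.
Implicit Types (z h a b u : R[i]).

Lemma cReD z h : Re (z + h) = Re z + Re h. Proof. by case: z; case: h. Qed.
Lemma cImD z h : Im (z + h) = Im z + Im h. Proof. by case: z; case: h. Qed.
Lemma cReN z : Re (- z) = - Re z. Proof. by case: z. Qed.
Lemma cImN z : Im (- z) = - Im z. Proof. by case: z. Qed.
Lemma cReM z h : Re (z * h) = Re z * Re h - Im z * Im h.
Proof. by case: z; case: h. Qed.
Lemma cImM z h : Im (z * h) = Re z * Im h + Im z * Re h.
Proof. by case: z => ? ?; case: h => ? ? /=; rewrite addrC addrC. Qed.
Lemma cReC (x : R) : Re x%:C = x. Proof. by []. Qed.
Lemma cImC (x : R) : Im x%:C = 0. Proof. by []. Qed.
Lemma cReJ z : Re z^* = Re z. Proof. by case: z. Qed.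
Lemma cImJ z : Im z^* = - Im z. Proof. by case: z. Qed.
Definition ReImE := (cReD, cImD, cReN, cImN, cReM, cImM, cReC, cImC, cReJ, cImJ).

Lemma complex_eqP z h : Re z = Re h -> Im z = Im h -> z = h.
Proof. by case: z; case: h => /= ? ? ? ? -> ->. Qed.

Lemma normc_gt0 z : (0 < normc z) = (z != 0).
Proof.
rewrite lt_def normc_ge0 andbT; congr (~~ _); apply/eqP/eqP => [/eq0_normc//|->].
exact: normc0.
Qed.

Lemma Re_sqrtc_ge0 z : 0 <= Re (sqrtc z).
Proof. by case: z => a b /=; exact: sqrtr_ge0. Qed.

Lemma Re_sqrtc_gt0 z : ~ (Im z = 0 /\ Re z <= 0) -> 0 < Re (sqrtc z).
Proof.
move=> nz; rewrite lt_def Re_sqrtc_ge0 andbT; apply/eqP => r0; apply: nz.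
rewrite -[z]sqr_sqrtc expr2 !ReImE r0; split; first by ring.
by rewrite mul0r sub0r oppr_le0 -expr2 sqr_ge0.
Qed.

(** If [a] has positive and [b] nonnegative real part, [a + b] is bounded away
    from 0 and [a - b = (a ^+ 2 - b ^+ 2) / (a + b)]; at 0 the square root of the
    modulus is continuous. *)
Lemma cvg_sqrtc (T : Type) (F : set_system T) {FF : Filter F} (f : T -> R[i])
  (l : R[i]) :
  ~ (Im l = 0 /\ Re l < 0) -> (f : T -> C) @ F --> (l : C) ->
  (sqrtc (f w) : C) @[w --> F] --> (sqrtc l : C).
Proof.
move=> nl fl; have [l0|l0] := eqVneq l 0.
  rewrite l0 in fl *; rewrite sqrtc0; apply: (@cvg_root R 1 T F FF 1 f _ 0 0 fl).
  by apply: nearW => w; rewrite !subr0 mul1r -normcX sqr_sqrtc.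
have r0 : 0 < Re (sqrtc l).
  apply: Re_sqrtc_gt0 => -[li lr]; apply: nl; split=> //.
  rewrite lt_neqAle lr andbT; apply: contra_neq l0 => lr0.
  exact: complex_eqP.
apply: (@cvg_root R 0 T F FF (Re (sqrtc l))^-1 f _ l (sqrtc l) fl).
apply: nearW => w; rewrite expr1 mulrC ler_pdivlMr //.
have -> : f w - l = (sqrtc (f w) - sqrtc l) * (sqrtc (f w) + sqrtc l).
  by rewrite -subr_sqr !sqr_sqrtc.
rewrite normcM; apply: ler_wpM2l; first exact: normc_ge0.
apply: le_trans (ler_norm _) _; apply: le_trans (Re_le_normc _).
rewrite cReD ger0_norm ?(ltW r0) // ger0_norm ?addr_ge0 ?Re_sqrtc_ge0 //.
by rewrite lerDr Re_sqrtc_ge0.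
Qed.

Definition sqrt3 : R := Num.sqrt 3.
Lemma sqrt3_gt0 : 0 < sqrt3. Proof. by rewrite sqrtr_gt0 ltr0n. Qed.
Lemma sqrt3_sqr : sqrt3 ^+ 2 = 3. Proof. by rewrite sqr_sqrtr // ler0n. Qed.

Definition omega : R[i] := (- (2^-1)) +i* (sqrt3 / 2).

Lemma ReOm : Re omega = - (2^-1). Proof. by []. Qed.
Lemma ImOm : Im omega = sqrt3 / 2. Proof. by []. Qed.
Lemma Re1 : Re (1 : R[i]) = 1. Proof. by []. Qed.
Lemma Im1 : Im (1 : R[i]) = 0. Proof. by []. Qed.
Definition ReImOm := (ReOm, ImOm, Re1, Im1, ReImE).
(* Otherwise the rules of [ReImE] unfold [omega] and rewrite inside it. *)
Opaque omega.

Lemma omega_conj : omega^* = omega ^+ 2.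
Proof.
have h := sqrt3_sqr; apply: complex_eqP; rewrite expr2 !ReImOm; nra.
Qed.

Lemma omega3 : omega ^+ 3 = 1.
Proof.
have h := sqrt3_sqr; rewrite exprS -omega_conj.
by apply: complex_eqP; rewrite !ReImOm; nra.
Qed.

Lemma omega_sum : 1 + omega + omega ^+ 2 = 0.
Proof. by rewrite -omega_conj; apply: complex_eqP; rewrite !ReImOm; lra. Qed.

(** For [s = false] the closed sector of arguments between 0 and [pi / 3], for
    [s = true] its complex conjugate. *)
Definition sector (s : bool) u : Prop := 0 <= (-1) ^+ s * Im u <= sqrt3 * Re u.

Lemma sector_conj s u : sector s u^* <-> sector (~~ s) u.
Proof. by rewrite /sector cReJ cImJ; case: s;
  rewrite /= ?expr0 ?expr1 ?mulN1r ?mul1r ?opprK. Qed.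

Lemma cube_Re z : Re (z ^+ 3) = Re z ^+ 3 - 3 * Re z * Im z ^+ 2.
Proof. by rewrite !exprS !ReImE !expr0 /=; ring. Qed.
Lemma cube_Im z : Im (z ^+ 3) = Im z * (3 * Re z ^+ 2 - Im z ^+ 2).
Proof. by rewrite !exprS !ReImE !expr0 /=; ring. Qed.

(** After rotating by [- pi / 3] the terms of [a ^+ 2 + a * b + b ^+ 2] have
    arguments within [pi / 3] of the positive axis and cannot cancel. *)
Lemma sector_holder s a b : sector s a -> sector s b ->
  normc (a - b) ^+ 3 <= 2 * normc (a ^+ 3 - b ^+ 3).
Proof.
wlog : s a b / s = false.
  move=> hw; case: s; last exact: hw.
  rewrite -(sector_conj false) -[X in _ -> X -> _](sector_conj false) => sa sb.
  have := hw false _ _ erefl sa sb.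
  by rewrite -!rmorphXn -!rmorphB !normc_conj.
move=> ->; rewrite /sector /= expr0 !mul1r => /andP[a0 a1] /andP[b0 b1].
have s30 := sqrt3_gt0; have s32 := sqrt3_sqr.
have ax : 0 <= Re a by rewrite -(pmulr_rge0 _ s30); lra.
have bx : 0 <= Re b by rewrite -(pmulr_rge0 _ s30); lra.
(* [e / 2] is the rotation by [- pi / 3]. *)
pose q := a ^+ 2 + a * b + b ^+ 2; pose e : R[i] := 1 -i* sqrt3.
have -> : a ^+ 3 - b ^+ 3 = (a - b) * q by rewrite /q; ring.
have e2 : normc e = 2.
  by rewrite /e /= sqrrN s32 expr1n -[2]gtr0_norm // -sqrtr_sqr; congr Num.sqrt; ring.
have h : normc (a - b) ^+ 2 <= Re (e * q).
  rewrite normc_sqr /q /e !expr2 !ReImOm /=.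
  set x := Re a in ax a1 *; set y := Im a in a0 a1 *.
  set x' := Re b in bx b1 *; set y' := Im b in b0 b1 *.
  have h1 : y * y <= sqrt3 * x * y by rewrite ler_wpM2r.
  have h2 : y' * y' <= sqrt3 * x' * y' by rewrite ler_wpM2r.
  have h3 : y * y' <= sqrt3 * x * y' by rewrite ler_wpM2r.
  have h4 : 0 <= sqrt3 * x' * y by rewrite !mulr_ge0 // ltW.
  have h5 : 0 <= x * x' by rewrite mulr_ge0.
  have h6 : 0 <= y * y' by rewrite mulr_ge0.
  nra.
have {}h : normc (a - b) ^+ 2 <= 2 * normc q.
  apply: le_trans h _; apply: le_trans (ler_norm _) _; rewrite -e2 -normcM.
  exact: Re_le_normc.
by rewrite exprS normcM [leRHS]mulrCA; apply: ler_wpM2l => //; exact: normc_ge0.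
Qed.

(** One of the three cube roots has its argument in the first third of the
    circle, and the sign of the imaginary part of the cube confines it to the
    half of that third which is the sector. *)
Lemma sector_cbrt (s : bool) (t : R[i]) : 0 <= (-1) ^+ s * Im t ->
  exists2 u, u ^+ 3 = t & sector s u.
Proof.
wlog -> : s t / s = false.
  move=> hw; case: s; last exact: hw.
  move=> t0; have [] := hw false t^* erefl.
    by move: t0; rewrite cImJ expr0 expr1 mul1r mulN1r.
  move=> u ut su; exists u^*; last exact/sector_conj.
  by rewrite -rmorphXn ut; exact: conjcK.
rewrite expr0 mul1r => t0.
have [c ct] : exists c, c ^+ 3 = t by exists (3.-root t); rewrite rootCK.
have s30 := sqrt3_gt0; have s32 := sqrt3_sqr.
have cc k : (omega ^+ k * c) ^+ 3 = t by rewrite exprMn exprAC omega3 expr1n mul1r.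
suff [k h] : exists k, 0 <= Im (omega ^+ k * c) <= sqrt3 * Re (omega ^+ k * c).
  by exists (omega ^+ k * c); rewrite // /sector expr0 mul1r.
have H k : 0 <= Im (omega ^+ k * c) ->
  0 < Im (omega ^+ k * c) + sqrt3 * Re (omega ^+ k * c) ->
  0 <= Im (omega ^+ k * c) <= sqrt3 * Re (omega ^+ k * c).
  move: t0; rewrite -(cc k) cube_Im; set x := Re _; set y := Im _ => t0 y0 xy.
  rewrite y0 /=; have [yE|yN] := eqVneq y 0; first by lra.
  have {}y0 : 0 < y by rewrite lt_def yN.
  move: t0; rewrite pmulr_rge0 // => t0.
  rewrite -subr_ge0 -(pmulr_rge0 _ xy); nra.
have [c0|c0] := eqVneq c 0.
  by exists 0%N; rewrite c0 mulr0 /= mulr0 lexx.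
set x := Re c; set y := Im c.
have xy0 : ~ (x = 0 /\ y = 0).
  by move=> [x0 y0]; move/eqP: c0; apply; exact: complex_eqP.
have E0 : Im (omega ^+ 0 * c) = y /\ Re (omega ^+ 0 * c) = x by rewrite expr0 mul1r.
have hy : sqrt3 * sqrt3 * y = 3 * y by rewrite -expr2 s32.
have E1 : Im (omega ^+ 1 * c) = (- y + sqrt3 * x) / 2 /\
  sqrt3 * Re (omega ^+ 1 * c) = (- sqrt3 * x - 3 * y) / 2.
  by rewrite expr1 !ReImOm -/x -/y; split; lra.
have E2 : Im (omega ^+ 2 * c) = (- y - sqrt3 * x) / 2 /\
  sqrt3 * Re (omega ^+ 2 * c) = (- sqrt3 * x + 3 * y) / 2.
  by rewrite -omega_conj !ReImOm -/x -/y; split; lra.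
(* The half-open thirds of the circle of arguments that multiplication by
   [1], [omega] and [omega ^+ 2] brings into the first one. *)
have [p0|p0] := boolP ((0 <= y) && (0 < y + sqrt3 * x)).
  by exists 0%N; apply: H; rewrite E0.1 ?E0.2; case/andP: p0.
have [p1|p1] := boolP ((0 <= - y + sqrt3 * x) && (y < 0)).
  by exists 1%N; apply: H; rewrite E1.1 ?E1.2; lra.
exists 2%N; apply: H; rewrite E2.1 ?E2.2; last first.
  suff : ~ (y <= sqrt3 * x) by lra.
  move=> h; have [y0|y0] := ltP y 0; first by lra.
  have [y1|y1] := ltP 0 y; first by lra.
  apply: xy0; split; last by lra.
  have : sqrt3 * x = 0 by lra.
  by move/eqP; rewrite mulf_eq0 gt_eqF //= => /eqP.
have [y0|y0] := ltP y 0; first by lra.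
by lra.
Qed.

End Roots.

(** * Solving j = w over a half-strip *)

Section Strip.
Variable R : realType.
Local Notation C := (R[i]^o).
Local Notation Re := (@complex.Re R).
Local Notation Im := (@complex.Im R).
Local Notation sqrt3 := (sqrt3 R).
Local Notation omega := (omega R).
Implicit Types (z h a b u w : R[i]) (s : bool) (m : 'I_3).

(** The half-strip of unbounded height: bounds proved on it are uniform in the
    width of the half-strips used for passages. *)
Definition strip s w : Prop := (0 <= Re w <= 1) /\ 0 <= (-1) ^+ s * Im w.

Lemma half_strip_strip s (e : R) w : half_strip s e w -> strip s w.
Proof. by move=> [? /andP[? _]]. Qed.

(** With [r := strip_sqrt w], the invariant is [w = 1 - r ^+ 2], the cube of the
    resolvent coordinate is [(r - 1) / (r + 1) = - strip_cube w], and
    [strip_cbrt] extracts its cube root up to a fixed sixth root of unity. *)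
Definition strip_sqrt w : R[i] := sqrtc (1 - w).
Definition strip_cube w : R[i] := (1 - strip_sqrt w) / (1 + strip_sqrt w).
Definition strip_cbrt s w : R[i] :=
  xget 0 [set u | u ^+ 3 = strip_cube w /\ sector s u].

Lemma strip_sqrt_sqr w : strip_sqrt w ^+ 2 = 1 - w. Proof. exact: sqr_sqrtc. Qed.

Lemma Re_strip_sqrt_ge0 w : 0 <= Re (strip_sqrt w). Proof. exact: Re_sqrtc_ge0. Qed.

Lemma strip_sqrt1_neq0 w : 1 + strip_sqrt w != 0.
Proof.
apply/eqP => /(congr1 Re); rewrite !ReImOm; have := Re_strip_sqrt_ge0 w; lra.
Qed.

Lemma strip_sqrt_sector s w : strip s w -> `|Im (strip_sqrt w)| <= Re (strip_sqrt w).
Proof.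
move=> [/andP[_ w1] _]; have := strip_sqrt_sqr w; have := Re_strip_sqrt_ge0 w.
move: (strip_sqrt w) => r r0 /(congr1 Re); rewrite expr2 !ReImOm => E.
by rewrite -(ler_pXn2r (ltn0Sn 1)) ?nnegrE // real_normK ?num_real //; nra.
Qed.

Lemma strip_sqrt_sign s w : strip s w -> (-1) ^+ s * Im (strip_sqrt w) <= 0.
Proof.
move=> sw; have := strip_sqrt_sector sw; case: sw => _ wi.
have := strip_sqrt_sqr w; have := Re_strip_sqrt_ge0 w.
move: (strip_sqrt w) => r; rewrite le_eqVlt => /orP[/eqP <- _|r0].
  by rewrite normr_le0 => /eqP ->; rewrite mulr0.
move=> /(congr1 Im); rewrite expr2 !ReImOm => E _.
by rewrite -(pmulr_rle0 _ r0); case: s wi; rewrite /= ?expr0 ?expr1; nra.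
Qed.

(** The imaginary part of [(1 - r) / (1 + r)] is that of [- r] up to the factor
    [2 / |1 + r| ^ 2]. *)
Lemma strip_cube_sign s w : strip s w -> 0 <= (-1) ^+ s * Im (strip_cube w).
Proof.
move=> sw; have := strip_sqrt_sign sw; rewrite /strip_cube; have := strip_sqrt1_neq0 w.
move: (strip_sqrt w) => r r1 ri; pose n := normc (1 + r) ^+ 2.
have n0 : 0 < n by rewrite exprn_gt0 // normc_gt0.
suff E : n * Im ((1 - r) / (1 + r)) = - 2 * Im r.
  by rewrite -(pmulr_rge0 _ n0) mulrCA E; case: (s) ri; rewrite /= ?expr0 ?expr1; lra.
have -> : n * Im ((1 - r) / (1 + r)) = Im (n%:C * ((1 - r) / (1 + r))).
  by rewrite !ReImOm; ring.
have -> : n%:C = (1 + r) * (1 + r)^*.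
  apply: complex_eqP; rewrite /n normc_sqr !ReImOm; ring.
rewrite mulrC mulrA divfK // !ReImOm; ring.
Qed.

Lemma strip_cbrtP s w : strip s w -> strip_cbrt s w ^+ 3 = strip_cube w /\
  sector s (strip_cbrt s w).
Proof.
move=> /strip_cube_sign/sector_cbrt[u ut us]; rewrite /strip_cbrt;
  case: xgetP => [_ -> //|].
by move/(_ u) => [].
Qed.

Lemma strip_cube1_neq0 w : 1 + strip_cube w != 0.
Proof.
rewrite /strip_cube; have r1 := strip_sqrt1_neq0 w.
have -> : 1 + (1 - strip_sqrt w) / (1 + strip_sqrt w) = 2 / (1 + strip_sqrt w) by field.
by rewrite mulf_neq0 ?invr_eq0 // pnatr_eq0.
Qed.

Lemma strip_cube_j w : 4 * strip_cube w = w * (1 + strip_cube w) ^+ 2.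
Proof.
rewrite /strip_cube; have := strip_sqrt_sqr w; have := strip_sqrt1_neq0 w.
move: (strip_sqrt w) => r r1 E; have -> : w = 1 - r ^+ 2 by rewrite E; ring.
by field.
Qed.

(** Points in the quadrant around the positive axis are closer to each other
    than one is to the opposite of the other. *)
Lemma quadrant_holder a b : `|Im a| <= Re a -> `|Im b| <= Re b ->
  normc (a - b) ^+ 2 <= 1 * normc (a ^+ 2 - b ^+ 2).
Proof.
rewrite !ler_norml => /andP[a1 a2] /andP[b1 b2].
rewrite mul1r expr2 subr_sqr normcM; apply: ler_wpM2l; first exact: normc_ge0.
rewrite -(ler_pXn2r (ltn0Sn 1)) ?nnegrE ?normc_ge0 // !normc_sqr !ReImOm.
have h1 : 0 <= (Re a + Im a) * (Re b + Im b) by apply: mulr_ge0; lra.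
have h2 : 0 <= (Re a - Im a) * (Re b - Im b) by apply: mulr_ge0; lra.
nra.
Qed.

Lemma strip_cube_lipschitz w w' : normc (strip_cube w - strip_cube w') <=
  2 * normc (strip_sqrt w - strip_sqrt w').
Proof.
rewrite /strip_cube; have :=
  (strip_sqrt1_neq0 w, strip_sqrt1_neq0 w', Re_strip_sqrt_ge0 w, Re_strip_sqrt_ge0 w').
move: (strip_sqrt w) (strip_sqrt w') => r r' [[[r1 r1'] r0] r0'].
have -> : (1 - r) / (1 + r) - (1 - r') / (1 + r') =
    2 * (r' - r) / ((1 + r) * (1 + r')).
  by field; apply/andP.
have n1 x : 0 <= Re x -> 1 <= normc (1 + x).
  move=> x0; apply: le_trans (Re_le_normc _); apply: le_trans (ler_norm _).
  by rewrite !ReImOm lerDl.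
have n2 : normc (2 : R[i]) = 2.
  have -> : (2 : R[i]) = 2%:C by apply: complex_eqP; rewrite ?ReImE /= ; lra.
  by rewrite /= expr0n addr0 sqrtr_sqr gtr0_norm.
rewrite normcM normcV normcM n2 ler_pdivrMr; last first.
  by rewrite normc_gt0 mulf_neq0.
rewrite -[normc (r' - r)]normcN opprB normcM.
rewrite ler_peMr ?mulr_ge0 ?normc_ge0 //.
have := n1 _ r0; have := n1 _ r0'; nra.
Qed.

Lemma strip_sqrt_cvg s w : strip s w ->
  (strip_sqrt : C -> C) @ within (strip s) (nbhs (w : C)) --> (strip_sqrt w : C).
Proof.
move=> [/andP[w0 w1] ws]; apply: cvg_sqrtc.
  by rewrite !ReImOm => -[]; lra.
apply: cvgCD; first exact: cvg_cst.
apply: cvgCN; exact: cvg_within.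
Qed.

Lemma strip_cube_cvg s w : strip s w ->
  (strip_cube : C -> C) @ within (strip s) (nbhs (w : C)) --> (strip_cube w : C).
Proof.
move=> sw; apply: (@cvg_root R 0 _ _ _ 2 strip_sqrt _ (strip_sqrt w) (strip_cube w));
  first exact: strip_sqrt_cvg.
by apply: nearW => x; rewrite expr1; exact: strip_cube_lipschitz.
Qed.

Lemma strip_cbrt_holder s w w' : strip s w -> strip s w' ->
  normc (strip_cbrt s w - strip_cbrt s w') ^+ 3 <=
    2 * normc (strip_cube w - strip_cube w').
Proof.
by move=> /strip_cbrtP[<- h] /strip_cbrtP[<- h']; exact: sector_holder h h'.
Qed.

Lemma strip_cbrt_cvg s w : strip s w ->
  (strip_cbrt s : C -> C) @ within (strip s) (nbhs (w : C)) --> (strip_cbrt s w : C).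
Proof.
move=> sw; apply: (@cvg_root R 2 _ _ _ 2 strip_cube _ (strip_cube w) (strip_cbrt s w));
  first exact: strip_cube_cvg.
by apply: (@nearW C (nbhs (w : C))) => x sx; exact: strip_cbrt_holder.
Qed.

Lemma strip_Re s w : strip s w -> strip s (Re w)%:C.
Proof. by move=> [w0 _]; split; rewrite ?cReC ?cImC ?mulr0. Qed.

(** Over the segment itself the solution is real, so the edge is mapped to the
    boundary ray of the sector. *)
Lemma strip_cbrt_real s (x : R) : 0 <= x <= 1 -> Im (strip_cbrt s x%:C) = 0.
Proof.
move=> x01; have sx : strip s x%:C by split; rewrite ?cReC ?cImC ?mulr0.
have [] := strip_cbrtP sx; have := strip_sqrt_sign sx; have :=
  strip_sqrt_sign (s := ~~ s) (w := x%:C).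
rewrite /strip cReC cImC mulr0 => /(_ (conj x01 (lexx _))) i1 i2.
have {i1 i2} ri : Im (strip_sqrt x%:C) = 0.
  by case: (s) i1 i2; rewrite /= ?expr0 ?expr1; lra.
have rrE : strip_sqrt x%:C = (Re (strip_sqrt x%:C))%:C by apply: complex_eqP => //;
  rewrite ri.
have r0 := Re_strip_sqrt_ge0 x%:C.
have r1 : Re (strip_sqrt x%:C) <= 1.
  have := congr1 Re (strip_sqrt_sqr x%:C); rewrite expr2 !ReImOm ri => E.
  rewrite leNgt; apply/negP => h; case/andP: x01; nra.
have [t t0 ->] : exists2 t : R, 0 <= t & strip_cube x%:C = t%:C.
  exists ((1 - Re (strip_sqrt x%:C)) / (1 + Re (strip_sqrt x%:C))).
    by rewrite divr_ge0 // ?subr_ge0 // addr_ge0.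
  by rewrite /strip_cube {1 2}rrE fmorph_div rmorphB rmorphD rmorph1.
move: (strip_cbrt s x%:C) => u ut; rewrite /sector.
have [yE _|yN] := eqVneq (Im u) 0; first by rewrite yE.
have := congr1 Re ut; have := congr1 Im ut; rewrite cube_Im cube_Re cReC cImC.
move: (Re u) (Im u) yN => p q q0 /eqP; rewrite mulf_eq0 (negbTE q0) /= subr_eq0 => /eqP.
move=> E1 E2 /andP[h1 h2].
have p0 : 0 <= p by rewrite -(pmulr_rge0 _ (sqrt3_gt0 R)); lra.
have {}E2 : - 8 * p ^+ 3 = t by rewrite -E2 -E1; ring.
have p3 : p ^+ 3 = 0.
  by apply/eqP; rewrite eq_le exprn_ge0 // andbT; lra.
move/eqP: p3; rewrite expf_eq0 /= => /eqP pE; move: E1;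
  rewrite pE expr0n mulr0 => /esym/eqP.
by rewrite expf_eq0 /= (negbTE q0).
Qed.

(** The solution is Hoelder continuous and real over the segment, hence thin
    half-strips are mapped close to the boundary ray. *)
Lemma strip_cbrt_Im_small s (d : R) : 0 < d ->
  \forall e \near (0 : R)^'+, forall w, half_strip s e w -> `|Im (strip_cbrt s w)| < d.
Proof.
move=> d0; pose e0 := (d ^+ 3 / 4) ^+ 2.
have e00 : 0 < e0 by rewrite exprn_gt0 // divr_gt0 // exprn_gt0.
near=> e; move=> w hw; have sw := half_strip_strip hw.
have sw' := strip_Re sw.
have -> : Im (strip_cbrt s w) = Im (strip_cbrt s w - strip_cbrt s (Re w)%:C).
  by rewrite cImD cImN strip_cbrt_real ?subr0 //; case: sw.
apply: le_lt_trans (Im_le_normc _) _.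
rewrite -(ltr_pXn2r (ltn0Sn 2)) ?nnegrE ?normc_ge0 ?(ltW d0) //.
apply: le_lt_trans (strip_cbrt_holder sw sw') _.
have t := strip_cube_lipschitz w (Re w)%:C.
suff h : normc (strip_sqrt w - strip_sqrt (Re w)%:C) < d ^+ 3 / 4 by lra.
rewrite -(ltr_pXn2r (ltn0Sn 1)) ?nnegrE ?normc_ge0 ?divr_ge0 ?exprn_ge0 ?(ltW d0) //.
apply: le_lt_trans (quadrant_holder (strip_sqrt_sector sw) (strip_sqrt_sector sw')) _.
rewrite !strip_sqrt_sqr mul1r.
have -> : 1 - w - (1 - (Re w)%:C) = - ('i * (Im w)%:C).
  by case: (w) => x y; apply: complex_eqP => /=; ring.
have ee : e < e0 by near: e; exact: nbhs_right_lt.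
rewrite normcN normcM /= !expr0n /= add0r addr0 expr1n sqrtr1 mul1r sqrtr_sqr.
apply: le_lt_trans ee; case: hw => _; case: (s);
  rewrite /= ?expr0 ?expr1 => /andP[h1 h2].
  by rewrite -normrN ger0_norm; lra.
by rewrite ger0_norm; lra.
Unshelve. all: by end_near. Qed.

(** On the boundary of the sector the cube is real, and then so is [w]. *)
Lemma strip_cbrt_strict s w : strip s w -> Im w != 0 ->
  0 < (-1) ^+ s * Im (strip_cbrt s w) < sqrt3 * Re (strip_cbrt s w).
Proof.
move=> sw wi; have [ut /andP[h1 h2]] := strip_cbrtP sw.
suff ti : Im (strip_cube w) != 0.
  move: ti; rewrite -ut cube_Im mulf_eq0 negb_or => /andP[ui ui'].
  rewrite !lt_def h1 h2 !andbT mulf_eq0 negb_or ui signr_eq0 /=.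
  apply: contra_neq ui' => E; have := sqrt3_sqr R.
  have <- : ((-1) ^+ s * Im (strip_cbrt s w)) ^+ 2 = Im (strip_cbrt s w) ^+ 2.
    by rewrite exprMn sqrr_sign mul1r.
  by rewrite -E exprMn => ->; ring.
have tw := strip_cube_j w; have t1 := strip_cube1_neq0 w; apply: contra_neq wi => ti.
have tE : strip_cube w = (Re (strip_cube w))%:C by apply: complex_eqP.
have -> : w = (4 * Re (strip_cube w) / (1 + Re (strip_cube w)) ^+ 2)%:C;
  last exact: cImC.
have xE (x : R) : (4 * x / (1 + x) ^+ 2)%:C = 4 * x%:C / (1 + x%:C) ^+ 2 :> R[i].
  by rewrite fmorph_div rmorphM rmorph_nat rmorphXn rmorphD rmorph1.
by rewrite xE -tE tw mulfK // expf_neq0.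
Qed.

End Strip.

(** * Thin half-strips and the three sectors *)

Lemma cvg_within_sub (T Y : topologicalType) (A B : set T) (f : T -> Y) (x : T) (l : Y)
  :
  A `<=` B -> f @ within B (nbhs x) --> l -> f @ within A (nbhs x) --> l.
Proof.
move=> AB fB V /fB h; have {}h : nbhs x [set w | B w -> V (f w)] by exact: h.
by apply: (filterS _ h) => w hw /AB; exact: hw.
Qed.

Section Cones.
Variable R : realType.
Local Notation C := (R[i]^o).
Local Notation Re := (@complex.Re R).
Local Notation Im := (@complex.Im R).
Local Notation sqrt3 := (sqrt3 R).
Local Notation omega := (omega R).
Implicit Types (z h a b u w : R[i]) (s : bool) (m : 'I_3).

(** The linear function is a multiple of [u - u0].  If [u0] is not
    strictly on the same side of the real axis as the sector, [u - u0] stays in the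
    half-plane of the sector; otherwise it stays in the opposite one as soon as the
    half-strip is thin.  A square root has a continuous branch on a half-plane. *)
Lemma sqrt_of_linear_cbrt s p q : (p != 0) || (q != 0) ->
  \forall e \near (0 : R)^'+,
    (forall w, half_strip s e w -> Im w != 0 -> p * strip_cbrt s w + q != 0) /\
    exists a : R[i] -> R[i],
      (forall w, half_strip s e w ->
        (a : C -> C) @ within (half_strip s e) (nbhs (w : C)) --> (a w : C)) /\
      (forall w, half_strip s e w -> a w ^+ 2 = p * strip_cbrt s w + q).
Proof.
have [-> /= q0|p0 _] := eqVneq p 0.
  apply: nearW => e; split; first by move=> w _ _; rewrite mul0r add0r.
  exists (fun=> sqrtc q); split=> w _; first exact: cvg_cst.
  by rewrite sqr_sqrtc mul0r add0r.
set u0 := - q / p.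
have E u : p * u + q = p * (u - u0) by rewrite /u0; field.
(* Multiplication by [- ii] or [ii] turns the half-plane where [u - u0] stays
   into the right half-plane. *)
pose ii : R[i] := 0 +i* (-1) ^+ s.
have ii2 : ii * ii = -1 by apply: complex_eqP; rewrite /ii /=; case: (s);
  rewrite ?expr0 ?expr1; ring.
have [Rii Iii] : Re ii = 0 /\ Im ii = (-1) ^+ s by [].
clearbody ii.
have ucvg e w c : half_strip s e w ->
    (c * (strip_cbrt s x - u0) : C) @[x --> within (half_strip s e) (nbhs (w : C))] -->
      (c * (strip_cbrt s w - u0) : C).
  move=> hw; apply: cvgCM; first exact: cvg_cst.
  apply: cvgCD; last exact: cvg_cst.
  have := strip_cbrt_cvg (half_strip_strip hw); apply: cvg_within_sub => x.
  exact: half_strip_strip.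
have lift e c : (forall w, half_strip s e w -> 0 <= Re (c * (strip_cbrt s w - u0))) ->
  c * c = -1 ->
    exists a : R[i] -> R[i],
      (forall w, half_strip s e w ->
        (a : C -> C) @ within (half_strip s e) (nbhs (w : C)) --> (a w : C)) /\
      (forall w, half_strip s e w -> a w ^+ 2 = p * strip_cbrt s w + q).
  move=> h c2; exists (fun w => sqrtc (- (p * c)) * sqrtc (c * (strip_cbrt s w - u0)));
    split=> w hw.
    apply: cvgCM; first exact: cvg_cst.
    by apply: cvg_sqrtc; [have := h w hw; lra|exact: ucvg].
  rewrite exprMn !sqr_sqrtc E.
  have -> : - (p * c) * (c * (strip_cbrt s w - u0)) =
    - (c * c) * (p * (strip_cbrt s w - u0)) by ring.
  by rewrite c2 opprK mul1r.
have neq w : (-1) ^+ s * Im (strip_cbrt s w) != (-1) ^+ s * Im u0 ->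
  p * strip_cbrt s w + q != 0.
  by move=> h; rewrite E mulf_neq0 // subr_eq0; apply: contra_neq h => ->.
have ReI c w : Re ((c%:C * ii) * (strip_cbrt s w - u0)) =
  c * ((-1) ^+ s * Im u0 - (-1) ^+ s * Im (strip_cbrt s w)).
  by rewrite !ReImE Rii Iii; ring.
have [u00|u00] := lerP ((-1) ^+ s * Im u0) 0.
  apply: nearW => e; split.
    move=> w hw wi; apply: neq; have := strip_cbrt_strict (half_strip_strip hw) wi; lra.
  apply: (lift e ((-1)%:C * ii)).
    move=> w hw; rewrite ReI; have [_ /andP[h _]] := strip_cbrtP (half_strip_strip hw);
      lra.
  by rewrite mulrACA ii2 mulrN1 -rmorphM /= mulrNN mulr1.
apply: filterS (strip_cbrt_Im_small s u00) => e he.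
have he' w : half_strip s e w -> (-1) ^+ s * Im (strip_cbrt s w) < (-1) ^+ s * Im u0.
  move=> /he; apply: le_lt_trans; apply: le_trans (ler_norm _) _.
  by rewrite normrM normrX normrN1 expr1n mul1r.
split; first by move=> w hw _; apply: neq; have := he' w hw; lra.
apply: (lift e (1%:C * ii)); last by rewrite mulrACA ii2 mulrN1 -rmorphM /= mulr1.
by move=> w hw; rewrite ReI; have := he' w hw; lra.
Qed.

(** Rotates the sector of [strip_cbrt s] so that its boundary ray, the image of
    the edge, becomes a ray of the dessin bounding the sector around 1. *)
Definition eta s : R[i] := if s then - omega ^+ 2 else - omega.
Definition strip_coord s w : R[i] := eta s * strip_cbrt s w.

Lemma eta_neq0 s : eta s != 0.
Proof.
have o0 : omega != 0 by apply: contraTneq isT => o; have := omega3 R;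
  rewrite o expr0n => /eqP; rewrite eq_sym oner_eq0.
by rewrite /eta; case: s; rewrite oppr_eq0 ?expf_neq0.
Qed.

Lemma eta_cube s : eta s ^+ 3 = -1.
Proof. by rewrite /eta; case: s; rewrite exprNn ?[omega ^+ 2 ^+ 3]exprAC omega3; ring.
  Qed.

Lemma strip_coord3 s w : strip s w -> strip_coord s w ^+ 3 = - strip_cube w.
Proof. by move=> /strip_cbrtP[ut _]; rewrite exprMn eta_cube ut mulN1r. Qed.

Lemma sqrt_of_linear s p q : (p != 0) || (q != 0) ->
  \forall e \near (0 : R)^'+,
    (forall w, half_strip s e w -> Im w != 0 -> p * strip_coord s w + q != 0) /\
    exists a : R[i] -> R[i],
      (forall w, half_strip s e w ->
        (a : C -> C) @ within (half_strip s e) (nbhs (w : C)) --> (a w : C)) /\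
      (forall w, half_strip s e w -> a w ^+ 2 = p * strip_coord s w + q).
Proof.
move=> pq; have := @sqrt_of_linear_cbrt s (p * eta s) q.
rewrite mulf_eq0 (negbTE (eta_neq0 s)) orbF => /(_ pq).
apply: filterS => e [h1 [a [h2 h3]]]; split.
  by move=> w hw wi; rewrite /strip_coord mulrA; exact: h1.
by exists a; split=> // w hw; rewrite h3 // mulrA.
Qed.

(** The sector around [omega ^+ m] is an intersection of two half-planes; these
    are the conjugates of their inner normals. *)
Definition cone_dual (b : bool) m : R[i] :=
  match val m with
  | 0%N => sqrt3 +i* (if b then 1 else -1)
  | 1%N => (if b then - sqrt3 else 0) +i* (-1)
  | _ => (if b then - sqrt3 else 0) +i* 1
  end.
Definition cone m h : bool :=
  (0 < Re (h * cone_dual false m)) && (0 < Re (h * cone_dual true m)).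

Lemma ord3_ind (P : 'I_3 -> Prop) : P 0 -> P 1 -> P 2%:R -> forall m, P m.
Proof.
move=> p0 p1 p2 [[|[|[|//]]] hm].
- by rewrite (_ : Ordinal hm = 0) //; apply: val_inj.
- by rewrite (_ : Ordinal hm = 1) //; apply: val_inj.
- by rewrite (_ : Ordinal hm = 2%:R) //; apply: val_inj.
Qed.

Lemma cone0E h : cone 0 h = (- (sqrt3 * Re h) < Im h < sqrt3 * Re h).
Proof. by rewrite /cone; case: h => x y /=; congr (_ && _); apply/idP/idP; lra. Qed.
Lemma cone1E h : cone 1 h = (0 < Im h) && (sqrt3 * Re h < Im h).
Proof. by rewrite /cone; case: h => x y /=; congr (_ && _); apply/idP/idP; lra. Qed.
Lemma cone2E h : cone 2%:R h = (Im h < 0) && (Im h < - (sqrt3 * Re h)).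
Proof. by rewrite /cone; case: h => x y /=; congr (_ && _); apply/idP/idP; lra. Qed.
Definition coneE := (cone0E, cone1E, cone2E).

Lemma cone_dual_neq0 (b : bool) m : cone_dual b m != 0.
Proof.
apply/eqP => /(congr1 Im)/eqP; rewrite /cone_dual.
by case: (val m) b => [|[|n]] [] /=; rewrite ?oppr_eq0 oner_eq0.
Qed.

Lemma cone_inj m m' h : cone m h -> cone m' h -> m = m'.
Proof. by move: m m'; apply: ord3_ind; apply: ord3_ind => // h1 h2; exfalso;
  move: h1 h2;
  rewrite !coneE; lra. Qed.

Lemma cone_neq0 m h : cone m h -> h != 0.
Proof. by rewrite /cone; apply: contraTneq => ->; rewrite mul0r /= ltxx. Qed.

Lemma coneZ m (k : R) h : 0 < k -> cone m (k%:C * h) = cone m h.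
Proof.
move=> k0; rewrite /cone; congr (_ && _);
  rewrite -mulrA cReM cImC mul0r subr0 pmulr_rgt0 //.
Qed.

Lemma cone_convex m h h' (t : R) : cone m h -> cone m h' -> 0 <= t <= 1 ->
  cone m (h + t%:C * (h' - h)).
Proof.
move=> /andP[a1 a2] /andP[b1 b2] t01.
have cv (x y : R) : 0 < x -> 0 < y -> 0 < x + t * (y - x) by nra.
have E d : Re ((h + t%:C * (h' - h)) * d) = Re (h * d) + t * (Re (h' * d) - Re (h * d)).
  by case: h {a1 a2} => ? ?; case: h' {b1 b2} => ? ?; case: d => ? ? /=; ring.
by apply/andP; rewrite !E; split; apply: cv.
Qed.

(** With [X := sqrt3 * Re h] and [y := Im h], the imaginary part of the cube is
    proportional to [y * (X - y) * (X + y)]: it vanishes on the six half-lines at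
    angles multiple of [pi / 3], and the real part is nonpositive on three of
    them, the boundaries of the cones. *)
Lemma cone_cube h : (exists m, cone m h) <-> ~ (Im (h ^+ 3) = 0 /\ Re (h ^+ 3) <= 0).
Proof.
have s0 := sqrt3_gt0 R; rewrite cube_Im cube_Re.
set x := Re h; set y := Im h; pose X := sqrt3 * x.
have E1 : y * (3 * x ^+ 2 - y ^+ 2) = y * (X - y) * (X + y).
  by rewrite -(sqrt3_sqr R) /X; ring.
have E2 : 3 * sqrt3 * (x ^+ 3 - 3 * x * y ^+ 2) = X * (X ^+ 2 - 9 * y ^+ 2).
  by rewrite /X exprMn (sqrt3_sqr R); ring.
have E2' : (x ^+ 3 - 3 * x * y ^+ 2 <= 0) = (X * (X ^+ 2 - 9 * y ^+ 2) <= 0).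
  by rewrite -E2 pmulr_rle0 // mulr_gt0.
have neg (t : R) : t < 0 -> 0 < t * (t ^+ 2 - 9 * t ^+ 2).
  by move=> t0; have : 0 < (- t) ^+ 3; [rewrite exprn_gt0 ?oppr_gt0|lra].
rewrite E1 E2'; split.
  move=> [m mh] [/eqP]; rewrite !mulf_eq0 -orbA => /or3P[] /eqP E.
  - rewrite E; have X0 : 0 < X by move: m mh; apply: ord3_ind;
    rewrite coneE -/x -/y -/X; lra.
    by apply/negP; rewrite -ltNge mulr_gt0 //; nra.
  - have X0 : X < 0 by move: m mh; apply: ord3_ind; rewrite coneE -/x -/y -/X; lra.
    have -> : y = X by lra.
    by apply/negP; rewrite -ltNge; exact: neg.
  - have X0 : X < 0 by move: m mh; apply: ord3_ind; rewrite coneE -/x -/y -/X; lra.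
    have -> : y = - X by lra.
    by apply/negP; rewrite -ltNge sqrrN; exact: neg.
move=> H; apply: contrapT => /forallNP N; apply: H.
have := (N 0, N 1, N 2%:R);
  rewrite !coneE -/x -/y -/X => -[[/negP n0 /negP n1] /negP n2].
have [y0|y0|y0] := ltrgtP y 0.
- have -> : X = - y by lra. by split; nra.
- have -> : X = y by lra. by split; nra.
- have : X <= 0 by lra. by split; nra.
Qed.

Lemma cone_separate m a : ~~ cone m a ->
  exists2 c, c != 0 & forall z, cone m z -> 0 < Re ((z - a) * c).
Proof.
rewrite negb_and => /orP[] /negbTE; rewrite ltNge => /negbFE h.
  exists (cone_dual false m); first exact: cone_dual_neq0.
  by move=> z /andP[h' _]; rewrite mulrBl cReD cReN; lra.
exists (cone_dual true m); first exact: cone_dual_neq0.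
by move=> z /andP[_ h']; rewrite mulrBl cReD cReN; lra.
Qed.

Lemma cone_rot m h : cone m (omega ^+ m * h) = cone 0 h.
Proof.
have s0 := sqrt3_gt0 R; have s2 := sqrt3_sqr R.
move: m; apply: ord3_ind; rewrite ?expr0 ?mul1r // !coneE.
  rewrite (_ : nat_of_ord (1 : 'I_3) = 1%N) // expr1 !ReImOm.
  have e : sqrt3 * sqrt3 * Im h = 3 * Im h by rewrite -expr2 s2.
  by apply/idP/idP; lra.
rewrite (_ : nat_of_ord (2%:R : 'I_3) = 2%N) // -omega_conj !ReImOm.
have e : sqrt3 * sqrt3 * Im h = 3 * Im h by rewrite -expr2 s2.
by apply/idP/idP; lra.
Qed.

Lemma cone0_conj h : cone 0 h^* = cone 0 h.
Proof. by rewrite !coneE cReJ cImJ; apply/idP/idP; lra. Qed.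

Lemma cone_strip_coord s w : strip s w -> Im w != 0 -> cone 0 (strip_coord s w).
Proof.
move=> sw wi; have := strip_cbrt_strict sw wi;
  rewrite /strip_coord /eta -omega_conj coneE.
move: (strip_cbrt s w) => u;
  have e : sqrt3 * sqrt3 * Im u = 3 * Im u by rewrite -expr2 sqrt3_sqr.
by case: s sw; rewrite ?expr0 ?expr1 !ReImOm => _; lra.
Qed.

End Cones.

(** * Pencils of binary quadratic forms *)

(** A change of coordinates [l] on the source, and two quadratic forms given by
    the coefficients [c] of the squares of the new coordinates. *)
Record pencil (R : realType) := Pencil {
  l11 : R[i]; l12 : R[i]; l21 : R[i]; l22 : R[i];
  c11 : R[i]; c12 : R[i]; c21 : R[i]; c22 : R[i];
  ldet : l11 * l22 - l12 * l21 != 0;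
  cdet : c11 * c22 - c12 * c21 != 0 }.

Section Pencil.
Variable R : realType.
Local Notation C := (R[i]^o).
Local Notation Re := (@complex.Re R).
Local Notation Im := (@complex.Im R).
Implicit Types (M : pencil R) (a b z w X Y : R[i]) (x : P1 R) (m : 'I_3).

Definition xi1 M X Y := l11 M * X + l12 M * Y.
Definition xi2 M X Y := l21 M * X + l22 M * Y.
Definition res1 M a b := c11 M * a ^+ 2 + c12 M * b ^+ 2.
Definition res2 M a b := c21 M * a ^+ 2 + c22 M * b ^+ 2.
(** The point with new coordinates [a], [b]: the inverse of [l], up to the
    determinant, which is immaterial in homogeneous coordinates. *)
Definition pt M a b : P1 R := to_P1 (l22 M * a - l12 M * b) (l11 M * b - l21 M * a).
(** The invariant in terms of the resolvents, [- 4 v / (1 - v) ^ 2] with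
    [v = (Z1 / Z2) ^ 3], in homogeneous form. *)
Definition j_res (Z1 Z2 : R[i]) : P1 R :=
  to_P1 (- (4 * (Z1 * Z2) ^+ 3)) ((Z2 ^+ 3 - Z1 ^+ 3) ^+ 2).
Definition pxi1 M x := xi1 M (hom1 x) (hom2 x).
Definition pxi2 M x := xi2 M (hom1 x) (hom2 x).
Definition models M (J : P1 R -> P1 R) := forall x,
  J x = j_res (res1 M (pxi1 M x) (pxi2 M x)) (res2 M (pxi1 M x) (pxi2 M x)).

Lemma pt_arg_neq0 M a b : (a != 0) || (b != 0) ->
  (l22 M * a - l12 M * b != 0) || (l11 M * b - l21 M * a != 0).
Proof.
apply: contraTT; rewrite !negb_or !negbK => /andP[/eqP h1 /eqP h2].
have d := ldet M; rewrite -(mulrI_eq0 a (mulfI d)) -(mulrI_eq0 b (mulfI d)).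
apply/andP; split; apply/eqP.
  transitivity (l11 M * (l22 M * a - l12 M * b) + l12 M * (l11 M * b - l21 M * a));
    first by ring.
  by rewrite h1 h2 !mulr0 addr0.
transitivity (l21 M * (l22 M * a - l12 M * b) + l22 M * (l11 M * b - l21 M * a));
  first by ring.
by rewrite h1 h2 !mulr0 addr0.
Qed.

Lemma pt_pxi M x : pt M (pxi1 M x) (pxi2 M x) = x.
Proof.
rewrite -[RHS]to_P1_hom -(to_P1Z _ _ (ldet M)) /pt /pxi1 /pxi2 /xi1 /xi2.
by congr to_P1; ring.
Qed.

Lemma pxi_neq0 M x : (pxi1 M x != 0) || (pxi2 M x != 0).
Proof.
have := hom_neq0 x; apply: contraTT; rewrite !negb_or !negbK => /andP[/eqP h1 /eqP h2].
have d := ldet M; rewrite -(mulrI_eq0 (hom1 x) (mulfI d))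
  -(mulrI_eq0 (hom2 x) (mulfI d)).
apply/andP; split; apply/eqP.
  transitivity (l22 M * pxi1 M x - l12 M * pxi2 M x);
    first by rewrite /pxi1 /pxi2 /xi1 /xi2; ring.
  by rewrite h1 h2 !mulr0 subr0.
transitivity (l11 M * pxi2 M x - l21 M * pxi1 M x);
  first by rewrite /pxi1 /pxi2 /xi1 /xi2; ring.
by rewrite h1 h2 !mulr0 subr0.
Qed.

Lemma pxi_pt M a b : (a != 0) || (b != 0) ->
  exists2 k, k != 0 & pxi1 M (pt M a b) = k * a /\ pxi2 M (pt M a b) = k * b.
Proof.
move=> ab; have [k k0 [h1 h2]] := hom_to_P1 (pt_arg_neq0 M ab).
have d := ldet M; exists ((l11 M * l22 M - l12 M * l21 M) / k).
  by rewrite mulf_neq0 ?invr_eq0.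
rewrite /pxi1 /pxi2 /pt; move: (hom1 _) (hom2 _) h1 h2 => X Y h1 h2.
have -> : X = (l22 M * a - l12 M * b) / k by rewrite h1 mulrC mulKf.
have -> : Y = (l11 M * b - l21 M * a) / k by rewrite h2 mulrC mulKf.
by rewrite /xi1 /xi2; split; ring.
Qed.

Lemma pt_eq M a b a' b' : (a != 0) || (b != 0) -> (a' != 0) || (b' != 0) ->
  a * b' = a' * b -> pt M a b = pt M a' b'.
Proof.
move=> ab ab' E; have [b'0|b'0] := eqVneq b' 0.
  move: ab' E; rewrite b'0 eqxx orbF mulr0 => a'0 /esym/eqP.
  rewrite mulf_eq0 (negbTE a'0) /= => /eqP b0; move: ab; rewrite b0 eqxx orbF => a0.
  have k0 : a / a' != 0 by rewrite mulf_neq0 ?invr_eq0.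
  by rewrite /pt -[in RHS](to_P1Z _ _ k0); congr to_P1; field.
have b0 : b != 0.
  apply: contraTneq ab => b0; move: E; rewrite b0 mulr0 => /eqP.
  by rewrite mulf_eq0 (negbTE b'0) orbF => ->; rewrite eqxx.
have k0 : b / b' != 0 by rewrite mulf_neq0 ?invr_eq0.
have -> : a = b / b' * a' by rewrite -[LHS](mulfK b'0) E; field.
by rewrite /pt -[in RHS](to_P1Z _ _ k0); congr to_P1; field.
Qed.

Lemma pt_inj M a b a' b' : (a != 0) || (b != 0) -> (a' != 0) || (b' != 0) ->
  pt M a b = pt M a' b' -> a * b' = a' * b.
Proof.
move=> /(pxi_pt M)[k k0 [h1 h2]] /(pxi_pt M)[k' k'0 [h1' h2']] E.
move: h1 h2; rewrite E h1' h2' => e1 e2.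
apply: (mulfI k0); rewrite !mulrA -e1 -mulrA; apply: (mulfI k'0).
by rewrite mulrA ![in LHS]mulrA; move: e2; transitivity (k' * a' * (k' * b'));
  [ring|rewrite e2; ring].
Qed.

Lemma resolvents_sq1 M a b : c22 M * res1 M a b - c12 M * res2 M a b =
  (c11 M * c22 M - c12 M * c21 M) * a ^+ 2.
Proof. by rewrite /res1 /res2; ring. Qed.
Lemma resolvents_sq2 M a b : c11 M * res2 M a b - c21 M * res1 M a b =
  (c11 M * c22 M - c12 M * c21 M) * b ^+ 2.
Proof. by rewrite /res1 /res2; ring. Qed.

Lemma resolvents_neq0 M a b : (a != 0) || (b != 0) ->
  (res1 M a b != 0) || (res2 M a b != 0).
Proof.
apply: contraTT; rewrite !negb_or !negbK => /andP[/eqP h1 /eqP h2].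
have := resolvents_sq1 M a b; have := resolvents_sq2 M a b;
  rewrite h1 h2 !mulr0 subr0 => /esym/eqP + /esym/eqP.
by rewrite !mulf_eq0 !(negbTE (cdet M)) /= !orbb => -> ->.
Qed.

Lemma res1Z M k a b : res1 M (k * a) (k * b) = k ^+ 2 * res1 M a b.
Proof. by rewrite /res1; ring. Qed.
Lemma res2Z M k a b : res2 M (k * a) (k * b) = k ^+ 2 * res2 M a b.
Proof. by rewrite /res2; ring. Qed.
Lemma res1N M a b : res1 M (- a) b = res1 M a b. Proof. by rewrite /res1 sqrrN. Qed.
Lemma res2N M a b : res2 M (- a) b = res2 M a b. Proof. by rewrite /res2 sqrrN. Qed.

Lemma j_resZ k Z1 Z2 : k != 0 -> j_res (k * Z1) (k * Z2) = j_res Z1 Z2.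
Proof.
move=> k0; rewrite /j_res -[in RHS](to_P1Z _ _ (expf_neq0 6 k0)); congr to_P1; ring.
Qed.

Lemma J_pt M J a b : models M J -> (a != 0) || (b != 0) ->
  J (pt M a b) = j_res (res1 M a b) (res2 M a b).
Proof.
move=> MJ /(pxi_pt M)[k k0 [h1 h2]]; rewrite MJ h1 h2 res1Z res2Z j_resZ //.
exact: expf_neq0.
Qed.

(** Both squares [a ^+ 2], [b ^+ 2] are determined by the two resolvents, so a
    fibre consists of two points exchanged by a sign. *)
Lemma pt_fiber2 M a b a' b' : (a != 0) || (b != 0) -> (a' != 0) || (b' != 0) ->
  res1 M a b * res2 M a' b' = res2 M a b * res1 M a' b' ->
  pt M a b = pt M a' b' \/ pt M a b = pt M (- a') b'.
Proof.
move=> ab ab' E; have d := cdet M.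
have E' : (a * b') ^+ 2 = (a' * b) ^+ 2.
  apply: (mulfI (mulf_neq0 d d)); apply/eqP; rewrite -subr_eq0; apply/eqP.
  set D := c11 M * c22 M - c12 M * c21 M.
  transitivity ((D * a ^+ 2) * (D * b' ^+ 2) - (D * a' ^+ 2) * (D * b ^+ 2));
    first by ring.
  rewrite /D -(resolvents_sq1 M a b) -(resolvents_sq2 M a' b')
    -(resolvents_sq1 M a' b') -(resolvents_sq2 M a b).
  transitivity (D * (res1 M a b * res2 M a' b' - res2 M a b * res1 M a' b'));
    first by rewrite /D; ring.
  by rewrite E subrr mulr0.
move/eqP: E'; rewrite eqf_sqr => /orP[] /eqP E'; [left|right]; apply: pt_eq => //.
  by rewrite oppr_eq0.
by rewrite mulNr.
Qed.

End Pencil.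

(** * Preimages of the sectors *)

Section Regions.
Variable R : realType.
Local Notation C := (R[i]^o).
Local Notation cj := (@conjc R).
Local Notation Re := (@complex.Re R).
Local Notation Im := (@complex.Im R).
Implicit Types (M : pencil R) (a b z w X Y : R[i]) (x : P1 R) (m : 'I_3).

Lemma mulcJ z : z * (cj z) = (normc z ^+ 2)%:C.
Proof. by rewrite normc_sqr; case: z => a b; apply: complex_eqP => /=; ring. Qed.

Lemma cjM a b : cj (a * b) = cj a * cj b. Proof. exact: rmorphM. Qed.

Lemma cReZ (r : R) z : Re (r%:C * z) = r * Re z.
Proof. by rewrite cReM cImC mul0r subr0. Qed.

Lemma cone_ratio m a b : b != 0 -> cone m (a * (cj b)) = cone m (a / b).
Proof.
move=> b0; have -> : a * (cj b) = (normc b ^+ 2)%:C * (a / b).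
  by rewrite -mulcJ; field.
by rewrite coneZ // exprn_gt0 // normc_gt0.
Qed.

(** Where it is defined, [Z1 / Z2] is a positive multiple of this form, hence in
    the same cones; the form is continuous where [Z2] vanishes too. *)
Definition herm M x := res1 M (pxi1 M x) (pxi2 M x)
  * (cj (res2 M (pxi1 M x) (pxi2 M x))).
(** For a suitable [k] the sign of this form distinguishes the two sheets over a
    sector without branch value. *)
Definition sheet M k x := Re (k * pxi1 M x * (cj (pxi2 M x))).
Definition sector_region M m : set (P1 R) := [set x | cone m (herm M x)].
Definition sheet_region M m k (e : bool) : set (P1 R) :=
  [set x | cone m (herm M x) /\ 0 < (-1) ^+ e * sheet M k x].

Lemma cone_herm_pt M m a b : (a != 0) || (b != 0) ->
  cone m (herm M (pt M a b)) = cone m (res1 M a b * (cj (res2 M a b))).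
Proof.
move=> /(pxi_pt M)[k k0 [h1 h2]]; rewrite /herm h1 h2 res1Z res2Z cjM mulrACA mulcJ.
by rewrite coneZ // exprn_gt0 // normc_gt0 expf_neq0.
Qed.

Lemma sheet_pt M k a b : (a != 0) || (b != 0) ->
  exists2 r : R, 0 < r & sheet M k (pt M a b) = r * Re (k * a * (cj b)).
Proof.
move=> /(pxi_pt M)[c c0 [h1 h2]]; exists (normc c ^+ 2).
  by rewrite exprn_gt0 // normc_gt0.
by rewrite /sheet h1 h2 cjM -cReZ -mulcJ; congr Re; ring.
Qed.

(** With [A := Z1 ^+ 3] and [B := Z2 ^+ 3], one has
    [1 - j = ((A + B) / (B - A)) ^+ 2], so [j] lies in [0, 1] iff
    [(A + B) / (B - A)] is real in [-1, 1], iff [A / B] is real nonpositive or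
    infinite. *)
Lemma j_res_real Z1 Z2 : (Z1 != 0) || (Z2 != 0) ->
  (exists2 t : R, 0 <= t <= 1 & j_res Z1 Z2 = Some t%:C) <->
  (Im ((Z1 * (cj Z2)) ^+ 3) = 0 /\ Re ((Z1 * (cj Z2)) ^+ 3) <= 0).
Proof.
move=> Z0; rewrite exprMn -rmorphXn /=.
have : (Z1 ^+ 3 != 0) || (Z2 ^+ 3 != 0) by rewrite !expf_eq0.
have -> : j_res Z1 Z2 = to_P1 (- (4 * (Z1 ^+ 3 * Z2 ^+ 3))) ((Z2 ^+ 3 - Z1 ^+ 3) ^+ 2).
  by rewrite /j_res exprMn.
move: (Z1 ^+ 3) (Z2 ^+ 3) => A B AB0; split.
  move=> [t /andP[t0 t1]]; rewrite /to_P1; case: ifPn => // BA0 [E].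
  have {}E : (A + B) ^+ 2 = ((Num.sqrt (1 - t))%:C * (B - A)) ^+ 2.
    rewrite exprMn; have -> : (Num.sqrt (1 - t))%:C ^+ 2 = (1 - t)%:C :> R[i].
      by rewrite -rmorphXn sqr_sqrtr ?subr_ge0.
    have -> : (1 - t)%:C = 1 - t%:C :> R[i] by rewrite rmorphB rmorph1.
    by rewrite -E; field; move: BA0; rewrite expf_eq0.
  have [r [r0 r1 {}E]] : exists r : R, [/\ -1 <= r, r <= 1 & A + B = r%:C * (B - A)].
    have s0 := sqrtr_ge0 (1 - t).
    have s1 : Num.sqrt (1 - t) <= 1.
      by rewrite -[leRHS]sqrtr1 ler_wsqrtr //; lra.
    move/eqP: E; rewrite eqf_sqr => /orP[] /eqP E.
      by exists (Num.sqrt (1 - t)); split => //; lra.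
    exists (- Num.sqrt (1 - t)); split; [lra|lra|].
    by rewrite E rmorphN mulNr.
  have {}E : (1 + r)%:C * A = (r - 1)%:C * B.
    have -> : (1 + r)%:C = 1 + r%:C :> R[i] by rewrite rmorphD rmorph1.
    have -> : (r - 1)%:C = r%:C - 1 :> R[i] by rewrite rmorphB rmorph1.
    move/eqP: E; rewrite -subr_eq0 => /eqP E.
    by apply/eqP; rewrite -subr_eq0; apply/eqP; rewrite -E; ring.
  have [rE|rN] := eqVneq (1 + r) 0.
    move: E; rewrite rE mul0r => /esym/eqP; rewrite mulf_eq0 => /orP[].
      by rewrite eq_complex /= => /andP[/eqP]; lra.
    move=> /eqP B0; have -> : (cj B) = 0 by rewrite B0; exact: conjc0.
    by rewrite mulr0.
  have r2 : 0 < 1 + r by rewrite lt_def rN; lra.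
  have {}E : A * (cj B) = ((r - 1) / (1 + r) * normc B ^+ 2)%:C.
    have rC : (1 + r)%:C != 0 by rewrite eq_complex /= eqxx andbT.
    apply: (mulfI rC); transitivity ((r - 1)%:C * (B * cj B)).
      by rewrite [LHS]mulrA [RHS]mulrA; congr (_ * _); exact: E.
    have rCM (x y : R) : x%:C * y%:C = (x * y)%:C :> R[i] by rewrite rmorphM.
    by rewrite mulcJ !rCM; congr (_%:C); field.
  rewrite E; split=> //; rewrite cReC; apply: mulr_le0_ge0; last exact: sqr_ge0.
  by apply: mulr_le0_ge0; [rewrite subr_le0|rewrite invr_ge0 ltW].
move=> [gi gr]; have [B0|B0] := eqVneq B 0.
  move: AB0; rewrite B0 eqxx orbF => A0; exists 0; first by rewrite lexx ler01.
  by rewrite /to_P1 sub0r sqrrN expf_eq0 (negbTE A0) /= mulr0 mulr0 oppr0 mul0r.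
pose q := - Re (A * (cj B)) / normc B ^+ 2.
have n0 : 0 < normc B ^+ 2 by rewrite exprn_gt0 // normc_gt0.
have q0 : 0 <= q by rewrite divr_ge0 ?oppr_ge0 // ltW.
have AE : A = - q%:C * B.
  have Bs0 : (cj B) != 0 by rewrite conjc_eq0.
  have g : A * cj B = (- (q * normc B ^+ 2))%:C.
    by apply: complex_eqP => //; rewrite cReC /q divfK ?gt_eqF // opprK.
  apply: (mulIf Bs0); transitivity (- q%:C * (B * cj B)); last by rewrite mulrA.
  by rewrite g mulcJ mulNr rmorphN rmorphM.
have q1 : 0 < 1 + q by lra.
exists (4 * q / (1 + q) ^+ 2).
  apply/andP; split; first by rewrite divr_ge0 ?sqr_ge0 // mulr_ge0.
  rewrite ler_pdivrMr ?exprn_gt0 // mul1r -subr_ge0.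
  by have -> : (1 + q) ^+ 2 - 4 * q = (1 - q) ^+ 2; [ring|exact: sqr_ge0].
have qC : 1 + q%:C != 0 by rewrite -(rmorph1 (real_complex R)) -rmorphD eq_complex /=
  eqxx andbT gt_eqF.
have -> : (B - A) ^+ 2 = (1 + q%:C) ^+ 2 * B ^+ 2 by rewrite AE; ring.
rewrite /to_P1 mulf_eq0 !expf_eq0 (negbTE qC) (negbTE B0) /=; congr Some.
have -> : (4 * q / (1 + q) ^+ 2)%:C = 4 * q%:C / (1 + q%:C) ^+ 2 :> R[i].
  by rewrite fmorph_div rmorphM rmorph_nat rmorphXn rmorphD rmorph1.
by rewrite AE; field; rewrite qC.
Qed.

Lemma dessinC M (D : trigonal R) : models M (j_invariant D) ->
  ~` dessin D = \bigcup_(m in [set: 'I_3]) sector_region M m.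
Proof.
move=> MJ; apply/seteqP; split=> x.
  move=> nd; have [m mx] : exists m, cone m (herm M x); last by exists m.
  apply/cone_cube => /(j_res_real (resolvents_neq0 M (pxi_neq0 M x)))[t t01 tE];
    apply: nd.
  by exists t; [rewrite /= in_itv|rewrite MJ tE].
move=> [m _ mx] [t /= t01]; rewrite MJ => /esym E.
have /cone_cube : exists m, cone m (herm M x) by exists m.
apply.
by apply/(j_res_real (resolvents_neq0 M (pxi_neq0 M x))); exists t.
Qed.

Section ContinuousForms.
Context (T : Type) (F : set_system T) {FF : Filter F}.
Implicit Types (f g : T -> R[i]) (p q : R[i]).

Lemma cvg_lin p q f g a b : (f : T -> C) @ F --> (a : C) -> (g : T -> C) @ F -->
  (b : C) ->
  (p * f w + q * g w : C) @[w --> F] --> (p * a + q * b : C).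
Proof.
move=> fa gb; apply: cvgCD; (apply: cvgCM; [exact: cvg_cst|]); [exact: fa|exact: gb].
Qed.

Lemma cvg_herm f g a b : (f : T -> C) @ F --> (a : C) -> (g : T -> C) @ F --> (b : C) ->
  (f w * cj (g w) : C) @[w --> F] --> (a * cj b : C).
Proof. by move=> fa gb; apply: cvgCM; [exact: fa|apply: cvg_conjc; exact: gb]. Qed.

Lemma cvg_quad p q f g a b : (f : T -> C) @ F --> (a : C) -> (g : T -> C) @ F -->
  (b : C) ->
  (p * f w ^+ 2 + q * g w ^+ 2 : C) @[w --> F] --> (p * a ^+ 2 + q * b ^+ 2 : C).
Proof. by move=> fa gb; apply: cvg_lin; apply: cvgCX. Qed.

End ContinuousForms.

Lemma cvg_herm_pencil M (F : set_system C) {FF : Filter F} (X Y : R[i] -> R[i]) a b :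
  (X : C -> C) @ F --> (a : C) -> (Y : C -> C) @ F --> (b : C) ->
  (res1 M (xi1 M (X w) (Y w)) (xi2 M (X w) (Y w)) *
   cj (res2 M (xi1 M (X w) (Y w)) (xi2 M (X w) (Y w))) : C) @[w --> F] -->
  (res1 M (xi1 M a b) (xi2 M a b) * cj (res2 M (xi1 M a b) (xi2 M a b)) : C).
Proof.
move=> Xa Yb.
have h1 : (xi1 M (X w) (Y w) : C) @[w --> F] -->
    (xi1 M a b : C) := @cvg_lin C F FF (l11 M) (l12 M) X Y a b Xa Yb.
have h2 : (xi2 M (X w) (Y w) : C) @[w --> F] -->
    (xi2 M a b : C) := @cvg_lin C F FF (l21 M) (l22 M) X Y a b Xa Yb.
have h3 := @cvg_quad C F FF (c11 M) (c12 M) _ _ _ _ h1 h2.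
have h4 := @cvg_quad C F FF (c21 M) (c22 M) _ _ _ _ h1 h2.
exact: (@cvg_herm C F FF _ _ _ _ h3 h4).
Qed.

Lemma open_half M (d : R[i]) : open [set x | 0 < Re (herm M x * d)].
Proof.
pose H X Y := Re (res1 M (xi1 M X Y) (xi2 M X Y)
  * (cj (res2 M (xi1 M X Y) (xi2 M X Y))) * d).
have cH (X Y : R[i] -> R[i]) (z : C) : (X : C -> C) @ nbhs z --> (X z : C) ->
    (Y : C -> C) @ nbhs z --> (Y z : C) -> H (X w) (Y w) @[w --> nbhs z] -->
      H (X z) (Y z).
  by move=> cX cY; apply: cvgRe; apply: cvgCM;
    [exact: cvg_herm_pencil cX cY|exact: cvg_cst].
apply: (@open_P1 R H).
- by move=> z; apply: (cH id (fun=> 1)); [exact: cvg_id|exact: cvg_cst].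
- by move=> z; apply: (cH (fun=> 1) id); [exact: cvg_cst|exact: cvg_id].
move=> c c0; exists (normc (c ^+ 2) ^+ 2);
  first by rewrite exprn_gt0 // normc_gt0 expf_neq0.
move=> X Y; rewrite /H; have ->
  : xi1 M (c * X) (c * Y) = c * xi1 M X Y by rewrite /xi1; ring.
have -> : xi2 M (c * X) (c * Y) = c * xi2 M X Y by rewrite /xi2; ring.
by rewrite res1Z res2Z cjM -cReZ -mulcJ; congr Re; ring.
Qed.

Lemma open_sector_region M m : open (sector_region M m).
Proof.
have -> : sector_region M m = [set x | 0 < Re (herm M x * cone_dual R false m)] `&`
                   [set x | 0 < Re (herm M x * cone_dual R true m)].
  by apply/seteqP; split=> x /= => [/andP[]//|[h1 h2]]; apply/andP.
by apply: openI; exact: open_half.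
Qed.

Lemma open_sheet M (k : R[i]) (e : bool) : open [set x | 0 < (-1) ^+ e * sheet M k x].
Proof.
have -> : [set x | 0 < (-1) ^+ e * sheet M k x] =
  [set x | 0 < Re ((-1) ^+ e * k * pxi1 M x * (cj (pxi2 M x)))].
  apply: eq_set => x; rewrite /sheet; congr (_ < _ = true).
  by case: e; rewrite ?expr0 ?expr1 ?mul1r // !mulN1r !mulNr cReN.
pose H X Y := Re ((-1) ^+ e * k * xi1 M X Y * (cj (xi2 M X Y))).
have cH (X Y : R[i] -> R[i]) (z : C) : (X : C -> C) @ nbhs z --> (X z : C) ->
    (Y : C -> C) @ nbhs z --> (Y z : C) -> H (X w) (Y w) @[w --> nbhs z] -->
      H (X z) (Y z).
  move=> cX cY; apply: cvgRe; apply: cvg_herm; last exact: cvg_lin cX cY.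
  by apply: cvgCM; [exact: cvg_cst|exact: cvg_lin cX cY].
apply: (@open_P1 R H).
- by move=> z; apply: (cH id (fun=> 1)); [exact: cvg_id|exact: cvg_cst].
- by move=> z; apply: (cH (fun=> 1) id); [exact: cvg_cst|exact: cvg_id].
move=> c c0; exists (normc c ^+ 2); first by rewrite exprn_gt0 // normc_gt0.
move=> X Y; rewrite /H; have ->
  : xi1 M (c * X) (c * Y) = c * xi1 M X Y by rewrite /xi1; ring.
have -> : xi2 M (c * X) (c * Y) = c * xi2 M X Y by rewrite /xi2; ring.
by rewrite cjM -cReZ -mulcJ; congr Re; ring.
Qed.

Lemma open_sheet_region M m k e : open (sheet_region M m k e).
Proof.
have -> : sheet_region M m k e =
  sector_region M m `&` [set x | 0 < (-1) ^+ e * sheet M k x] by [].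
by apply: openI; [exact: open_sector_region|exact: open_sheet].
Qed.

(** [c12 / c22] and [c11 / c21] are the branch values, taken where the first
    and the second new coordinate vanish. *)
Definition ramified M m : bool :=
  cone m (c12 M * (cj (c22 M))) || cone m (c11 M * (cj (c21 M))).

(** A linear function that vanishes nowhere on a convex cone has values in a
    half-plane. *)
Lemma halfplane m p q : (p != 0) || (q != 0) -> ~~ cone m (q * (cj p)) ->
  exists2 c, c != 0 & forall z, cone m z -> 0 < Re ((p * z - q) * c).
Proof.
have [-> /= q0 _|p0 _] := eqVneq p 0.
  exists (- q^-1); first by rewrite oppr_eq0 invr_eq0.
  by move=> z _; rewrite mul0r sub0r mulrNN mulfV //= ltr01.
rewrite cone_ratio // => /cone_separate[c c0 h]; exists (c / p).
  by rewrite mulf_neq0 ?invr_eq0.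
move=> z /h; congr (0 < Re _); by field.
Qed.

(** Both square roots have argument less than [pi / 4] in absolute value. *)
Lemma sqrt_pair A B : 0 < Re A -> 0 < Re B -> 0 < Re (sqrtc A * (cj (sqrtc B))).
Proof.
have h X : 0 < Re X -> 0 < Re (sqrtc X) /\ `|Im (sqrtc X)| < Re (sqrtc X).
  move=> X0; have r0 : 0 < Re (sqrtc X) by apply: Re_sqrtc_gt0 => -[_]; lra.
  split=> //; rewrite -(ltr_pXn2r (ltn0Sn 1)) ?nnegrE ?(ltW r0) // real_normK ?num_real
    //.
  by move: X0; rewrite -{1}(sqr_sqrtc X) expr2 cReM -!expr2 subr_gt0.
move=> /h[a0]; rewrite ltr_norml => /andP[a1 a2] /h[b0];
  rewrite ltr_norml => /andP[b1 b2].
rewrite !ReImE.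
have h1 : 0 < (Re (sqrtc A) + Im (sqrtc A)) * (Re (sqrtc B) + Im (sqrtc B))
  by apply: mulr_gt0; lra.
have h2 : 0 < (Re (sqrtc A) - Im (sqrtc A)) * (Re (sqrtc B) - Im (sqrtc B))
  by apply: mulr_gt0; lra.
nra.
Qed.

(** The squares of the new coordinates are linear functions of [z] without zero
    on the sector, so both have square roots there, with arguments within [pi / 4]
    of a constant. *)
Lemma split_param M m : ~~ ramified M m ->
  exists k : R[i], exists f g : R[i] -> R[i],
  [/\ forall z, cone m z -> (f : C -> C) @ nbhs (z : C) --> (f z : C),
      forall z, cone m z -> (g : C -> C) @ nbhs (z : C) --> (g z : C),
      forall z, cone m z -> 0 < Re (k * f z * (cj (g z))) &
      forall z, cone m z -> f z ^+ 2 = c22 M * z - c12 M /\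
        g z ^+ 2 = c11 M - c21 M * z].
Proof.
rewrite negb_or => /andP[nA nB].
have cA : (c22 M != 0) || (c12 M != 0).
  by have := cdet M; apply: contraTT; rewrite negb_or !negbK => /andP[/eqP -> /eqP ->];
    rewrite mulr0 mul0r subrr.
have cB : (- c21 M != 0) || (- c11 M != 0).
  by have := cdet M; apply: contraTT;
    rewrite negb_or !negbK !oppr_eq0 => /andP[/eqP -> /eqP ->];
      rewrite mulr0 mul0r subrr.
have [ca ca0 hA] := halfplane cA nA.
have nB' : ~~ cone m (- c11 M * (cj (- c21 M))) by rewrite rmorphN mulrNN.
have [cb cb0 hB] := halfplane cB nB'.
have {}hB z : cone m z -> 0 < Re ((c11 M - c21 M * z) * cb).
  by move=> /hB; congr (0 < Re _); ring.
have sca0 : sqrtc ca != 0 by rewrite sqrtc_eq0.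
have scb0 : sqrtc cb != 0 by rewrite sqrtc_eq0.
exists (sqrtc ca * (cj (sqrtc cb))).
exists (fun z => sqrtc ((c22 M * z - c12 M) * ca) / sqrtc ca).
exists (fun z => sqrtc ((c11 M - c21 M * z) * cb) / sqrtc cb).
split=> z mz.
- apply: cvgCM; last exact: cvg_cst.
  apply: cvg_sqrtc; first by have := hA z mz; lra.
  apply: cvgCM; last exact: cvg_cst.
  apply: cvgCD; last exact: cvg_cst.
  by apply: cvgCM; [exact: cvg_cst|exact: cvg_id].
- apply: cvgCM; last exact: cvg_cst.
  apply: cvg_sqrtc; first by have := hB z mz; lra.
  apply: cvgCM; last exact: cvg_cst.
  apply: cvgCD; first exact: cvg_cst.
  by apply: cvgCN; apply: cvgCM; [exact: cvg_cst|exact: cvg_id].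
- have := sqrt_pair (hA z mz) (hB z mz); move: (sqrtc (_ * ca)) (sqrtc (_ * cb)) => A B.
  have scb0' : (cj (sqrtc cb)) != 0 by rewrite conjc_eq0.
  congr (0 < Re _); rewrite fmorph_div; field; exact/andP.
- by rewrite !expr_div_n !sqr_sqrtc !mulfK.
Qed.

Lemma cone_omega m : cone m (omega R ^+ m).
Proof.
rewrite -[_ ^+ m]mulr1 cone_rot cone0E Re1 Im1.
by have := sqrt3_gt0 R; lra.
Qed.

(** The sector is star-shaped and each half of its preimage is its image under
    one of the two square roots. *)
Lemma split_region M m : ~~ ramified M m ->
  exists k, [/\ forall e, connected (sheet_region M m k e), forall e,
    sheet_region M m k e !=set0 &
    forall x, sector_region M m x -> sheet M k x != 0].
Proof.
move=> /split_param[k [f [g [cf cg kp sq]]]]; exists k.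
have fg z (e : bool) : cone m z -> ((-1) ^+ e * f z != 0) || (g z != 0).
  move=> /kp; apply: contraTT; rewrite negb_or !negbK => /andP[_ /eqP ->].
  by rewrite conjc0 mulr0 /= ltxx.
have zf z : cone m z -> res1 M (f z) (g z) = (c11 M * c22 M - c12 M * c21 M) * z.
  by move=> /sq[h1 h2]; rewrite /res1 h1 h2; ring.
have zg z : cone m z -> res2 M (f z) (g z) = c11 M * c22 M - c12 M * c21 M.
  by move=> /sq[h1 h2]; rewrite /res2 h1 h2; ring.
have zs (e : bool) a b : res1 M ((-1) ^+ e * a) b = res1 M a b /\
  res2 M ((-1) ^+ e * a) b = res2 M a b.
  by case: e; rewrite ?expr0 ?expr1 ?mulN1r ?mul1r ?res1N ?res2N.
have inO z (e : bool) : cone m z -> sector_region M m (pt M ((-1) ^+ e * f z) (g z)).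
  move=> mz; suff : cone m (herm M (pt M ((-1) ^+ e * f z) (g z))) by [].
  rewrite (cone_herm_pt M m (fg z e mz)).
  rewrite (zs e _ _).1 (zs e _ _).2.
  by rewrite zf // zg // cone_ratio ?cdet // mulrAC mulfV ?cdet // mul1r.
have kkE z (e : bool) : cone m z ->
  0 < (-1) ^+ e * sheet M k (pt M ((-1) ^+ e * f z) (g z)).
  move=> mz; have [r r0 ->] := sheet_pt M k (fg z e mz); have := kp z mz.
  by case: e; rewrite ?expr0 ?expr1 ?mulN1r ?mul1r ?mulrN ?mulNr ?cReN; nra.
have cov x : sector_region M m x -> exists z (e : bool), cone m z /\
  x = pt M ((-1) ^+ e * f z) (g z).
  move=> mx; have z20 : res2 M (pxi1 M x) (pxi2 M x) != 0.
    by have := cone_neq0 mx; rewrite /herm mulf_eq0 negb_or conjc_eq0 => /andP[].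
  pose z := res1 M (pxi1 M x) (pxi2 M x) / res2 M (pxi1 M x) (pxi2 M x).
  have mz : cone m z by rewrite /z -cone_ratio.
  have fg0 := fg z false mz; rewrite expr0 mul1r in fg0.
  have E : res1 M (pxi1 M x) (pxi2 M x) * res2 M (f z) (g z) =
    res2 M (pxi1 M x) (pxi2 M x) * res1 M (f z) (g z).
    by rewrite zf // zg // /z; field.
  exists z; case: (pt_fiber2 (pxi_neq0 M x) fg0 E); rewrite pt_pxi => ->.
    by exists false; rewrite expr0 mul1r.
  by exists true; rewrite expr1 mulN1r.
have img e : sheet_region M m k e =
  (fun z : C => pt M ((-1) ^+ e * f z) (g z)) @` [set z : C | cone m z].
  apply/seteqP; split=> x.
    move=> [mx kx]; have [z [e' [mz xE]]] := cov x mx; exists z => //.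
    suff -> : e = e' by [].
    have := kkE z e' mz; rewrite -xE; move: kx; move: (sheet _ _ _) => r.
    by case: e; case: e' {xE} => //; rewrite ?expr0 ?expr1; lra.
  by move=> [z mz <-]; split; [exact: inO|exact: kkE].
split.
- move=> e; rewrite img; apply: connected_continuous_connected.
    apply: (@connected_star R [set z : C | cone m z] (omega R ^+ m));
      first exact: cone_omega.
    by move=> z t mz t01; apply: cone_convex => //; exact: cone_omega.
  apply/subspace_continuousP => z mz; apply: cvg_to_P1; last exact/pt_arg_neq0/fg.
    apply: cvgCD; last apply: cvgCN; apply: cvgCM; try exact: cvg_cst.
      by apply: cvgCM; [exact: cvg_cst|apply: cvg_within_filter; exact: cf].
    by apply: cvg_within_filter; exact: cg.
  apply: cvgCD; last apply: cvgCN; apply: cvgCM; try exact: cvg_cst.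
    by apply: cvg_within_filter; exact: cg.
  by apply: cvgCM; [exact: cvg_cst|apply: cvg_within_filter; exact: cf].
- move=> e; exists (pt M ((-1) ^+ e * f (omega R ^+ m)) (g (omega R ^+ m))).
  by split; [apply: inO|apply: kkE]; exact: cone_omega.
- move=> x /cov[z [e [mz ->]]]; have := kkE z e mz.
  by case: eqP => // ->; rewrite mulr0 ltxx.
Qed.

End Regions.

(** * Sectors containing a branch value *)

Section Ramified.
Variable R : realType.
Local Notation C := (R[i]^o).
Local Notation cj := (@conjc R).
Local Notation Re := (@complex.Re R).
Local Notation Im := (@complex.Im R).
Implicit Types (M : pencil R) (a b z w X Y : R[i]) (x : P1 R) (m : 'I_3).

(** Lifts the segment from the branch value [c12 / c22] to the image of the
    point.  Normalizing the second resolvent to 1, the squares of the coordinates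
    are affine in the parameter [t]: the first is [t * a ^+ 2] and the second joins
    [(c22 M)^-1] to [b ^+ 2]; the hypothesis says that it does not pass through
    0, so that its square root is continuous. *)
Lemma path_to_branch M m a b :
  cone m (c12 M * cj (c22 M)) -> res2 M a b = 1 -> cone m (res1 M a b) ->
  b != 0 -> ~ (Im (c22 M * b ^+ 2)^-1 = 0 /\ Re (c22 M * b ^+ 2)^-1 <= 0) ->
  connected_component (sector_region M m) (pt M 0 1) (pt M a b).
Proof.
move=> ma z21 mz b0 nr; set rho := (c22 M * b ^+ 2)^-1 in nr.
have c0 : c22 M != 0 by have := cone_neq0 ma;
  rewrite mulf_eq0 negb_or conjc_eq0 => /andP[].
rewrite cone_ratio // in ma.
pose s (t : R) : R[i] := (1 - t)%:C * rho + t%:C.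
pose f (t : R) := pt M ((Num.sqrt t)%:C * a) (b * sqrtc (s t)).
have s_neq (t : R) : 0 <= t <= 1 -> ~ (Im (s t) = 0 /\ Re (s t) <= 0).
  move=> /andP[t0 t1]; rewrite /s cImD cReD cReZ cImM !cImC cReC mul0r !addr0 =>
    -[/eqP].
  rewrite mulf_eq0 cReC subr_eq0 => /orP[/eqP <-|/eqP ri];
    first by rewrite subrr mul0r add0r; lra.
  move=> h; apply: nr; split=> //; rewrite leNgt; apply/negP => r0.
  by move: (Re rho) r0 h => r r0 h; clear -t0 t1 r0 h; nra.
have f_neq0 (t : R) : 0 <= t <= 1 ->
  ((Num.sqrt t)%:C * a != 0) || (b * sqrtc (s t) != 0).
  move=> t01; rewrite [X in _ || X]mulf_neq0 ?orbT // sqrtc_eq0.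
  by apply/eqP => s0; apply: (s_neq t t01); rewrite s0.
have f2 (t : R) : 0 <= t <= 1 -> res2 M ((Num.sqrt t)%:C * a) (b * sqrtc (s t)) = 1 /\
    res1 M ((Num.sqrt t)%:C * a) (b * sqrtc (s t)) = c12 M / c22 M
      + t%:C * (res1 M a b - c12 M / c22 M).
  move=> /andP[t0 _].
  have E1 : (Num.sqrt t)%:C ^+ 2 = t%:C :> R[i] by rewrite -rmorphXn sqr_sqrtr.
  have E2 : (1 - t)%:C = 1 - t%:C :> R[i] by rewrite rmorphB rmorph1.
  have E3 : c21 M * a ^+ 2 = 1 - c22 M * b ^+ 2 by rewrite -z21 /res2; ring.
  rewrite /res1 /res2 !exprMn sqr_sqrtc E1 /s E2 /rho; split.
    by rewrite mulrCA E3; field; rewrite b0.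
  by field; rewrite ?b0 ?c0.
have fO (t : R) : 0 <= t <= 1 -> sector_region M m (f t).
  move=> t01; suff : cone m (herm M (f t)) by [].
  rewrite /f (cone_herm_pt M m (f_neq0 t t01)); have [-> ->] := f2 t t01.
  rewrite (_ : cj 1 = 1) ?mulr1; last exact: conjc1.
  exact: cone_convex.
exists (f @` `[0, 1]%classic).
  split.
  - exists 0; first by rewrite /= in_itv /= lexx ler01.
    apply: pt_eq; [by apply: f_neq0; rewrite lexx ler01|by rewrite oner_eq0 orbT|].
    by rewrite sqrtr0 (rmorph0 (real_complex R)) !mul0r.
  - by move=> x [t /= t01 <-]; apply: fO; move: t01; rewrite in_itv.
  apply: connected_path => t t01.
  have h1 : ((Num.sqrt t')%:C * a : C) @[t' --> within `[0, 1]%classic (nbhs t)] -->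
    ((Num.sqrt t)%:C * a : C).
    apply: cvgCM; last exact: cvg_cst.
    apply: cvg_Complex; last exact: cvg_cst.
    by apply: cvg_within_filter; exact: sqrt_continuous.
  have h2 : (b * sqrtc (s t') : C) @[t' --> within `[0, 1]%classic (nbhs t)] -->
    (b * sqrtc (s t) : C).
    apply: cvgCM; first exact: cvg_cst.
    apply: cvg_sqrtc.
      by move=> [h3 h4]; apply: (s_neq t t01); split=> //; exact: ltW.
    apply: cvgCD; last by apply: cvg_real; exact: cvg_within.
    apply: cvgCM; last exact: cvg_cst.
    apply: cvg_Complex; last exact: cvg_cst.
    by apply: cvgB; [exact: cvg_cst|exact: cvg_within].
  apply: cvg_to_P1; last exact/pt_arg_neq0/f_neq0.
    apply: cvgCD; first by apply: cvgCM; [exact: cvg_cst|exact: h1].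
    by apply: cvgCN; apply: cvgCM; [exact: cvg_cst|exact: h2].
  apply: cvgCD; first by apply: cvgCM; [exact: cvg_cst|exact: h2].
  by apply: cvgCN; apply: cvgCM; [exact: cvg_cst|exact: h1].
exists 1; first by rewrite /= in_itv /= lexx ler01.
have s1 : s 1 = 1 by rewrite /s subrr mul0r add0r.
by rewrite /f s1 sqrtr1 mul1r sqrtc1 mulr1.
Qed.

Lemma swap_ldet M : l21 M * l12 M - l22 M * l11 M != 0.
Proof. by have := ldet M; rewrite -oppr_eq0; congr (_ != 0); ring. Qed.
Lemma swap_cdet M : c12 M * c21 M - c11 M * c22 M != 0.
Proof. by have := cdet M; rewrite -oppr_eq0; congr (_ != 0); ring. Qed.

(** Exchanges the two new coordinates and thereby the two branch values. *)
Definition swap M : pencil R := Pencil (swap_ldet M) (swap_cdet M).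

Lemma pt_swap M a b : pt (swap M) a b = pt M b a.
Proof.
have n1 : -1 != 0 :> R[i] by rewrite oppr_eq0 oner_eq0.
by rewrite /pt -[RHS](to_P1Z _ _ n1) /=; congr to_P1; ring.
Qed.

Lemma sector_region_swap M m : sector_region (swap M) m = sector_region M m.
Proof.
apply/seteqP; split=> x; rewrite /sector_region /= /herm /res1 /res2 /pxi1 /pxi2 /=;
 by rewrite addrC [c22 _ * _ + _]addrC.
Qed.

Lemma res_swap M a b : res1 (swap M) a b = res1 M b a /\ res2 (swap M) a b = res2 M b a.
Proof. by rewrite /res1 /res2 /=; split; rewrite addrC. Qed.

Lemma sector_region_normal M m x : sector_region M m x -> exists a b,
  [/\ x = pt M a b, res2 M a b = 1 & cone m (res1 M a b)].
Proof.
move=> mx; have z20 : res2 M (pxi1 M x) (pxi2 M x) != 0.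
  by have := cone_neq0 mx; rewrite /herm mulf_eq0 negb_or conjc_eq0 => /andP[].
set s := sqrtc (res2 M (pxi1 M x) (pxi2 M x)).
have s0 : s^-1 != 0 by rewrite invr_eq0 sqrtc_eq0.
have E2 : res2 M (s^-1 * pxi1 M x) (s^-1 * pxi2 M x) = 1.
  by rewrite res2Z exprVn sqr_sqrtc mulVf.
have x0 : (s^-1 * pxi1 M x != 0) || (s^-1 * pxi2 M x != 0).
  by rewrite !mulf_eq0 !(negbTE s0) /= pxi_neq0.
have xE : x = pt M (s^-1 * pxi1 M x) (s^-1 * pxi2 M x).
  by rewrite -{1}(pt_pxi M x); apply: pt_eq => //; [exact: pxi_neq0|ring].
exists (s^-1 * pxi1 M x), (s^-1 * pxi2 M x); split => //.
have : cone m (herm M x) by [].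
rewrite {1}xE (cone_herm_pt M m x0) E2 (_ : cj 1 = 1) ?mulr1 //; exact: conjc1.
Qed.

(** Points are joined to the ramification point over the first branch value.  If
    the second branch value lies on the segment to be lifted, it belongs to the
    sector too, and the path goes through the ramification point over it; the two
    ramification points are joined through the midpoint of the branch values. *)
Lemma connected_ramified1 M m : cone m (c12 M * cj (c22 M)) ->
  connected (sector_region M m) /\ sector_region M m !=set0.
Proof.
move=> ma; have n01 : ((0 : R[i]) != 0) || ((1 : R[i]) != 0) by rewrite oner_eq0 orbT.
have n10 : ((1 : R[i]) != 0) || ((0 : R[i]) != 0) by rewrite oner_eq0.
have c220 : c22 M != 0 by have := cone_neq0 ma;
  rewrite mulf_eq0 negb_or conjc_eq0 => /andP[].
have Oa : sector_region M m (pt M 0 1).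
  suff : cone m (herm M (pt M 0 1)) by [].
  by rewrite (cone_herm_pt M m n01) /res1 /res2 expr0n expr1n /= !mulr0 !mulr1 !add0r.
suff h : sector_region M m `<=` connected_component (sector_region M m) (pt M 0 1).
  split; last by exists (pt M 0 1).
  have -> : sector_region M m = connected_component (sector_region M m) (pt M 0 1).
    by apply/seteqP; split=> //; exact: connected_component_sub.
  exact: component_connected.
move=> x /sector_region_normal[a [b [-> z21 mz]]].
pose rho := (c22 M * b ^+ 2)^-1.
have [/andP[b0 nr]|bad] := boolP ((b != 0) && ~~ ((Im rho == 0) && (Re rho <= 0))).
  apply: path_to_branch => // -[i1 i2]; move/negP: nr; apply.
  by rewrite /rho i1 eqxx.
(* The segment to be lifted meets the second branch value at the parameter [t],
   where the square of the second coordinate vanishes. *)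
have [t [t0 t1 tE]] : exists t : R,
  [/\ 0 < t, t <= 1 & (1 - t)%:C + t%:C * (c22 M * b ^+ 2) = 0].
  have [bE|b0] := eqVneq b 0.
    by exists 1; rewrite ltr01 lexx subrr bE expr0n /= !mulr0 addr0; split.
  move: bad; rewrite b0 /= negbK => /andP[/eqP ri strip_sqrt].
  have rN : c22 M * b ^+ 2 != 0 by rewrite mulf_neq0 // expf_neq0.
  have rE : rho = (Re rho)%:C by apply: complex_eqP.
  have r0 : Re rho != 0.
    by apply: contra_neq rN => r0; rewrite -[LHS]invrK -/rho rE r0 rmorph0 invr0.
  have rl : Re rho < 0 by rewrite lt_neqAle r0.
  have r1 : 0 < 1 - Re rho by lra.
  exists (- Re rho / (1 - Re rho)); split.
  - by rewrite divr_gt0 // oppr_gt0.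
  - by rewrite ler_pdivrMr // mul1r; lra.
  have -> : c22 M * b ^+ 2 = (Re rho)%:C^-1 by rewrite -rE /rho invrK.
  have rCV (y : R) : y%:C^-1 = (y^-1)%:C :> R[i] by rewrite fmorphV.
  have rCM (y y' : R) : y%:C * y'%:C = (y * y')%:C :> R[i] by rewrite rmorphM.
  have rCD (y y' : R) : y%:C + y'%:C = (y + y')%:C :> R[i] by rewrite rmorphD.
  rewrite rCV rCM rCD -[RHS](rmorph0 (real_complex R)); congr (_%:C).
  by field; rewrite r0 gt_eqF.
have E3 : c21 M * a ^+ 2 = 1 - c22 M * b ^+ 2 by rewrite -z21 /res2; ring.
have tC : t%:C != 0 by rewrite eq_complex /= eqxx andbT gt_eqF.
have E2 : (1 - t)%:C = 1 - t%:C :> R[i] by rewrite rmorphB rmorph1.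
have ta : t%:C * (c21 M * a ^+ 2) = 1.
  by rewrite E3; apply/eqP; rewrite -subr_eq0 -oppr_eq0 -tE E2; apply/eqP; ring.
have c210 : c21 M != 0 by apply: contra_eq_neq ta => ->;
  rewrite mul0r mulr0 eq_sym oner_eq0.
have a0 : a != 0 by apply: contra_eq_neq ta => ->;
  rewrite expr0n /= !mulr0 eq_sym oner_eq0.
have mb : cone m (c11 M * cj (c21 M)).
  rewrite cone_ratio //.
  have -> : c11 M / c21 M = c12 M / c22 M + t%:C * (res1 M a b - c12 M / c22 M).
    have tb : t%:C * b ^+ 2 = (t%:C - 1) / c22 M.
      apply: (mulfI c220); apply/eqP; rewrite -subr_eq0 -[X in _ == X]tE E2.
      by apply/eqP; field.
    have ta' : t%:C * a ^+ 2 = 1 / c21 M by rewrite -ta; field.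
    transitivity (c12 M / c22 M + (c11 M * (t%:C * a ^+ 2) + c12 M * (t%:C * b ^+ 2))
      - t%:C * (c12 M / c22 M)).
      by rewrite ta' tb; field; rewrite ?c210 ?c220.
    by rewrite /res1; ring.
  by apply: cone_convex => //; [rewrite -cone_ratio|rewrite ltW].
have Ob : connected_component (sector_region M m) (pt M 1 0) (pt M a b).
  rewrite -(pt_swap M 0 1) -(pt_swap M b a) -sector_region_swap; apply: path_to_branch;
    rewrite ?(res_swap M _ _).1 ?(res_swap M _ _).2 //=.
  have -> : (c21 M * a ^+ 2)^-1 = t%:C
    by rewrite -[LHS]mul1r -ta mulfK // mulf_neq0 // expf_neq0.
  by rewrite cReC; lra.
apply: connected_component_trans Ob.
(* The midpoint of the branch values, with second resolvent equal to 1. *)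
pose a' := sqrtc (2 * c21 M)^-1; pose b' := sqrtc (2 * c22 M)^-1.
have n2 : (2 : R[i]) != 0 by rewrite pnatr_eq0.
have a'2 : a' ^+ 2 = (2 * c21 M)^-1 by rewrite sqr_sqrtc.
have b'2 : b' ^+ 2 = (2 * c22 M)^-1 by rewrite sqr_sqrtc.
have a'0 : a' != 0 by rewrite sqrtc_eq0 invr_eq0 mulf_neq0.
have b'0 : b' != 0 by rewrite sqrtc_eq0 invr_eq0 mulf_neq0.
have z2' : res2 M a' b' = 1 by rewrite /res2 a'2 b'2; field; rewrite c210 c220.
have mz' : cone m (res1 M a' b').
  have -> : res1 M a' b' = c12 M / c22 M + (2^-1)%:C * (c11 M / c21 M - c12 M / c22 M).
    have -> : (2^-1)%:C = 2^-1 :> R[i] by rewrite fmorphV rmorph_nat.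
    by rewrite /res1 a'2 b'2; field; rewrite c210 c220.
  by apply: cone_convex; rewrite -?cone_ratio //; lra.
have half (c : R[i]) : c != 0 -> (c * (2 * c)^-1)^-1 = (2 : R)%:C.
  move=> c0; have -> : (2 : R)%:C = 2 :> R[i] by rewrite rmorph_nat.
  by field.
apply: (@connected_component_trans _ _ (pt M a' b')).
  by apply: path_to_branch => //; rewrite b'2 half // cReC; lra.
apply: connected_component_sym;
  rewrite -(pt_swap M 0 1) -(pt_swap M b' a') -sector_region_swap.
apply: path_to_branch; rewrite ?(res_swap M _ _).1 ?(res_swap M _ _).2 //=.
by rewrite a'2 half // cReC; lra.
Qed.

Lemma connected_ramified M m : ramified M m -> connected (sector_region M m) /\
  sector_region M m !=set0.
Proof.
move=> /orP[|h]; first exact: connected_ramified1.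
by rewrite -sector_region_swap; apply: connected_ramified1.
Qed.

End Ramified.

(** * Passages as sections of j *)

Lemma card_finset (T : finType) (P : {set T}) : ([set` P] #= `I_#|P|)%card.
Proof.
have -> : [set` P] = (@enum_val T (mem P)) @` [set: 'I_#|P|].
  apply/seteqP; split=> x /= => [xP|[i _ <-]]; last exact: enum_valP.
  by exists (enum_rank_in xP x) => //; rewrite enum_rankK_in.
apply: card_eq_trans (card_esym card_II); apply: inj_card_eq => i j _ _.
exact: enum_val_inj.
Qed.

Section Sections.
Variable R : realType.
Local Notation C := (R[i]^o).
Local Notation cj := (@conjc R).
Local Notation Re := (@complex.Re R).
Local Notation Im := (@complex.Im R).
Local Notation omega := (omega R).
Implicit Types (a b z w X Y : R[i]) (x : P1 R) (m : 'I_3) (s sw : bool).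
Variables (M : pencil R) (D : trigonal R).
Hypothesis MD : models M (j_invariant D).

(** The six solutions of [j = w] in terms of the resolvents: the index [m] is
    the sector, and [sw] tells which of the two boundary rays the solution
    approaches. *)
Definition strip_res1 s m sw w : R[i] :=
  if sw then omega ^+ m else omega ^+ m * strip_coord s w.
Definition strip_res2 s sw w : R[i] := if sw then strip_coord s w else 1.

(** Square roots of the two linear functions of the resolvents that are the
    squares of the new coordinates, up to a common factor. *)
Definition is_lift (e : R) (i : bool * 'I_3 * bool)
  (ab : (R[i] -> R[i]) * (R[i] -> R[i])) :=
  let: (s, m, sw) := i in forall w, half_strip s e w ->
  [/\ (ab.1 : C -> C) @ within (half_strip s e) (nbhs (w : C)) --> (ab.1 w : C),
      (ab.2 : C -> C) @ within (half_strip s e) (nbhs (w : C)) --> (ab.2 w : C),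
      ab.1 w ^+ 2 = c22 M * strip_res1 s m sw w - c12 M * strip_res2 s sw w,
      ab.2 w ^+ 2 = c11 M * strip_res2 s sw w - c21 M * strip_res1 s m sw w &
      Im w != 0 -> ab.1 w != 0 /\ ab.2 w != 0].

Lemma omega_neq0 n : omega ^+ n != 0.
Proof.
apply: expf_neq0; apply: contra_eq_neq (omega3 R) => ->.
by rewrite expr0n eq_sym oner_eq0.
Qed.

Lemma sqrt_form s m sw p q : (p != 0) || (q != 0) ->
  \forall e \near (0 : R)^'+,
    exists a : R[i] -> R[i], forall w, half_strip s e w ->
    [/\ (a : C -> C) @ within (half_strip s e) (nbhs (w : C)) --> (a w : C),
        a w ^+ 2 = p * strip_res1 s m sw w + q * strip_res2 s sw w &
        Im w != 0 -> a w != 0].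
Proof.
move=> pq.
have h : ((if sw then q else p * omega ^+ m) != 0) ||
  ((if sw then p * omega ^+ m else q) != 0).
  by case: sw; rewrite mulf_eq0 (negbTE (omega_neq0 m)) orbF // orbC.
apply: filterS (sqrt_of_linear s h) => e [h1 [a [h2 h3]]]; exists a => w hw.
have E : a w ^+ 2 = p * strip_res1 s m sw w + q * strip_res2 s sw w.
  by rewrite h3 // /strip_res1 /strip_res2; case: (sw); ring.
split; [exact: h2|exact: E|].
by move=> wi; have := h1 w hw wi; rewrite -h3 // expf_eq0.
Qed.

Lemma exists_lifts : \forall e \near (0 : R)^'+, forall i, exists ab, is_lift e i ab.
Proof.
apply: filter_forall => -[[s m] sw].
have dA : (c22 M != 0) || (- c12 M != 0).
  by have := cdet M; apply: contraTT;
    rewrite negb_or !negbK oppr_eq0 => /andP[/eqP -> /eqP ->];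
      rewrite mulr0 mul0r subrr.
have dB : (- c21 M != 0) || (c11 M != 0).
  by have := cdet M; apply: contraTT;
    rewrite negb_or !negbK oppr_eq0 => /andP[/eqP -> /eqP ->];
      rewrite mulr0 mul0r subrr.
apply: filterS2 (sqrt_form s m sw dA) (sqrt_form s m sw dB) => e [a ha] [b hb].
exists (a, b) => w hw; have [a1 a2 a3] := ha w hw; have [b1 b2 b3] := hb w hw.
split; [exact: a1|exact: b1|by rewrite /= a2 mulNr|by rewrite /= b2 mulNr addrC|].
by move=> wi; split; [exact: a3|exact: b3].
Qed.

Lemma cube_eq z w : z ^+ 3 = w ^+ 3 -> exists m, z = omega ^+ m * w.
Proof.
move=> E; have os := omega_sum R.
have : (z - w) * (z - omega * w) * (z - omega ^+ 2 * w) = 0.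
  transitivity (z ^+ 3 - z ^+ 2 * w * (1 + omega + omega ^+ 2) +
     z * w ^+ 2 * omega * (1 + omega + omega ^+ 2) - omega ^+ 3 * w ^+ 3);
       first by ring.
  by rewrite os omega3 E; ring.
move/eqP; rewrite !mulf_eq0 !subr_eq0 -orbA => /or3P[] /eqP ->.
- by exists 0; rewrite expr0 mul1r.
- by exists 1; rewrite expr1.
- by exists 2%:R.
Qed.

Section FixedWidth.
Variables (e : R) (e0 : 0 < e).
Variable L : bool * 'I_3 * bool -> (R[i] -> R[i]) * (R[i] -> R[i]).
Hypothesis hL : forall i, is_lift e i (L i).

Local Notation idx := (bool * 'I_3 * bool * bool)%type.

Lemma liftP s m sw w : half_strip s e w ->
  [/\ ((L (s, m, sw)).1 : C -> C) @ within (half_strip s e) (nbhs (w : C)) -->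
    ((L (s, m, sw)).1 w : C),
      ((L (s, m, sw)).2 : C -> C) @ within (half_strip s e) (nbhs (w : C)) -->
        ((L (s, m, sw)).2 w : C),
      (L (s, m, sw)).1 w ^+ 2 = c22 M * strip_res1 s m sw w - c12 M * strip_res2 s sw w,
      (L (s, m, sw)).2 w ^+ 2 = c11 M * strip_res2 s sw w
        - c21 M * strip_res1 s m sw w &
      Im w != 0 -> (L (s, m, sw)).1 w != 0 /\ (L (s, m, sw)).2 w != 0].
Proof. by move=> hw; have h : is_lift e (s, m, sw) (L (s, m, sw)) := hL _;
  exact: (h w hw). Qed.

(** Indexed by the side [s] of the segment, the sector, the solution in it and
    the sign of the first square root. *)
Definition section (i : idx) (w : R[i]^o) : P1 R :=
  if `[< half_strip i.1.1.1 e w >] then pt M ((-1) ^+ i.2 * (L i.1).1 w) ((L i.1).2 w)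
    else None.

Lemma section_E (i : idx) w : half_strip i.1.1.1 e w ->
  section i w = pt M ((-1) ^+ i.2 * (L i.1).1 w) ((L i.1).2 w).
Proof. by move=> h; rewrite /section asboolT. Qed.

Lemma lift_res (i : idx) w : half_strip i.1.1.1 e w ->
  res1 M ((-1) ^+ i.2 * (L i.1).1 w) ((L i.1).2 w) =
    (c11 M * c22 M - c12 M * c21 M) * strip_res1 i.1.1.1 i.1.1.2 i.1.2 w /\
  res2 M ((-1) ^+ i.2 * (L i.1).1 w) ((L i.1).2 w) =
    (c11 M * c22 M - c12 M * c21 M) * strip_res2 i.1.1.1 i.1.2 w.
Proof.
case: i => [[[s m] sw] d] /= hw; have [_ _ h1 h2 _] := liftP m sw hw.
by rewrite /res1 /res2 !exprMn sqrr_sign mul1r h1 h2; split; ring.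
Qed.

Lemma strip_res_neq0 s m sw w : (strip_res1 s m sw w != 0) || (strip_res2 s sw w != 0).
Proof. by rewrite /strip_res1 /strip_res2; case: sw;
  rewrite ?omega_neq0 // oner_eq0 orbT. Qed.

Lemma lift_neq0 (i : idx) w : half_strip i.1.1.1 e w ->
  ((-1) ^+ i.2 * (L i.1).1 w != 0) || ((L i.1).2 w != 0).
Proof.
move=> hw; have [E1 E2] := lift_res hw.
have := strip_res_neq0 i.1.1.1 i.1.1.2 i.1.2 w; apply: contraTT.
rewrite negb_or !negbK => /andP[/eqP h1 /eqP h2].
have d := cdet M; move: E1 E2; rewrite h1 h2 /res1 /res2 expr0n /= !mulr0 addr0.
by move=> /esym/eqP + /esym/eqP; rewrite !mulf_eq0 (negbTE d) /= negb_or !negbK => ->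
  ->.
Qed.

Lemma section_cvg s m sw (d : bool) (w : R[i]) : half_strip s e w ->
  section (s, m, sw, d) @ within (half_strip s e) (nbhs (w : C)) -->
    section (s, m, sw, d) w.
Proof.
move=> hw; have [ca cb _ _ _] := liftP m sw hw.
pose i : idx := (s, m, sw, d).
rewrite (@section_E i w hw) /=.
set F := within _ _ in ca cb *.
have h1 : ((-1) ^+ d * (L (s, m, sw)).1 z : C) @[z --> F] -->
  ((-1) ^+ d * (L (s, m, sw)).1 w : C).
  by apply: cvgCM; [exact: cvg_cst|exact: ca].
have h2 : pt M ((-1) ^+ d * (L (s, m, sw)).1 z) ((L (s, m, sw)).2 z) @[z --> F] -->
    pt M ((-1) ^+ d * (L (s, m, sw)).1 w) ((L (s, m, sw)).2 w).
  apply: cvg_to_P1; last exact/pt_arg_neq0/(@lift_neq0 i w hw).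
    apply: cvgCD; first by apply: cvgCM; [exact: cvg_cst|exact: h1].
    by apply: cvgCN; apply: cvgCM; [exact: cvg_cst|exact: cb].
  apply: cvgCD; first by apply: cvgCM; [exact: cvg_cst|exact: cb].
  by apply: cvgCN; apply: cvgCM; [exact: cvg_cst|exact: h1].
apply: cvg_trans h2; apply: near_eq_cvg; apply: (@nearW C (nbhs (w : C))) => z hz.
by rewrite (@section_E i z hz).
Qed.

Lemma omega3n n : (omega ^+ n) ^+ 3 = 1.
Proof. by rewrite exprAC omega3 expr1n. Qed.

Lemma j_res_strip s m sw w : strip s w ->
  j_res (strip_res1 s m sw w) (strip_res2 s sw w) = Some w.
Proof.
move=> sw'; rewrite /j_res.
have g3 := strip_coord3 sw'; have t1 := strip_cube1_neq0 w; have tj := strip_cube_j w.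
have E1 : (strip_res1 s m sw w * strip_res2 s sw w) ^+ 3 = - strip_cube w.
  by rewrite /strip_res1 /strip_res2; case: (sw); rewrite ?mulr1 exprMn omega3n mul1r.
have E2 : (strip_res2 s sw w ^+ 3 - strip_res1 s m sw w ^+ 3) ^+ 2 =
  (1 + strip_cube w) ^+ 2.
  have o3 := omega3n m; rewrite /strip_res1 /strip_res2; case: (sw).
    by rewrite o3 g3; ring.
  by rewrite [(_ * strip_coord s w) ^+ 3]exprMn o3 g3; ring.
rewrite E1 E2 /to_P1 expf_eq0 (negbTE t1) /=; congr Some.
by rewrite mulrN opprK tj mulfK // expf_neq0.
Qed.

Lemma section_j (i : idx) w : half_strip i.1.1.1 e w ->
  j_invariant D (section i w) = Some w.
Proof.
move=> hw; rewrite section_E // (J_pt MD (lift_neq0 hw)); have [-> ->] := lift_res hw.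
by rewrite j_resZ ?cdet // j_res_strip //; exact: half_strip_strip hw.
Qed.

Lemma section_cone (i : idx) w : half_strip i.1.1.1 e w -> Im w != 0 ->
  sector_region M i.1.1.2 (section i w).
Proof.
move=> hw wi; suff : cone i.1.1.2 (herm M (section i w)) by [].
rewrite section_E // (cone_herm_pt M _ (lift_neq0 hw)); have [-> ->] := lift_res hw.
rewrite cjM mulrACA mulcJ coneZ; last by rewrite exprn_gt0 // normc_gt0 cdet.
have g0 := cone_strip_coord (half_strip_strip hw) wi.
rewrite /strip_res1 /strip_res2; case: ifP => _; first by rewrite cone_rot cone0_conj.
by rewrite (_ : cj 1 = 1) ?mulr1 ?cone_rot //; exact: conjc1.
Qed.

(** Sections over different sectors differ.  Over the same sector, equality of
    the two solutions would give [g ^+ 2 = 1] for [g := strip_coord s w], which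
    forces [w = 1].  Finally the sign matters because neither square root
    vanishes off the real axis. *)
Lemma section_inj (i i' : idx) w : i.1.1.1 = i'.1.1.1 -> half_strip i.1.1.1 e w ->
  Im w != 0 ->
  section i w = section i' w -> i = i'.
Proof.
move=> ss hw wi E; have hw' : half_strip i'.1.1.1 e w by rewrite -ss.
have mm : i.1.1.2 = i'.1.1.2.
  have h := section_cone hw wi; have h' := section_cone hw' wi.
  by rewrite E in h; exact: (cone_inj h h').
move: (E); rewrite !section_E // => /(pt_inj (lift_neq0 hw) (lift_neq0 hw')).
case: i i' ss mm hw hw' E => [[[s m] sw] d] [[[s' m'] sw'] d'] /= <- <- hw _ _ E.
have swE : sw = sw'.
  apply: contrapT => nsw; have sw'E : sw' = ~~ sw by case: (sw) nsw; case: (sw').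
  have [_ _ a2 b2 _] := liftP m sw hw; have [_ _ a2' b2' _] := liftP m sw' hw.
  have {}E : strip_res1 s m sw w * strip_res2 s sw' w =
    strip_res2 s sw w * strip_res1 s m sw' w.
    have {}E := congr1 (fun z => z ^+ 2) E.
    move: E; rewrite /= !exprMn !sqrr_sign !mul1r a2 a2' b2 b2' => E.
    apply/eqP; rewrite -subr_eq0 -(mulrI_eq0 _ (mulfI (cdet M))).
    move/eqP: E; rewrite -subr_eq0 => /eqP E; apply/eqP; rewrite -[RHS]E; ring.
  have {E} g2 : strip_coord s w ^+ 2 = 1.
    apply: (mulfI (omega_neq0 m)); move: E; rewrite sw'E /strip_res1 /strip_res2;
      case: (sw) => /= E.
      by rewrite mulr1 -[RHS]mulr1 E; ring.
    by rewrite mulr1 expr2 mulrA E mul1r.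
  have t2 : strip_cube w ^+ 2 = 1.
    by rewrite -sqrrN -(strip_coord3 (half_strip_strip hw)) exprAC g2 expr1n.
  have tj := strip_cube_j w; move/eqP: t2; rewrite sqrf_eq1 => /orP[] /eqP tE.
    move: tj wi; rewrite tE mulr1 => tj; suff -> : w = 1 by rewrite eqxx.
    have n4 : (4 : R[i]) != 0 by rewrite pnatr_eq0.
    by apply: (mulIf n4); rewrite mul1r {2}tj; ring.
  by have := strip_cube1_neq0 w; rewrite tE subrr eqxx.
move: E; rewrite -swE; have [_ _ _ _ /(_ wi)[n1 n2]] := liftP m sw hw.
move=> /(mulIf n2)/(mulIf n1) dd; congr (_, _, _, _).
move: dd n1; case: d; case: d' => //; rewrite ?expr0 ?expr1.
  by move=> /eqP; rewrite eqNr oner_eq0.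
by move=> /esym/eqP; rewrite eqNr oner_eq0.
Qed.

(** Multiplied by [1 + strip_cube w] squared, the equation [j = w] factors into
    the two equations [Z1 ^+ 3 = g ^+ 3 * Z2 ^+ 3] and [Z2 ^+ 3 = g ^+ 3 * Z1 ^+ 3],
    where [g := strip_coord s w]. *)
Lemma section_fiber s w x : half_strip s e w -> Im w != 0 -> j_invariant D x = Some w ->
  exists2 i : idx, i.1.1.1 = s & x = section i w.
Proof.
move=> hw wi; rewrite MD; have x0 := pxi_neq0 M x.
set Z1 := res1 M _ _; set Z2 := res2 M _ _.
rewrite /j_res /to_P1; case: ifPn => // BA; move=> [E].
have g3 := strip_coord3 (half_strip_strip hw); have t1 := strip_cube1_neq0 w;
  have tj := strip_cube_j w.
have {E} : (Z1 ^+ 3 + strip_cube w * Z2 ^+ 3) * (Z2 ^+ 3 + strip_cube w * Z1 ^+ 3) = 0.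
  have n4 : (4 : R[i]) != 0 by rewrite pnatr_eq0.
  apply: (mulfI n4); rewrite mulr0.
  have {}E : - (4 * (Z1 * Z2) ^+ 3) = w * (Z2 ^+ 3 - Z1 ^+ 3) ^+ 2 by rewrite -E divfK.
  transitivity ((4 * strip_cube w) * (Z2 ^+ 3 - Z1 ^+ 3) ^+ 2
    + (4 * (Z1 * Z2) ^+ 3) * (1 + strip_cube w) ^+ 2); first by ring.
  by rewrite -[4 * (Z1 * Z2) ^+ 3]opprK E tj; ring.
have key m sw : Z1 * strip_res2 s sw w = Z2 * strip_res1 s m sw w ->
  exists2 i : idx, i.1.1.1 = s & x = section i w.
  move=> EZ; pose i0 : idx := (s, m, sw, false).
  have [h1 h2] := @lift_res i0 w hw.
  have := @pt_fiber2 R M (pxi1 M x) (pxi2 M x) _ _ x0 (@lift_neq0 i0 w hw).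
  rewrite h1 h2 -/Z1 -/Z2 pt_pxi; case.
  - by rewrite !(mulrCA _ (_ - _)); congr (_ * _); exact: EZ.
  - by move=> xE; exists i0 => //; rewrite section_E.
  - move=> xE; exists (s, m, sw, true) => //; rewrite section_E //= xE.
    by rewrite expr0 expr1 mul1r mulN1r.
move=> /eqP; rewrite mulf_eq0 => /orP[] /eqP E.
  have [|m Em] := @cube_eq Z1 (strip_coord s w * Z2).
    by rewrite exprMn g3 mulNr; apply/eqP; rewrite -subr_eq0 opprK E.
  by apply: (key m false); rewrite /strip_res1 /strip_res2 mulr1 Em; ring.
have [|m Em] := @cube_eq (strip_coord s w * Z1) Z2.
  by rewrite exprMn g3 mulNr; apply/esym/eqP; rewrite -subr_eq0 opprK E.
by apply: (key m true); rewrite /strip_res1 /strip_res2 mulrC Em mulrC.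
Qed.

Definition base s : R[i] := 2^-1 +i* ((-1) ^+ s * e).
Definition open_strip s : set C := [set w | half_strip s e w /\ Im w != 0].

Lemma base_open s : open_strip s (base s).
Proof.
split; last by rewrite /= mulf_neq0 ?signr_eq0 // gt_eqF.
split; first by rewrite /=; lra.
by rewrite /= mulrA -expr2 sqrr_sign mul1r lexx ltW.
Qed.

Lemma open_strip_segment s w (t : R) : half_strip s e w -> 0 < t <= 1 ->
  open_strip s (w + t%:C * (base s - w)).
Proof.
move=> [/andP[w0 w1] /andP[w2 w3]] /andP[t0 t1].
have Er : Re (w + t%:C * (base s - w)) = Re w + t * (2^-1 - Re w).
  by rewrite cReD cReZ cReD cReN.
have Ei : (-1) ^+ s * Im (w + t%:C * (base s - w)) = (-1) ^+ s * Im w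
  + t * (e - (-1) ^+ s * Im w).
  rewrite cImD cImM cReC cImC mul0r addr0 cImD cImN /=.
  by case: (s); rewrite ?expr0 ?expr1; ring.
move: Er Ei; set y := (-1) ^+ s * Im w in w2 w3 *; set r := Re w in w0 w1 * => Er Ei.
have t1' : 0 <= 1 - t by lra.
have h1 : 0 < t * e by exact: mulr_gt0.
have h2 : 0 <= (1 - t) * y by exact: mulr_ge0.
have h3 : 0 <= (1 - t) * (e - y) by apply: mulr_ge0 => //; lra.
have h4 : 0 <= (1 - t) * r by exact: mulr_ge0.
have h5 : 0 <= (1 - t) * (1 - r) by apply: mulr_ge0 => //; lra.
have p : 0 < (-1) ^+ s * Im (w + t%:C * (base s - w)) by rewrite Ei; lra.
split; last by apply: contraTneq p => ->; rewrite mulr0 ltxx.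
split; first by rewrite Er; lra.
by rewrite (ltW p) Ei /=; lra.
Qed.

Lemma connected_open_strip s : connected (open_strip s).
Proof.
apply: (@connected_star R _ (base s)); first exact: base_open.
move=> z t [hz zi] /andP[t0 t1]; have [->|tN] := eqVneq t 1.
  by rewrite mul1r addrC subrK.
have -> : base s + t%:C * (z - base s) = z + (1 - t)%:C * (base s - z).
  have -> : (1 - t)%:C = 1 - t%:C :> R[i] by rewrite rmorphB rmorph1.
  by ring.
apply: open_strip_segment => //; apply/andP; split; last by lra.
by rewrite subr_gt0 lt_neqAle tN.
Qed.

Lemma dense_open_strip s : half_strip s e `<=` closure (open_strip s).
Proof.
move=> w hw B nB.
have c : (w + t%:C * (base s - w) : C) @[t --> (0 : R)^'+] --> (w : C).
  rewrite -[X in _ --> X]addr0 -(mul0r (base s - w)).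
  apply: cvgCD; first exact: cvg_cst.
  apply: cvgCM; last exact: cvg_cst.
  apply: cvg_Complex; last exact: cvg_cst.
  by apply: cvg_at_right_filter; exact: cvg_id.
have h1 : \forall t \near (0 : R)^'+, B (w + t%:C * (base s - w)) := c _ nB.
have h2 : \forall t \near (0 : R)^'+, t <= 1 by exact: nbhs_right_le.
have h3 : \forall t \near (0 : R)^'+, 0 < t by exact: nbhs_right_gt.
have [t [Bt [t1 t0]]] := filter_ex (filterI h1 (filterI h2 h3)).
by exists (w + t%:C * (base s - w)); split=> //; apply: open_strip_segment; rewrite ?t0.
Qed.

Lemma open_strip_dessin (i : idx) w : open_strip i.1.1.1 w ->
  (~` dessin D) (section i w).
Proof.
move=> [hw wi]; rewrite (dessinC MD); exists i.1.1.2 => //; exact: section_cone.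
Qed.

(** A section maps the connected open half-strip off the dessin, hence into one
    region. *)
Lemma section_region (i : idx) U : regions D U -> U (section i (base i.1.1.1)) ->
  forall w, open_strip i.1.1.1 w -> U (section i w).
Proof.
move=> [x _ <-] Ub w ow.
rewrite (same_connected_component Ub).
apply: (@connected_component_max _ _ (section i @` open_strip i.1.1.1));
  last by exists w.
- by exists (base i.1.1.1) => //; exact: base_open.
- by move=> _ [z oz <-]; exact: open_strip_dessin.
apply: connected_continuous_connected; first exact: connected_open_strip.
apply/subspace_continuousP => z [hz _].
by case: i {Ub ow} hz => [[[s m] sw] d] hz;
  apply: (cvg_within_sub (B := half_strip s e)) (section_cvg hz) => ? [].
Qed.

(** A passage solves the same equation as the sections, so it coincides with one
    of them on the open half-strip, which is connected, and on its closure by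
    density. *)
Lemma passagesE U : regions D U ->
  passages D U e = (fun i : idx => (i.1.1.1, section i)) @`
    [set i : idx | U (section i (base i.1.1.1))].
Proof.
move=> rU; apply/seteqP; split=> -[s sg].
  move=> [cs js Us ns].
  have cs' w : half_strip s e w -> sg @ within (half_strip s e) (nbhs (w : C)) --> sg w.
    by move/subspace_continuousP: cs; exact.
  have [j hj] : exists j : 'I_3 * bool * bool, forall w, open_strip s w ->
      sg w = section (s, j.1.1, j.1.2, j.2) w.
    apply: (connected_choice (@hausdorff_P1 R) (@connected_open_strip s)).
    - by exists (base s); exact: base_open.
    - by move=> w [hw _]; apply: (cvg_within_sub (B := half_strip s e)) (cs' w hw) =>
      ? [].
    - move=> [[m sw] d] w [hw _].
      by apply: (cvg_within_sub (B := half_strip s e)) (@section_cvg s m sw d w hw) =>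
        ? [].
    - move=> [[m sw] d] [[m' sw'] d'] w [hw wi] E.
      by have [-> -> ->] := @section_inj (s, m, sw, d) (s, m', sw', d') w erefl hw wi E.
    - move=> w [hw wi]; have [[[[s' m] sw] d] /= -> E] := section_fiber hw wi (js w hw).
      by exists (m, sw, d).
  exists (s, j.1.1, j.1.2, j.2) => /=.
    by rewrite -hj; [apply: Us; case: (base_open s)|exact: base_open].
  congr (_, _); apply/funext => w; have [hw|hw] := pselect (half_strip s e w).
    apply/esym; apply: (within_dense_eq (@hausdorff_P1 R) _ (@dense_open_strip s) cs' _
      hj) => //.
      by move=> ? [].
    by move=> z hz; exact: (@section_cvg s j.1.1 j.1.2 j.2 z hz).
  by rewrite ns // /section asboolF.
move=> [i Ui [<- <-]]; split.
- by apply/subspace_continuousP => w hw; case: i {Ui} hw => [[[s' m] sw] d];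
  exact: section_cvg.
- by move=> w hw; exact: section_j.
- by move=> w hw wi; apply: section_region.
- by move=> w hw; rewrite /section asboolF.
Qed.

Lemma card_passages U : regions D U ->
  (passages D U e #= `I_#|[set i : idx | `[<U (section i (base i.1.1.1))>]]%SET|)%card.
Proof.
move=> rU; rewrite passagesE //.
set A := [set i : idx | _]; set P := [set i : idx | _]%SET.
have AP : A = [set` P] by apply/seteqP; split=> i /=; rewrite inE => /asboolP.
have inj : {in A &, injective (fun i : idx => (i.1.1.1, section i))}.
  move=> i i' _ _ [ss E]; apply: (section_inj ss (w := base i.1.1.1));
    last by rewrite E.
    by case: (base_open i.1.1.1).
  by case: (base_open i.1.1.1).
apply: card_eq_trans (inj_card_eq inj) _; rewrite AP.
exact: card_finset.
Qed.

Lemma card_sector m0 (U : set (P1 R)) :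
  (forall x, U x <-> sector_region M m0 x) ->
  #|[set i : idx | `[<U (section i (base i.1.1.1))>]]%SET| = 8.
Proof.
move=> UO; pose f (j : bool * bool * bool) : idx := (j.1.1, m0, j.1.2, j.2).
have -> : [set i : idx | `[<U (section i (base i.1.1.1))>]]%SET =
  [set f j | j in [set: bool * bool * bool]]%SET.
  apply/setP => i; rewrite inE; apply/asboolP/imsetP => [/UO h|[j _ ->]].
    have [hb bi] := base_open i.1.1.1; have h' := section_cone hb bi.
    exists (i.1.1.1, i.1.2, i.2); first by rewrite inE.
    by case: i {hb bi} h h' => [[[s m] sw] d] h h'; rewrite /f /= (cone_inj h h').
  by apply/UO; have [hb bi] := base_open (f j).1.1.1; exact: (section_cone hb bi).
rewrite card_imset; first by rewrite cardsT !card_prod card_bool.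
by move=> [[s sw] d] [[s' sw'] d'] [-> -> ->].
Qed.

(** Changing the sign of the first square root exchanges the sheets, so exactly
    half of the sections over the sector lie in a given one. *)
Lemma card_half_sector m0 k (b : bool)
  : (forall x, sector_region M m0 x -> sheet M k x != 0) ->
  #|[set i : idx | `[<sheet_region M m0 k b (section i (base i.1.1.1))>]]%SET| = 4.
Proof.
move=> kn.
pose v (j : bool * bool) : R :=
  Re (k * (L (j.1, m0, j.2)).1 (base j.1) * cj ((L (j.1, m0, j.2)).2 (base j.1))).
(* The sign is determined by that of the form with the sign [+1]. *)
pose f (j : bool * bool) : idx := (j.1, m0, j.2, b (+) (v j < 0)).
have sgn s sw d : exists2 r : R, 0 < r &
    sheet M k (section (s, m0, sw, d) (base s)) = r * ((-1) ^+ d * v (s, sw)).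
  have [hb bi] := base_open s; pose i : idx := (s, m0, sw, d).
  have [r r0 E] := sheet_pt M k (@lift_neq0 i _ hb).
  exists r => //; rewrite (@section_E i _ hb) E; congr (_ * _); rewrite /v /=.
  by case: (d); rewrite ?expr0 ?expr1 ?mul1r // !mulN1r mulrN mulNr cReN.
have vn s sw : v (s, sw) != 0.
  have [hb bi] := base_open s; have [r r0 E] := sgn s sw false.
  have := kn _ (@section_cone (s, m0, sw, false) _ hb bi); rewrite /= E expr0 mul1r.
  by rewrite mulf_eq0 negb_or => /andP[].
have key s sw d : sheet_region M m0 k b (section (s, m0, sw, d) (base s)) <->
  d = b (+) (v (s, sw) < 0).
  have [hb bi] := base_open s; have [r r0 E] := sgn s sw d.
  have Oi := @section_cone (s, m0, sw, d) _ hb bi.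
  have -> : sheet_region M m0 k b (section (s, m0, sw, d) (base s)) <->
    0 < (-1) ^+ b * ((-1) ^+ d * v (s, sw)).
    rewrite -(pmulr_rgt0 _ r0) mulrCA -E; split; first by case.
    by move=> h; split.
  have := vn s sw; have [v0|v0|//] := ltrgtP (v (s, sw)) 0 => _.
    by move: (v (s, sw)) v0 => y y0; case: (b); case: (d); rewrite ?expr0 ?expr1 /=;
      split=> //; lra.
  by move: (v (s, sw)) v0 => y y0; case: (b); case: (d); rewrite ?expr0 ?expr1 /=;
    split=> //; lra.
have -> : [set i : idx | `[<sheet_region M m0 k b (section i (base i.1.1.1))>]]%SET =
  [set f j | j in [set: bool * bool]]%SET.
  apply/setP => -[[[s m] sw] d]; rewrite inE;
    apply/asboolP/imsetP => [h|[[s' sw'] _ [-> -> -> ->]]].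
    have [hb bi] := base_open s; have h' := @section_cone (s, m, sw, d) _ hb bi.
    have mE : m0 = m by case: h => h _; exact: (cone_inj h h').
    exists (s, sw); first by rewrite inE.
    by rewrite -mE in h *; move/key: h => ->.
  exact/key.
rewrite card_imset; first by rewrite cardsT !card_prod card_bool.
by move=> [s sw] [s' sw'] [-> -> _].
Qed.

End FixedWidth.

Lemma gon_of_card n (U : set (P1 R)) : regions D U ->
  (forall e (e0 : 0 < e) L (hL : forall i, is_lift e i (L i)),
    #|[set i : bool * 'I_3 * bool * bool |
      `[<U (section e L i (base e i.1.1.1))>]]%SET| = n.*2) ->
  is_gon D n U.
Proof.
move=> rU h; rewrite /is_gon; near=> e.
have e0 : 0 < e by near: e; exact: nbhs_right_gt.
have : forall i, exists ab, is_lift e i ab by near: e; exact: exists_lifts.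
move=> /choice[L hL]; rewrite -(h e e0 L hL); exact: card_passages.
Unshelve. all: by end_near. Qed.

Lemma gon_sector m : regions D (sector_region M m) -> is_gon D 4 (sector_region M m).
Proof. by move=> rU; apply: gon_of_card => // e e0 L hL;
  exact: (card_sector e0 hL (m0 := m)). Qed.

Lemma gon_half_sector m k (b : bool)
  : (forall x, sector_region M m x -> sheet M k x != 0) ->
  regions D (sheet_region M m k b) -> is_gon D 2 (sheet_region M m k b).
Proof. by move=> kn rU; apply: gon_of_card => // e e0 L hL;
  exact: (card_half_sector e0 hL b kn). Qed.
End Sections.

(** * Combinatorial types *)

Section Types.
Variable R : realType.
Local Notation C := (R[i]^o).
Local Notation cj := (@conjc R).
Implicit Types (D : trigonal R) (M : pencil R) (U : set (P1 R)).

Lemma is_gon_inj D m n U : is_gon D m U -> is_gon D n U -> m = n.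
Proof.
rewrite /is_gon => hm hn.
have : \forall e \near (0 : R)^'+, m.*2 = n.*2.
  by apply: filterS2 hm hn => e h1 h2; apply/card_eq_II;
    exact: card_eq_trans (card_esym h1) h2.
by move=> /filter_ex[_]; exact: double_inj.
Qed.

Lemma geq_trans : transitive geq.
Proof. by move=> a b c h1 h2; exact: leq_trans h2 h1. Qed.
Lemma geq_total : total geq.
Proof. by move=> a b; exact: leq_total. Qed.
Lemma geq_anti : antisymmetric geq.
Proof. by move=> a b; rewrite andbC; exact: anti_leq. Qed.

(** The number of passages determines the size of a region, so two enumerations
    of the regions give the same sizes up to order. *)
Lemma combinatorial_typeE (I : eqType) (i0 : I) (l : seq I) (V : I -> set (P1 R))
  (g : I -> nat) D :
  uniq l -> {in l &, injective V} -> V @` [set` l] = regions D ->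
  (forall i, i \in l -> is_gon D (g i) (V i)) ->
  forall s, combinatorial_type D s <-> s = sort geq (map g l).
Proof.
move=> ul injV VR gon s; split.
  move=> [ss [U [injU UR gU]]].
  have /choice[f hf] : forall k, exists i, i \in l /\ V i = U k.
    move=> k; have : regions D (U k) by rewrite -UR; exists k.
    by rewrite -VR => -[i il Vi]; exists i.
  have injf : injective f.
    by move=> k k' E; apply: injU; rewrite -(hf k).2 -(hf k').2 E.
  have pf : perm_eq (map f (enum 'I_(size s))) l.
    apply: uniq_perm => //; first by rewrite map_inj_uniq ?enum_uniq.
    move=> i; apply/mapP/idP => [[k _ ->]|il]; first by case: (hf k).
    have : regions D (V i) by rewrite -VR; exists i.
    rewrite -UR => -[k _ Uk]; exists k; first by rewrite mem_enum.
    by apply: injV => //; [case: (hf k)|rewrite (hf k).2].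
  have sE : s = map g (map f (enum 'I_(size s))).
    rewrite -map_comp -{1}(mkseq_nth 0%N s) /mkseq -val_enum_ord -map_comp.
    apply: eq_map => k /=; apply: is_gon_inj (gU k) _.
    by rewrite -(hf k).2; apply: gon; case: (hf k).
  apply: (sorted_eq geq_trans geq_anti) => //; first exact: sort_sorted geq_total _.
  by rewrite perm_sym perm_sort perm_sym {1}sE perm_map.
move=> ->; split; first exact: sort_sorted geq_total _.
pose e := sort (relpre g geq) l.
have -> : sort geq (map g l) = map g e by rewrite sort_map.
have ue : uniq e by rewrite sort_uniq.
have sz (k : 'I_(size (map g e))) : (k < size e)%N by rewrite -(size_map g).
have me (k : 'I_(size (map g e))) : nth i0 e k \in l.
  by rewrite -(mem_sort (relpre g geq)) mem_nth.
exists (fun k => V (nth i0 e k)); split.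
- move=> k k' /(injV _ _ (me k) (me k'))/eqP.
  by rewrite nth_uniq // => /eqP/val_inj.
- rewrite -VR; apply/seteqP; split=> U.
    by move=> [k _ <-]; exists (nth i0 e k) => //; exact: me.
  move=> [i /= il <-]; have ie : i \in e by rewrite mem_sort.
  have hk : (index i e < size (map g e))%N by rewrite size_map index_mem.
  by exists (Ordinal hk) => //=; rewrite nth_index.
- move=> k; rewrite (nth_map i0) //; apply: gon; exact: me.
Qed.

Definition all_idx : seq ('I_3 * bool) :=
  [:: (0, false); (0, true); (1, false); (1, true); (2%:R, false); (2%:R, true)].
(** A sector with connected preimage is counted once, under the index
    [false]. *)
Definition region_idx (r : 'I_3 -> bool) := [seq i <- all_idx | r i.1 ==> ~~ i.2].
Definition type_of (r : 'I_3 -> bool) : seq nat :=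
  sort geq [seq (if r i.1 then 4 else 2) | i <- region_idx r].

Lemma all_idxP i : i \in all_idx.
Proof. by case: i => m b; move: m; apply: ord3_ind; case: b. Qed.

Lemma region_idxP r m b : ((m, b) \in region_idx r) = (r m ==> ~~ b).
Proof. by rewrite mem_filter all_idxP andbT. Qed.

Lemma type_of_model D M : models M (j_invariant D) ->
  forall s, combinatorial_type D s <-> s = type_of (ramified M).
Proof.
move=> MD.
have /choice[k hk] : forall m, exists k, ~~ ramified M m ->
    [/\ forall e, connected (sheet_region M m k e), forall e,
      sheet_region M m k e !=set0 &
    forall x, sector_region M m x -> sheet M k x != 0].
  move=> m; have [r|/split_region[k hk]] := boolP (ramified M m); first by exists 0.
  by exists k.
pose V (i : 'I_3 * bool) :=
  if ramified M i.1 then sector_region M i.1 else sheet_region M i.1 (k i.1) i.2.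
have VO i x : V i x -> sector_region M i.1 x by rewrite /V; case: ifP => // _ [].
have disj i j x : i \in region_idx (ramified M) -> j \in region_idx (ramified M) ->
  V i x -> V j x -> i = j.
  move=> il jl Vi Vj; have mm := cone_inj (VO i x Vi) (VO j x Vj).
  case: i j il jl Vi Vj mm => [m b] [m' b'] + + + + /= mm;
    rewrite -mm !region_idxP /V /=.
  case: ifP => [r|_] /=; first by case: b; case: b'.
  move=> _ _ [_ h1] [_ h2]; congr (_, _); move: h1 h2; move: (sheet _ _ _) => v.
  by case: b; case: b'; rewrite ?expr0 ?expr1 //; lra.
have nV i : V i !=set0.
  rewrite /V; case: ifPn => [/connected_ramified[]//|r]; by have [_ h _] := hk _ r.
have RE : V @` [set` region_idx (ramified M)] = regions D.
  apply/esym/components_partition.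
  - by move=> i _; rewrite /V; case: ifP => _;
    [exact: open_sector_region|exact: open_sheet_region].
  - move=> i _; rewrite /V; case: ifPn => [/connected_ramified[]//|r];
    by have [h _ _] := hk _ r.
  - by move=> i _; exact: nV.
  - by move=> i j x; exact: disj.
  rewrite (dessinC MD); apply/seteqP; split=> x.
    move=> [m _ mx]; have [r|r] := boolP (ramified M m).
      by exists (m, false); rewrite /= ?region_idxP ?implybT // /V /= r.
    have [_ _ /(_ x mx) kx] := hk m r.
    exists (m, sheet M (k m) x < 0); first by rewrite /= region_idxP (negbTE r).
    rewrite /V /= (negbTE r); split=> //.
    move: (sheet M (k m) x) kx => v v0; have [vn|vp] := ltrP v 0.
      by rewrite expr1; lra.
    by rewrite expr0 mul1r lt_def v0.
  by move=> [i _ /VO Oi]; exists i.1.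
apply: (combinatorial_typeE (0, false) _ _ RE).
- by rewrite filter_uniq.
- move=> i j il jl E; have [x Vx] := nV i; apply: (disj i j x) => //; by rewrite -E.
move=> i il; have rV : regions D (V i) by rewrite -RE; exists i.
move: rV; rewrite /V; case: ifPn => r rV; first exact: gon_sector.
by have [_ _ h] := hk _ r; exact: gon_half_sector.
Qed.

(** The sectors are disjoint and there are only two branch values. *)
Lemma ramified_two M : ~~ [&& ramified M 0, ramified M 1 & ramified M 2%:R].
Proof.
apply/negP => /and3P[]; rewrite /ramified.
by case/orP=> h0; case/orP=> h1; case/orP=> h2;
  first [have := cone_inj h0 h1|have := cone_inj h0 h2|have := cone_inj h1 h2].
Qed.

Lemma type_ofE (r : 'I_3 -> bool) :
  let gons (b : bool) := if b then [:: 4] else [:: 2; 2] in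
  type_of r = sort geq (gons (r 0) ++ gons (r 1) ++ gons (r 2%:R)).
Proof.
by rewrite /type_of /region_idx /=; case E0: (r 0); case E1: (r 1); case E2: (r 2%:R);
  rewrite /= ?E0 ?E1 ?E2.
Qed.

Lemma type_of_ramified M :
  type_of (ramified M) \in [:: [:: 4; 4; 2; 2]; [:: 4; 2; 2; 2; 2];
    [:: 2; 2; 2; 2; 2; 2]]%N.
Proof.
have := ramified_two M; rewrite type_ofE.
by case: (ramified M 0); case: (ramified M 1); case: (ramified M 2%:R).
Qed.

End Types.

(** * From curves to pencils *)

Section CurvePencil.
Variable R : realType.
Local Notation cj := (@conjc R).
Local Notation Re := (@complex.Re R).
Local Notation Im := (@complex.Im R).
Local Notation omega := (omega R).
Implicit Types (D : trigonal R) (M : pencil R) (X Y : R[i]) (p q : {poly R[i]})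
  (x : P1 R).

Definition qform (c2 c1 c0 X Y : R[i]) := c2 * X ^+ 2 + c1 * X * Y + c0 * Y ^+ 2.
Definition pform p X Y := qform p`_2 p`_1 p`_0 X Y.

Lemma pformE p (x0 : R[i]) : (size p <= 3)%N -> p.[x0] = pform p x0 1.
Proof.
move=> sp; rewrite (horner_coef_wide x0 sp) !big_ord_recl big_ord0 /pform /qform /=.
by rewrite /bump /=; ring.
Qed.

(** The resolvents depend only on differences of the [y]s because
    [1 + omega + omega ^+ 2 = 0]. *)
Definition curve_res1 D X Y :=
  pform (y1 D - y3 D) X Y + omega ^+ 2 * pform (y2 D - y3 D) X Y.
Definition curve_res2 D X Y :=
  pform (y1 D - y3 D) X Y + omega * pform (y2 D - y3 D) X Y.

Lemma omegaD2 : omega ^+ 2 = - 1 - omega.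
Proof. by apply/eqP; rewrite -subr_eq0 -(omega_sum R); apply/eqP; ring. Qed.

Lemma j_of_lambda_res P Q : (P != 0) || (Q != 0) ->
  j_of_lambda (to_P1 P Q) = j_res (P + omega ^+ 2 * Q) (P + omega * Q).
Proof.
move=> PQ; have o2 := omegaD2; rewrite /j_res.
have EP : (P + omega ^+ 2 * Q) * (P + omega * Q) = P ^+ 2 - P * Q + Q ^+ 2.
  transitivity (P ^+ 2 + (omega ^+ 2 + omega) * P * Q + omega ^+ 3 * Q ^+ 2);
    first by ring.
  by rewrite omega3 o2; ring.
have EQ : ((P + omega * Q) ^+ 3 - (P + omega ^+ 2 * Q) ^+ 3) ^+ 2 =
    - (27 * P ^+ 2 * Q ^+ 2 * (P - Q) ^+ 2).
  have -> : (P + omega * Q) ^+ 3 - (P + omega ^+ 2 * Q) ^+ 3 =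
      3 * P * Q * (omega - omega ^+ 2) * P
        + 3 * P * Q * (omega ^+ 2 - omega ^+ 3 * omega) * Q
      + (omega ^+ 3 - (omega ^+ 3) ^+ 2) * Q ^+ 3 by ring.
  have d2 : (omega - omega ^+ 2) ^+ 2 = -3.
    transitivity (omega ^+ 2 - 2 * omega ^+ 3 + omega ^+ 3 * omega); first by ring.
    by rewrite omega3 o2; ring.
  rewrite omega3 mul1r expr1n subrr mul0r addr0.
  transitivity (9 * P ^+ 2 * Q ^+ 2 * (P - Q) ^+ 2 * (omega - omega ^+ 2) ^+ 2);
    first by ring.
  by rewrite d2; ring.
rewrite EP EQ /to_P1; have [Q0|Q0] := eqVneq Q 0.
  by rewrite /= Q0 expr0n /= mulr0 mul0r oppr0 eqxx.
rewrite /=.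

have E1 : 27 * (P / Q) ^+ 2 * (P / Q - 1) ^+ 2 =
    - (27 * P ^+ 2 * Q ^+ 2 * (P - Q) ^+ 2) * (- (Q ^+ 6)^-1) by field.
have n6 : - (Q ^+ 6)^-1 != 0 by rewrite oppr_eq0 invr_eq0 expf_neq0.
rewrite /to_P1 E1 mulf_eq0 (negbTE n6) orbF; case: ifPn => // n0; congr Some.
have P0 : P != 0 by apply: contraNneq n0 => ->; apply/eqP; ring.
have PQ0 : P - Q != 0 by apply: contraNneq n0 => ->; apply/eqP; ring.
by field; rewrite PQ0 Q0 P0.
Qed.

Lemma size_y D : crtc 2 D ->
  [/\ (size (y1 D) <= 3)%N, (size (y2 D) <= 3)%N & (size (y3 D) <= 3)%N].
Proof.
case=> + _ _ _; rewrite /max_degree => h.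
have : (maxn (size (y1 D)) (maxn (size (y2 D)) (size (y3 D))) <= 3)%N
  by case: maxn h => // n /= ->.
by rewrite !geq_max => /and3P[].
Qed.

Lemma size_y_sub D : crtc 2 D -> (size (y1 D - y3 D)%R <= 3)%N /\
  (size (y2 D - y3 D)%R <= 3)%N.
Proof.
move=> /size_y[s1 s2 sqrt3]; split; apply: leq_trans (size_polyD _ _) _;
  by rewrite size_polyN geq_max ?s1 ?s2 sqrt3.
Qed.

(** A common zero is a triple intersection, over infinity when [Y = 0]. *)
Lemma pform_no_zero D X Y : crtc 2 D -> (X != 0) || (Y != 0) ->
  (pform (y1 D - y3 D) X Y != 0) || (pform (y2 D - y3 D) X Y != 0).
Proof.
move=> cD; have [s1 s2] := size_y_sub cD; case: cD => h2 _ n1 n2.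
apply: contraTT; rewrite !negb_or !negbK => /andP[/eqP e1 /eqP e2].
have [Y0|Y0] := eqVneq Y 0.
  rewrite andbT; move: e1 e2; rewrite Y0 /pform /qform expr0n /= !mulr0 !addr0 => e1 e2.
  apply/negPn/negP => X0; apply: n2; rewrite h2.
  move/eqP: e1; rewrite mulf_eq0 expf_eq0 /= (negbTE X0) orbF coefB subr_eq0 => /eqP e1.
  move/eqP: e2; rewrite mulf_eq0 expf_eq0 /= (negbTE X0) orbF coefB subr_eq0 => /eqP e2.
  by rewrite e1 e2.
have hz p : pform p X Y = 0 -> pform p (X / Y) 1 = 0.
  have -> : pform p (X / Y) 1 = pform p X Y / Y ^+ 2 by rewrite /pform /qform; field.
  by move=> ->; rewrite mul0r.
exfalso; apply: n1; exists (X / Y).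
have := hz _ e1; rewrite -pformE // hornerD hornerN => /eqP;
  rewrite subr_eq0 => /eqP ->.
by have := hz _ e2; rewrite -pformE // hornerD hornerN => /eqP;
  rewrite subr_eq0 => /eqP ->.
Qed.

Lemma j_invariantE D x : crtc 2 D ->
  j_invariant D x = j_res (curve_res1 D (hom1 x) (hom2 x))
    (curve_res2 D (hom1 x) (hom2 x)).
Proof.
move=> cD; have [s1 s2] := size_y_sub cD; have h := pform_no_zero cD (hom_neq0 x).
rewrite /curve_res1 /curve_res2 -j_of_lambda_res // /j_invariant; congr j_of_lambda.
case: x h => [x0|] h; rewrite /lambda /=; first by rewrite !pformE.
case: cD => -> _ _ _; rewrite /pform /qform !expr1n expr0n /=.
by congr to_P1; ring.
Qed.

Lemma pencil_models D M : crtc 2 D ->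
  (forall X Y, res1 M (xi1 M X Y) (xi2 M X Y) = curve_res1 D X Y) ->
  (forall X Y, res2 M (xi1 M X Y) (xi2 M X Y) = curve_res2 D X Y) ->
  models M (j_invariant D).
Proof. by move=> cD h1 h2 x; rewrite j_invariantE // /pxi1 /pxi2 h1 h2. Qed.

Lemma qform_root (c2 c1 c0 : R[i]) : exists X Y, ((X != 0) || (Y != 0)) /\
  qform c2 c1 c0 X Y = 0.
Proof.
have [->|n2] := eqVneq c2 0.
  by exists 1, 0; rewrite oner_eq0 /qform; split=> //; ring.
exists (- c1 + sqrtc (c1 ^+ 2 - 4 * c2 * c0)), (2 * c2).
have h2 : (2 : R[i]) != 0 by rewrite pnatr_eq0.
rewrite mulf_neq0 ?orbT //; split=> //.
have := sqr_sqrtc (c1 ^+ 2 - 4 * c2 * c0); move: (sqrtc _) => s hs.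
transitivity (c2 * (s ^+ 2 - (c1 ^+ 2 - 4 * c2 * c0))); first by rewrite /qform; ring.
by rewrite hs subrr mulr0.
Qed.

(** The number in question is the resultant of the two forms, and also the
    discriminant of their Wronskian, whose coefficients are [w2], [2 * w1] and [w0].
    If it vanishes, the double root of the Wronskian is a common root; if the
    Wronskian vanishes identically, the forms are proportional. *)
Lemma wronskian_disc (p2 p1 p0 q2 q1 q0 : R[i]) :
  (forall X Y, (X != 0) || (Y != 0) ->
    (qform p2 p1 p0 X Y != 0) || (qform q2 q1 q0 X Y != 0)) ->
  (p2 * q0 - p0 * q2) ^+ 2 - (p2 * q1 - p1 * q2) * (p1 * q0 - p0 * q1) != 0.
Proof.
move=> nz; apply/negP => /eqP; set w1 := p2 * q0 - _; set w2 := p2 * q1 - _; set w0 :=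
  p1 * q0 - _.
move=> W; have bad X Y : (X != 0) || (Y != 0) -> qform p2 p1 p0 X Y = 0 ->
  qform q2 q1 q0 X Y = 0 -> False.
  by move=> XY e1 e2; have := nz X Y XY; rewrite e1 e2 eqxx.
have Ip : p2 * w0 - p1 * w1 + p0 * w2 = 0 by rewrite /w0 /w1 /w2; ring.
have Iq : q2 * w0 - q1 * w1 + q0 * w2 = 0 by rewrite /w0 /w1 /w2; ring.
have [w20|w2N] := eqVneq w2 0; last first.
  apply: (bad (- w1) w2); first by rewrite w2N orbT.
    transitivity (p2 * (w1 ^+ 2 - w2 * w0) + w2 * (p2 * w0 - p1 * w1 + p0 * w2));
      first by rewrite /qform; ring.
    by rewrite W Ip !mulr0 addr0.
  transitivity (q2 * (w1 ^+ 2 - w2 * w0) + w2 * (q2 * w0 - q1 * w1 + q0 * w2));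
    first by rewrite /qform; ring.
  by rewrite W Iq !mulr0 addr0.
move: W; rewrite w20 mul0r subr0 => /eqP; rewrite expf_eq0 /= => /eqP w10.
move: Ip Iq; rewrite w20 w10 !mulr0 !subr0 !addr0 => /eqP + /eqP.
have [w00 _ _|w0N] := eqVneq w0 0; last first.
  rewrite !mulf_eq0 (negbTE w0N) !orbF => /eqP e1 /eqP e2.
  by apply: (bad 1 0); rewrite ?oner_eq0 // /qform ?e1 ?e2; ring.
have pr c X Y : (exists2 p, p != 0 & p * qform q2 q1 q0 X Y = c * qform p2 p1 p0 X Y) ->
    (X != 0) || (Y != 0) -> qform p2 p1 p0 X Y = 0 -> False.
  move=> [p pn E] XY e1; apply: (bad X Y XY e1); apply: (mulfI pn).
  by rewrite E e1 !mulr0.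
move: w00 w10 w20; rewrite /w0 /w1 /w2 => /eqP; rewrite subr_eq0 => /eqP E0 /eqP.
rewrite subr_eq0 => /eqP E1 /eqP; rewrite subr_eq0 => /eqP E2.
have [X [Y [XY e1]]] := qform_root p2 p1 p0.
have [p20|n] := eqVneq p2 0; last first.
  apply: (pr q2 X Y) => //; exists p2 => //; rewrite /qform.
  transitivity (p2 * q2 * X ^+ 2 + (p2 * q1) * X * Y + (p2 * q0) * Y ^+ 2);
    first by ring.
  by rewrite E1 E2; ring.
have [p10|n] := eqVneq p1 0; last first.
  apply: (pr q1 X Y) => //; exists p1 => //; rewrite /qform.
  transitivity ((p1 * q2) * X ^+ 2 + (p1 * q1) * X * Y + (p1 * q0) * Y ^+ 2);
    first by ring.
  by rewrite E0 -E2; ring.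
have [p00|n] := eqVneq p0 0; last first.
  apply: (pr q0 X Y) => //; exists p0 => //; rewrite /qform.
  transitivity ((p0 * q2) * X ^+ 2 + (p0 * q1) * X * Y + (p0 * q0) * Y ^+ 2);
    first by ring.
  by rewrite -E0 -E1; ring.
have [X' [Y' [XY' e2]]] := qform_root q2 q1 q0.
by apply: (bad X' Y' XY' _ e2); rewrite p20 p10 p00 /qform; ring.
Qed.

(** The new coordinates are the two linear factors of the Wronskian: they vanish
    at the critical points of the quotient of the two forms, and over a critical
    value the corresponding member of the pencil is a square. *)
Lemma simultaneous_squares (p2 p1 p0 q2 q1 q0 : R[i]) :
  (p2 * q0 - p0 * q2) ^+ 2 - (p2 * q1 - p1 * q2) * (p1 * q0 - p0 * q1) != 0 ->
  exists M, forall X Y,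
    res1 M (xi1 M X Y) (xi2 M X Y) = qform p2 p1 p0 X Y /\
    res2 M (xi1 M X Y) (xi2 M X Y) = qform q2 q1 q0 X Y.
Proof.
set w1 := p2 * q0 - _; set w2 := p2 * q1 - _; set w0 := p1 * q0 - _ => W.
have n2 : (2 : R[i]) != 0 by rewrite pnatr_eq0.
suff [a [b [c [d [dn [e1 [e2 e3]]]]]]] : exists a b c d : R[i], a * d - b * c != 0 /\
   (p1 * (d * a + c * b) = 2 * p2 * d * b + 2 * p0 * c * a /\
   (q1 * (d * a + c * b) = 2 * q2 * d * b + 2 * q0 * c * a /\
    - w2 * (d * b) + w1 * (d * a + c * b) - w0 * (c * a) != 0)).
  set dd := a * d - b * c in dn.
  (* The values of the forms at the zeros of [c X + d Y] and of [a X + b Y] are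
     the coefficients of the squares; the two equations say that the mixed terms
     vanish. *)
  pose k (f2 f1 f0 : R[i]) := qform f2 f1 f0 d (- c) / dd ^+ 2.
  pose k' (f2 f1 f0 : R[i]) := qform f2 f1 f0 (- b) a / dd ^+ 2.
  have cd : k p2 p1 p0 * k' q2 q1 q0 - k' p2 p1 p0 * k q2 q1 q0 != 0.
    have -> : k p2 p1 p0 * k' q2 q1 q0 - k' p2 p1 p0 * k q2 q1 q0 =
        (- w2 * (d * b) + w1 * (d * a + c * b) - w0 * (c * a)) / dd ^+ 3.
      by rewrite /k /k' /qform /w0 /w1 /w2 /dd; field.
    by rewrite mulf_neq0 // invr_eq0 expf_neq0.
  have sq f2 f1 f0 X Y : f1 * (d * a + c * b) = 2 * f2 * d * b + 2 * f0 * c * a ->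
      k f2 f1 f0 * (a * X + b * Y) ^+ 2 + k' f2 f1 f0 * (c * X + d * Y) ^+ 2 =
        qform f2 f1 f0 X Y.
    move=> E; transitivity (qform f2 f1 f0 X Y +
      (f1 * (d * a + c * b) - (2 * f2 * d * b + 2 * f0 * c * a)) * (a * X + b * Y)
        * (c * X + d * Y) * (- 1) / dd ^+ 2).
      by rewrite /k /k' /qform /dd; field.
    by rewrite E subrr !mul0r addr0.
  exists (@Pencil R a b c d (k p2 p1 p0) (k' p2 p1 p0) (k q2 q1 q0) (k' q2 q1 q0) dn
    cd) => X Y.
  by rewrite /res1 /res2 /xi1 /xi2 /=; split; exact: sq.
have Ip : p2 * w0 - p1 * w1 + p0 * w2 = 0 by rewrite /w0 /w1 /w2; ring.
have Iq : q2 * w0 - q1 * w1 + q0 * w2 = 0 by rewrite /w0 /w1 /w2; ring.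
have [w20|w2N] := eqVneq w2 0.
  move: W; rewrite w20 mul0r subr0 expf_eq0 /= => w1N.
  exists 0, 1, (2 * w1), w0; split.
    by rewrite mul0r mul1r sub0r oppr_eq0 mulf_neq0.
  move: Ip Iq; rewrite w20 !mulr0 !addr0 => /eqP + /eqP;
    rewrite !subr_eq0 => /eqP Ip /eqP Iq.
  split; first by transitivity (2 * (p1 * w1)); [ring|rewrite -Ip; ring].
  split; first by transitivity (2 * (q1 * w1)); [ring|rewrite -Iq; ring].
  have -> : - 0 * (w0 * 1) + w1 * (0 + 2 * w1 * 1) = 2 * w1 ^+ 2 by ring.
  by rewrite mulf_neq0 // expf_neq0.
pose r := sqrtc (w1 ^+ 2 - w2 * w0).
have r2 : r ^+ 2 = w1 ^+ 2 - w2 * w0 by rewrite sqr_sqrtc.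
have rN : r != 0 by rewrite sqrtc_eq0.
have rr' : (w1 + r) * (w1 - r) = w2 * w0.
  by transitivity (w1 ^+ 2 - r ^+ 2); [ring|rewrite r2; ring].
exists w2, (w1 - r), w2, (w1 + r); split.
  have -> : w2 * (w1 + r) - (w1 - r) * w2 = 2 * r * w2 by ring.
  by rewrite !mulf_neq0.
split.
  transitivity (2 * w2 * (p2 * w0 - (p2 * w0 - p1 * w1 + p0 * w2)) + 2 * p0 * w2 * w2);
    first by ring.
  rewrite Ip -[2 * p2 * (w1 + r) * (w1 - r)]mulrA rr'; ring.
split.
  transitivity (2 * w2 * (q2 * w0 - (q2 * w0 - q1 * w1 + q0 * w2)) + 2 * q0 * w2 * w2);
    first by ring.
  rewrite Iq -[2 * q2 * (w1 + r) * (w1 - r)]mulrA rr'; ring.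
rewrite rr'; have -> : - w2 * (w2 * w0) + w1 * ((w1 + r) * w2 + w2 * (w1 - r))
  - w0 * (w2 * w2) =
  2 * w2 * (w1 ^+ 2 - w2 * w0) by ring.
by rewrite !mulf_neq0.
Qed.

Lemma crtc_pencil D : crtc 2 D -> exists M, models M (j_invariant D).
Proof.
move=> cD; set P := y1 D - y3 D; set Q := y2 D - y3 D.
have zE k X Y : pform P X Y + k * pform Q X Y =
    qform (P`_2 + k * Q`_2) (P`_1 + k * Q`_1) (P`_0 + k * Q`_0) X Y.
  by rewrite /pform /qform; ring.
have [] := @simultaneous_squares (P`_2 + omega ^+ 2 * Q`_2) (P`_1 + omega ^+ 2 * Q`_1)
  (P`_0 + omega ^+ 2 * Q`_0)
  (P`_2 + omega * Q`_2) (P`_1 + omega * Q`_1) (P`_0 + omega * Q`_0).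
  apply: wronskian_disc => X Y XY; rewrite -!zE.
  have := pform_no_zero cD XY; rewrite -/P -/Q; apply: contraTT.
  rewrite !negb_or !negbK => /andP[/eqP e1 /eqP e2].
  have oo : omega ^+ 2 - omega != 0.
    apply/eqP => /(congr1 Im); rewrite omegaD2 !ReImOm; have := sqrt3_gt0 R; lra.
  have Q0 : pform Q X Y = 0.
    apply: (mulfI oo); rewrite mulr0 -[RHS](subrr 0) -{1}e1 -e2; ring.
  by move: e1; rewrite Q0 mulr0 addr0 => ->; rewrite eqxx.
move=> M hM; exists M; apply: pencil_models => // X Y; have [h1 h2] := hM X Y.
  by rewrite h1 /curve_res1 zE.
by rewrite h2 /curve_res2 zE.
Qed.

(** The function [lambda] is [(a x^2 + b) / (c x^2 + d)], ramified at 0 and at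
    infinity, so that both resolvents are combinations of the squares of the
    homogeneous coordinates. *)
Definition even_curve (a b c d : R[i]) : trigonal R :=
  Trigonal (a *: 'X^2 + b%:P) (c *: 'X^2 + d%:P) 0.

Lemma even_size (a b : R[i]) : (size (a *: 'X^2 + b%:P : {poly R[i]})%R <= 3)%N.
Proof.
apply: leq_trans (size_polyD _ _) _; rewrite geq_max.
rewrite (leq_trans (size_scale_leq _ _)) ?size_polyXn //.
exact: leq_trans (size_polyC_leq1 _) _.
Qed.

Lemma even_coef (a b : R[i]) : let p := a *: 'X^2 + b%:P : {poly R[i]} in
  [/\ p`_2 = a, p`_1 = 0 & p`_0 = b].
Proof. by split; rewrite coefD coefZ coefXn coefC /= ?mulr1 ?mulr0 ?addr0 ?add0r. Qed.

Lemma even_crtc (a b c d : R[i]) : a != 0 -> a * d - b * c != 0 ->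
  crtc 2 (even_curve a b c d).
Proof.
move=> a0 det; have [a2 a1 a00] := even_coef a b; have [c2 c1 c00] := even_coef c d.
have md : max_degree (even_curve a b c d) = 2.
  rewrite /max_degree /= size_poly0 maxn0.
  have -> : size (a *: 'X^2 + b%:P : {poly R[i]}) = 3.
    apply/eqP; rewrite eqn_leq even_size /= ltnNge; apply/negP => /(nth_default 0).
    by move/eqP; rewrite a2 (negbTE a0).
  by rewrite (maxn_idPl (even_size c d)).
split=> //.
  move=> [x0 /= [e1]]; rewrite horner0 => e2; rewrite e2 in e1; move: e1 e2.
  rewrite !(hornerD, hornerZ, hornerXn, hornerC) => e1 e2.
  have x0E : x0 = 0.
    suff : x0 ^+ 2 * (a * d - b * c) == 0
      by rewrite mulf_eq0 (negbTE det) orbF expf_eq0 => /eqP.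
    apply/eqP; transitivity ((a * x0 ^+ 2 + b) * d - (c * x0 ^+ 2 + d) * b);
      first by ring.
    by rewrite e1 e2 !mul0r subrr.
  move: e1 e2; rewrite x0E expr0n /= !mulr0 !add0r => b0 d0.
  by move/eqP: det; apply; rewrite b0 d0; ring.
rewrite /no_triple_intersection_at_infinity md /= a2 c2 coef0 => -[ac c0].
by move/eqP: a0; rewrite ac c0; apply.
Qed.

Lemma even_pencil (a b c d : R[i]) : a * d - b * c != 0 ->
  (a + omega ^+ 2 * c) * (b + omega * d) - (b + omega ^+ 2 * d) * (a + omega * c) != 0.
Proof.
move=> det; have -> : (a + omega ^+ 2 * c) * (b + omega * d)
  - (b + omega ^+ 2 * d) * (a + omega * c) =
  (omega - omega ^+ 2) * (a * d - b * c) by ring.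
rewrite mulf_neq0 //; apply/eqP => /(congr1 Im); rewrite omegaD2 !ReImOm; have :=
  sqrt3_gt0 R; lra.
Qed.

Lemma id_det : (1 : R[i]) * 1 - 0 * 0 != 0.
Proof. by rewrite mulr1 mulr0 subr0 oner_eq0. Qed.

Definition even_curve_pencil (a b c d : R[i]) (det : a * d - b * c != 0) : pencil R :=
  Pencil id_det (even_pencil det).

Lemma even_models (a b c d : R[i]) (det : a * d - b * c != 0) : a != 0 ->
  models (even_curve_pencil det) (j_invariant (even_curve a b c d)).
Proof.
move=> a0; have [a2 a1 a00] := even_coef a b; have [c2 c1 c00] := even_coef c d.
apply: pencil_models; first exact: even_crtc.
  move=> X Y; rewrite /curve_res1 /=
    !subr0 /pform a2 a1 a00 c2 c1 c00 /res1 /xi1 /xi2 /qform /=; ring.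
move=> X Y; rewrite /curve_res2 /=
  !subr0 /pform a2 a1 a00 c2 c1 c00 /res2 /xi1 /xi2 /qform /=; ring.
Qed.

End CurvePencil.

(** * The three types occur *)

Section Examples.
Variable R : realType.
Local Notation Re := (@complex.Re R).
Local Notation Im := (@complex.Im R).
Local Notation omega := (omega R).

(** The conjugate of [x + omega * y] is [x + omega ^+ 2 * y], so the argument of
    the cone is the square of the latter; its real and imaginary part are [A] and
    [sqrt3 * B]. *)
Lemma cone_branch m (x y : R) :
  let A := x ^+ 2 - x * y - y ^+ 2 / 2 in let B := y ^+ 2 / 2 - x * y in
  cone m ((x%:C + omega ^+ 2 * y%:C) * conjc (x%:C + omega * y%:C)) =
  match val m with
  | 0%N => - A < B < A
  | 1%N => (0 < B) && (A < B)
  | _ => (B < 0) && (B < - A)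
  end.
Proof.
move=> A B; set h := _ * _.
have [hr hi] : Re h = A /\ Im h = sqrt3 R * B.
  have s2 : sqrt3 R * sqrt3 R = 3 by rewrite -expr2 sqrt3_sqr.
  have -> : h = (x%:C + conjc omega * y%:C) * (x%:C + conjc omega * y%:C).
    rewrite /h; have -> : conjc (x%:C + omega * y%:C) = x%:C + conjc omega * y%:C.
      by rewrite -[in RHS](conjc_real x) -[in RHS](conjc_real y) -cjM; exact: rmorphD.
    by rewrite omega_conj.
  rewrite !ReImOm /A /B; split; last by field.
  transitivity (x ^+ 2 - x * y + (1 - sqrt3 R * sqrt3 R) / 4 * y ^+ 2); first by field.
  by rewrite s2; field.
have s0 := sqrt3_gt0 R.
move: m; apply: ord3_ind; rewrite coneE hr hi /=.
- by rewrite -mulrN !ltr_pM2l.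
- by rewrite pmulr_rgt0 // ltr_pM2l.
- by rewrite pmulr_rlt0 // -mulrN ltr_pM2l.
Qed.

Lemma even_type (a b c d : R) : a != 0 -> a * d - b * c != 0 ->
  exists C : trigonal R, crtc 2 C /\
    combinatorial_type C (type_of (fun m =>
      cone m ((b%:C + omega ^+ 2 * d%:C) * conjc (b%:C + omega * d%:C)) ||
      cone m ((a%:C + omega ^+ 2 * c%:C) * conjc (a%:C + omega * c%:C)))).
Proof.
move=> a0 det.
have a0' : a%:C != 0 by rewrite eq_complex /= eqxx andbT.
have det' : a%:C * d%:C - b%:C * c%:C != 0.
  by rewrite -!rmorphM -rmorphB eq_complex /= eqxx andbT.
exists (even_curve a%:C b%:C c%:C d%:C); split; first exact: even_crtc.
exact/(type_of_model (even_models det' a0')).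
Qed.

End Examples.

Local Close Scope complex_scope.
Local Close Scope ring_scope.
Local Close Scope classical_set_scope.

Theorem proposition7 (R : realType) :
  (forall C : trigonal R, crtc 2 C -> exists! s : seq nat, combinatorial_type C s)
  /\
  (forall s : seq nat,
    (exists C : trigonal R, crtc 2 C /\ combinatorial_type C s) <->
    s \in [:: [:: 4; 4; 2; 2]; [:: 4; 2; 2; 2; 2]; [:: 2; 2; 2; 2; 2; 2]]).
Proof.
split=> [C /crtc_pencil[M MC]|s].
  exists (type_of (ramified M)); split; first exact/(type_of_model MC).
  by move=> s /(type_of_model MC).
split.
  move=> [C [/crtc_pencil[M MC] /(type_of_model MC) ->]]; exact: type_of_ramified.
rewrite !inE => /or3P[] /eqP ->.
- have [||C [cC tC]] := @even_type R 1 0 0 1;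
  [by apply/eqP; lra|by apply/eqP; lra|exists C; split=> //].
  move: tC; rewrite type_ofE !cone_branch /=.
  by do 3 (case: ifPn => ?) => //; exfalso; lra.
- have [||C [cC tC]] := @even_type R 1 (-1) 0 1;
  [by apply/eqP; lra|by apply/eqP; lra|exists C; split=> //].
  move: tC; rewrite type_ofE !cone_branch /=.
  by do 3 (case: ifPn => ?) => //; exfalso; lra.
- have [||C [cC tC]] := @even_type R 2 1 1 (-1);
  [by apply/eqP; lra|by apply/eqP; lra|exists C; split=> //].
  move: tC; rewrite type_ofE !cone_branch /=.
  by do 3 (case: ifPn => ?) => //; exfalso; lra.
Qed.
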